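(* Let $M$ be a smooth manifold with a $C^{1,1}$ pseudo-Riemannian metric $g$. Then each point $p\in M$ possesses a basis of totally normal neighborhoods.
   Context: A $C^{1,1}$ pseudo-Riemannian metric is a pseudo-Riemannian metric (symmetric, non-degenerate $(0,2)$-tensor field of constant, arbitrary signature) whose components in smooth charts are continuously differentiable with locally Lipschitz first derivatives. Its Christoffel symbols $\Gamma^k_{g,ij}$ are then locally Lipschitz functions, so the geodesic equation $\ddot c^k+\Gamma_{g,ij}^k(c)\dot c^i\dot c^j=0$ has unique local solutions. For $q\in M$, $\exp_q^g(v):=c(1)$, where $c$ is the $g$-geodesic with $c(0)=q$, $\dot c(0)=v$, for all $v\in T_qM$ for which $c$ exists on $[0,1]$. A neighborhood $U$ of a point $q\in M$ is called a normal neighborhood of $q$ if there exists an open neighborhood $\tilde U$ of $0$ in $T_qM$, starshaped with respect to $0$, such that $\exp_q^g$ is a bi-Lipschitz homeomorphism from $\tilde U$ onto $U$. An open set $U\subseteq M$ is called totally normal if it is a normal neighborhood of each of its points. A basis of totally normal neighborhoods of $p$ means: every neighborhood of $p$ contains a totally normal open set containing $p$. A bi-Lipschitz homeomorphism $f:\tilde U\to U$ is a homeomorphism onto $U$ such that there are constants $c,C>0$ with $c\|u-v\|\le d(f(u),f(v))\le C\|u-v\|$ for all $u,v\in\tilde U$. Here $\|\cdot\|$ is any norm on $T_qM$ and $d$ is the distance on $M$ induced by any fixed smooth background Riemannian metric. *)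

(* Defs.v *)
From HB Require Import structures.
From mathcomp Require Import all_boot all_order all_algebra.
From mathcomp Require Import all_classical all_reals all_analysis.

Set Implicit Arguments.
Unset Strict Implicit.
Unset Printing Implicit Defensive.

Import Order.TTheory GRing.Theory Num.Theory numFieldNormedType.Exports.

Local Open Scope classical_set_scope.
Local Open Scope ring_scope.

(** * Regularity classes on open subsets of R^n *)

Definition partial (R : realType) (n : nat) (W : normedModType R) (i : 'I_n)
    (f : 'rV[R]_n -> W) : 'rV[R]_n -> W :=
  'D_(delta_mx 0 i) f.

Fixpoint Ck (R : realType) (n : nat) (W : normedModType R) (k : nat)
    (A : set 'rV[R]_n) (f : 'rV[R]_n -> W) : Prop :=
  {within A, continuous f} /\
  if k is k'.+1 then
    forall i : 'I_n, (forall x, A x -> derivable f x (delta_mx 0 i)) /\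
                     Ck k' A (partial i f)
  else True.

Definition smooth (R : realType) (n : nat) (W : normedModType R)
    (A : set 'rV[R]_n) (f : 'rV[R]_n -> W) : Prop :=
  forall k, Ck k A f.

Definition locally_lipschitz (R : realType) (n : nat) (W : normedModType R)
    (A : set 'rV[R]_n) (f : 'rV[R]_n -> W) : Prop :=
  forall x, A x -> exists2 B, nbhs x B & [lipschitz f y | y in A `&` B].

Definition C11 (R : realType) (n : nat) (W : normedModType R)
    (A : set 'rV[R]_n) (f : 'rV[R]_n -> W) : Prop :=
  Ck 1 A f /\ forall i : 'I_n, locally_lipschitz A (partial i f).

(** * Smooth manifolds *)

(* [chart_map] and [chart_inv] are total functions, but only their restrictions
   to [chart_dom] and [chart_map @` chart_dom] are meaningful. *)
Record chart (R : realType) (n : nat) (M : topologicalType) := Chart {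
  chart_dom : set M ;
  chart_map : M -> 'rV[R]_n ;
  chart_inv : 'rV[R]_n -> M ;
  chart_dom_open : open chart_dom ;
  chart_img_open : open (chart_map @` chart_dom) ;
  chart_mapK : {in chart_dom, cancel chart_map chart_inv} ;
  chart_map_continuous : {within chart_dom, continuous chart_map} ;
  chart_inv_continuous :
    {within chart_map @` chart_dom, continuous chart_inv} }.

Definition chart_img (R : realType) (n : nat) (M : topologicalType)
    (x : chart R n M) : set 'rV[R]_n := chart_map x @` chart_dom x.

Definition compatible (R : realType) (n : nat) (M : topologicalType)
    (x y : chart R n M) : Prop :=
  let D := chart_dom x `&` chart_dom y in
  smooth (chart_map x @` D) (chart_map y \o chart_inv x) /\
  smooth (chart_map y @` D) (chart_map x \o chart_inv y).

(* The atlas is maximal, so its members are exactly the smooth charts.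
   [chart_at] selects a smooth chart around each point; the tangent space T_qM
   is represented by 'rV[R]_n through the coordinate basis of [chart_at q], so
   that vectors and bilinear forms on T_qM are row vectors and square matrices.
   Expressions in other charts are obtained through [frame] below. *)
Record manifold (R : realType) (n : nat) := Manifold {
  carrier :> topologicalType ;
  manifold_hausdorff : hausdorff_space carrier ;
  manifold_second_countable : @second_countable carrier ;
  atlas : set (chart R n carrier) ;
  atlas_compatible : forall x y, atlas x -> atlas y -> compatible x y ;
  atlas_maximal :
    forall x, (forall y, atlas y -> compatible x y) -> atlas x ;
  chart_at : carrier -> chart R n carrier ;
  chart_at_atlas : forall q, atlas (chart_at q) ;
  chart_at_dom : forall q, chart_dom (chart_at q) q }.

(* The vector d/dx^i of the chart x at q, as an element of T_qM. *)
Definition frame (R : realType) (n : nat) (M : manifold R n)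
    (x : chart R n M) (q : M) (i : 'I_n) : 'rV[R]_n :=
  partial i (chart_map (chart_at q) \o chart_inv x) (chart_map x q).

(** * Metrics *)

Definition bform (R : realType) (n : nat) (G : 'M[R]_n) (u v : 'rV[R]_n) : R :=
  (u *m G *m v^T) 0 0.

(* The component g_ij of g in the chart x, as a function of the coordinates. *)
Definition component (R : realType) (n : nat) (M : manifold R n)
    (g : M -> 'M[R]_n) (x : chart R n M) (i j : 'I_n) (a : 'rV[R]_n) : R :=
  let q := chart_inv x a in bform (g q) (frame x q i) (frame x q j).

(* The rows of P form an orthonormal basis whose first r vectors are negative
   and whose other vectors are positive. *)
Definition has_signature (R : realType) (n r : nat) (G : 'M[R]_n) : Prop :=
  exists2 P : 'M[R]_n, P \in unitmx &
    P *m G *m P^T = diag_mx (\row_i (if (i < r)%N then -1 else 1)).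

Record C11_pseudo_riemannian (R : realType) (n : nat) (M : manifold R n)
    (g : M -> 'M[R]_n) : Prop := {
  metric_sym : forall q u v, bform (g q) u v = bform (g q) v u ;
  metric_nondegenerate :
    forall q u, (forall v, bform (g q) u v = 0) -> u = 0 ;
  metric_signature : exists r, forall q, has_signature r (g q) ;
  metric_C11 :
    forall x, atlas x -> forall i j, C11 (chart_img x) (component g x i j) }.

Record smooth_riemannian (R : realType) (n : nat) (M : manifold R n)
    (h : M -> 'M[R]_n) : Prop := {
  riem_sym : forall q u v, bform (h q) u v = bform (h q) v u ;
  riem_pos : forall q u, u != 0 -> 0 < bform (h q) u u ;
  riem_smooth :
    forall x, atlas x -> forall i j, smooth (chart_img x) (component h x i j) }.

(** * Geodesics and the exponential map *)

(* Gamma^k_ij = 1/2 g^kl (d_i g_jl + d_j g_il - d_l g_ij) in the chart x. *)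
Definition christoffel (R : realType) (n : nat) (M : manifold R n)
    (g : M -> 'M[R]_n) (x : chart R n M) (k i j : 'I_n) (a : 'rV[R]_n) : R :=
  2^-1 * \sum_l invmx (\matrix_(r, s) component g x r s a) k l *
    (partial i (component g x j l) a + partial j (component g x i l) a -
     partial l (component g x i j) a).

(* Only meaningful for I an open interval: the derivatives are two-sided. *)
Definition geodesic (R : realType) (n : nat) (M : manifold R n)
    (g : M -> 'M[R]_n) (I : set R) (c : R -> M) : Prop :=
  {within I, continuous c} /\
  forall t x, I t -> atlas x -> chart_dom x (c t) ->
    let c_x : R -> 'rV[R]_n := chart_map x \o c in
    [/\ \forall s \near t, derivable c_x s 1,
        derivable (derive1 c_x) t 1 &
        forall k, derive1 (derive1 c_x) t 0 k +
          \sum_i \sum_j christoffel g x k i j (c_x t) *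
            derive1 c_x t 0 i * derive1 c_x t 0 j = 0].

(* The velocity of c at t, as an element of T_{c(t)}M. *)
Definition velocity (R : realType) (n : nat) (M : manifold R n)
    (c : R -> M) (t : R) : 'rV[R]_n :=
  derive1 (chart_map (chart_at (c t)) \o c) t.

(* A geodesic on [0, 1] is the restriction of one defined on an open interval
   containing [0, 1]; this avoids one-sided derivatives at the end points. *)
Definition exp_rel (R : realType) (n : nat) (M : manifold R n)
    (g : M -> 'M[R]_n) (q : M) (v : 'rV[R]_n) (y : M) : Prop :=
  exists (e : R) (c : R -> M),
    [/\ 0 < e, geodesic g `](- e), (1 + e)[ c,
        c 0 = q, velocity c 0 = v & c 1 = y].

Definition exp_dom (R : realType) (n : nat) (M : manifold R n)
    (g : M -> 'M[R]_n) (q : M) : set 'rV[R]_n :=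
  [set v | exists y, exp_rel g q v y].

(* Takes the junk value q outside of [exp_dom g q]. *)
Definition exp_map (R : realType) (n : nat) (M : manifold R n)
    (g : M -> 'M[R]_n) (q : M) (v : 'rV[R]_n) : M :=
  xget q (exp_rel g q v).

(** * Riemannian distance *)

(* C^1 on a closed interval means C^1 on an open interval containing it. *)
Definition C1_segment (R : realType) (n : nat) (M : manifold R n)
    (c : R -> M) : Prop :=
  exists2 e : R, 0 < e &
    {within `](- e), (1 + e)[, continuous c} /\
    forall (t : R) (x : chart R n M),
      - e < t < 1 + e -> atlas x -> chart_dom x (c t) ->
      (\forall s \near t, derivable (chart_map x \o c : R -> 'rV[R]_n) s 1) /\
      {for t, continuous (derive1 (chart_map x \o c : R -> 'rV[R]_n))}.

Definition segment_length (R : realType) (n : nat) (M : manifold R n)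
    (h : M -> 'M[R]_n) (c : R -> M) : R :=
  \int[lebesgue_measure]_(t in `[0, 1])
    Num.sqrt (bform (h (c t)) (velocity c t) (velocity c t)).

(* [path_of_length h p q l]: some piecewise C^1 path, i.e. a finite
   concatenation of C^1 segments, goes from p to q and has h-length l. *)
Inductive path_of_length (R : realType) (n : nat) (M : manifold R n)
    (h : M -> 'M[R]_n) : M -> M -> R -> Prop :=
| path_nil p : path_of_length h p p 0
| path_cons c q l :
    C1_segment c -> path_of_length h (c 1) q l ->
    path_of_length h (c 0) q (segment_length h c + l).

(* Equal to +oo when p and q lie in different components of M. *)
Definition riem_dist (R : realType) (n : nat) (M : manifold R n)
    (h : M -> 'M[R]_n) (p q : M) : \bar R :=
  ereal_inf [set l%:E | l in path_of_length h p q].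

(** * Normal neighborhoods *)

Definition is_norm (R : realType) (n : nat) (N : 'rV[R]_n -> R) : Prop :=
  [/\ forall u v, N (u + v) <= N u + N v,
      forall (a : R) u, N (a *: u) = `|a| * N u &
      forall u, N u = 0 -> u = 0].

Definition bilipschitz_homeo (R : realType) (n : nat) (M : manifold R n)
    (h : M -> 'M[R]_n) (N : 'rV[R]_n -> R)
    (V : set 'rV[R]_n) (U : set M) (f : 'rV[R]_n -> M) : Prop :=
  [/\ set_bij V U f,
      {within V, continuous f},
      (exists2 finv : M -> 'rV[R]_n,
         {in V, cancel f finv} & {within U, continuous finv}) &
      exists a b : R, [/\ 0 < a, 0 < b &
        forall u v, V u -> V v ->
          ((a * N (u - v))%:E <= riem_dist h (f u) (f v))%E /\
          (riem_dist h (f u) (f v) <= (b * N (u - v))%:E)%E]].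

(* g is the metric defining the exponential map; the background metric h and
   the norm N on T_qM enter only through the bi-Lipschitz condition. *)
Definition normal_nbhd (R : realType) (n : nat) (M : manifold R n)
    (g h : M -> 'M[R]_n) (N : 'rV[R]_n -> R) (q : M) (U : set M) : Prop :=
  nbhs q U /\
  exists V : set 'rV[R]_n,
    [/\ open V, V 0,
        forall v (t : R), V v -> 0 <= t <= 1 -> V (t *: v),
        V `<=` exp_dom g q &
        bilipschitz_homeo h N V U (exp_map g q)].

Definition totally_normal (R : realType) (n : nat) (M : manifold R n)
    (g h : M -> 'M[R]_n) (N : M -> 'rV[R]_n -> R) (U : set M) : Prop :=
  open U /\ forall q, U q -> normal_nbhd g h (N q) q U.

(* Main.v *)
(* In a chart around [p], multiply by cut-offs so that the spray
   [H c z = - Gamma(c)(z, z)] becomes globally Lipschitz with a small constant.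
   Picard iteration then solves the geodesic equation on [-2, 2] from every initial
   condition, and comparing two solutions with the same starting point gives
   [|E v - E w - (v - w)| <= |v - w| / 2] for the time-one map [E]: it is a
   perturbation of the identity, hence a bi-Lipschitz homeomorphism of R^n, and
   this needs no differentiability of the exponential map.  For [U] take a small
   Euclidean coordinate ball.  The second derivative of [|c - p|^2] along a geodesic
   is [2 |c'|^2 - 2 <c - p, Gamma(c)(c', c')>], which is nonnegative near [p], so
   geodesics of [U] joining two points of [U] stay in [U]: the preimage of [U]
   under [exp_q] is starshaped for every [q] in [U].

   That a solution in one chart is a geodesic in all charts follows from the
   covariance of the Euler-Lagrange expression of the energy, which rests on the
   symmetry of second derivatives.  The Riemannian distance is bounded below by
   integrating the derivative of a truncated coordinate distance along paths, and
   above by the length of coordinate segments. *)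

Require Import Defs.
From HB Require Import structures.
From mathcomp Require Import all_boot all_order all_algebra.
From mathcomp Require Import all_classical all_reals all_analysis.
From mathcomp Require Import ring lra.

Set Implicit Arguments.
Unset Strict Implicit.
Unset Printing Implicit Defensive.

Import Order.TTheory GRing.Theory Num.Theory numFieldNormedType.Exports.

Local Open Scope classical_set_scope.
Local Open Scope ring_scope.

(** * Calculus on the real line *)

(** Row vectors carry the max norm, in which all Lipschitz estimates are made; [U] is a Euclidean
    ball because the squared distance must be differentiated twice. The small Lipschitz constant
    comes for free: the spray is quadratic in the velocity, so truncating velocities at [s] gives a
    constant of order [s]. The cut-offs are coordinatewise truncations, which are 1-Lipschitz;
    Picard iteration asks for no more. The price is that the truncated equation is no longer
    homogeneous, so rescaling and the identification with geodesics hold only where the truncations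
    are inactive. An endpoint in [U] forces an initial velocity below [4 * eps]; the curve then
    stays within [25 * eps] of the centre with velocity below [12 * eps], which fixes the size of
    [eps]. A second obstacle is that the exponential map is defined by choice among all geodesics of
    [M] with the given initial data. Uniqueness must therefore hold against curves that could leave
    the chart, and is proved by continuation along [0, 1]. All estimates are uniform in the starting
    point, so one [U] serves all its points. *)

Lemma real_induction (R : realType) (a b : R) (P : R -> Prop) :
  P a ->
  (forall t, a <= t -> t < b -> (forall s, a <= s <= t -> P s) ->
     exists2 d, 0 < d & forall s, t < s < t + d -> P s) ->
  (forall t, a < t -> t <= b -> (forall s, a <= s < t -> P s) -> P t) ->
  forall t, a <= t <= b -> P t.
Proof.
move=> Pa Popen Pclosed t /andP[at_ tb].
have ab : a <= b := le_trans at_ tb.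
(* Membership asks for [P] on the whole segment from [a], so that [P] holds everywhere below the
   supremum. *)
pose S := [set t : R | a <= t <= b /\ forall s, a <= s <= t -> P s].
have Sa : S a.
  split; first by rewrite lexx.
  by move=> s /andP[h1 h2]; have -> : s = a by apply/eqP; rewrite eq_le h1 h2.
have hS : has_sup S.
  by split; [exists a | exists b => s [/andP[]]].
pose T := sup S.
have aT : a <= T by apply: ub_le_sup => //; case: hS.
have Tb : T <= b by apply: ge_sup; [exists a | move=> s [/andP[]]].
have PltT s : a <= s < T -> P s.
  move=> /andP[h1 h2].
  have [u Su su] := sup_gt (ex_intro _ a Sa) h2.
  by case: Su => _; apply; rewrite h1 ltW.
have PT : P T.
  have [->//|aneT] := eqVneq T a.
  by apply: Pclosed => //; rewrite lt_neqAle eq_sym aneT.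
have PleT s : a <= s <= T -> P s.
  move=> /andP[h1]; rewrite le_eqVlt => /predU1P[->//|h2].
  by apply: PltT; rewrite h1.
have [|bT] := leP b T; first by move=> bT; apply: PleT; rewrite at_ (le_trans tb).
have [d d0 Pd] := Popen T aT bT PleT.
pose u := T + Num.min (b - T) (d / 2).
have m0 : 0 < Num.min (b - T) (d / 2).
  by rewrite lt_min subr_gt0 bT divr_gt0.
have mb : Num.min (b - T) (d / 2) <= b - T by rewrite ge_min lexx.
have md : Num.min (b - T) (d / 2) < d.
  by rewrite gt_min; apply/orP; right; rewrite ltr_pdivrMr// ltr_pMr// ltr1n.
suff Su : S u.
  have : u <= T by apply: ub_le_sup => //; case: hS.
  by rewrite /u; lra.
split; first by rewrite /u; apply/andP; split; lra.
move=> s /andP[h1 h2]; have [sT|Ts] := leP s T; first by apply: PleT; rewrite h1.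
by apply: Pd; rewrite Ts/=; move: h2; rewrite /u; lra.
Qed.

(** Replaces a derivative by an upper right derivate, and continuity by the absence of upward jumps
    from the left. This serves functions built from norms and minima, which need not be
    differentiable. Real induction gives [psi t <= psi a + eta * (t - a)] for each [eta]. *)
Lemma nonincreasing_of_upper_derivate (R : realType) (psi : R -> R) (a b : R) :
  a <= b ->
  (forall t, a <= t -> t < b -> forall eta, 0 < eta -> exists2 d, 0 < d &
     forall s, t < s < t + d -> psi s - psi t <= eta * (s - t)) ->
  (forall t, a < t -> t <= b -> forall eta, 0 < eta -> exists2 d, 0 < d &
     forall s, t - d < s < t -> psi t - psi s <= eta) ->
  psi b <= psi a.
Proof.
move=> ab hr hl; apply/ler_addgt0Pr => e e0.
pose eta := e / (b - a + 1).
have ba : 0 < b - a + 1 by lra.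
have eta0 : 0 < eta by rewrite divr_gt0.
suff H : forall t, a <= t <= b -> psi t <= psi a + eta * (t - a).
  have bb : a <= b <= b by rewrite ab lexx.
  apply: (le_trans (H b bb)); rewrite lerD2l /eta mulrAC ler_pdivrMr//.
  by rewrite ler_pM2l//; lra.
apply: real_induction => [|t at_ tb IH|t at_ tb IH].
- by rewrite subrr mulr0 addr0.
- have [d d0 Hd] := hr t at_ tb eta eta0; exists d => // s sd.
  have := Hd s sd; have tt : a <= t <= t by rewrite at_ lexx.
  by have := IH t tt; lra.
- apply/ler_addgt0Pr => e' e'0.
  have [d d0 Hd] := hl t at_ tb e' e'0.
  pose s := Num.max a (t - d / 2).
  have st : s < t by rewrite /s gt_max at_/=; lra.
  have sa : a <= s by rewrite /s le_max lexx.
  have sd : t - d < s by rewrite /s lt_max; apply/orP; right; lra.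
  have sdt : t - d < s < t by rewrite sd.
  have := Hd s sdt.
  have sat : a <= s < t by rewrite sa.
  have := IH s sat.
  have : eta * (s - a) <= eta * (t - a) by rewrite ler_pM2l//; lra.
  lra.
Qed.

Lemma is_derive_expand (R : realType) (V W : normedModType R) (f : V -> W) (x v : V) (l : W) :
  is_derive x v f l -> forall e, 0 < e -> exists2 d, 0 < d &
    forall h : R, `|h| < d -> `|f (h *: v + x) - f x - h *: l| <= e * `|h|.
Proof.
move=> [df dl] e e0.
have : (h^-1 *: (f (h *: v + x) - f x)) @[h --> 0^'] --> l.
  by rewrite -dl; exact: df.
move=> /cvgrPdist_le /(_ e e0) [d /= d0 Hd]; exists d => // h hd.
have [->|h0] := eqVneq h 0.
  by rewrite !scale0r add0r subrr subr0 !normr0 mulr0.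
have := Hd h _ h0; rewrite /ball_/= sub0r normrN => /(_ hd).
rewrite distrC -(ler_pM2r (x := `|h|)) ?normr_gt0//; apply: le_trans.
rewrite mulrC -normrZ scalerBr scalerA divff// scale1r.
by [].
Qed.

Lemma expand_is_derive (R : realType) (V W : normedModType R) (f : V -> W) (x v : V) (l : W) :
  (forall e, 0 < e -> exists2 d, 0 < d &
    forall h : R, `|h| < d -> `|f (h *: v + x) - f x - h *: l| <= e * `|h|) ->
  is_derive x v f l.
Proof.
move=> H.
have cv : (h^-1 *: (f (h *: v + x) - f x)) @[h --> 0^'] --> l.
  apply/cvgrPdist_le => e e0; have [d d0 Hd] := H e e0.
  exists d => //= h; rewrite /ball_/= sub0r normrN => hd h0.
  rewrite distrC -(ler_pM2l (x := `|h|)) ?normr_gt0// -normrZ scalerBr scalerA divff// scale1r.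
  by rewrite mulrC; exact: Hd.
by apply: DeriveDef; [apply/cvg_ex; exists l | apply/cvg_lim].
Qed.

Lemma is_derive1_expand (R : realType) (W : normedModType R) (f : R -> W) (t : R) (l : W) :
  is_derive t 1 f l -> forall e, 0 < e -> exists2 d, 0 < d &
    forall s, `|s - t| < d -> `|f s - f t - (s - t) *: l| <= e * `|s - t|.
Proof.
move=> /is_derive_expand H e e0; have [d d0 Hd] := H e e0; exists d => // s sd.
by have := Hd (s - t) sd; rewrite [(s - t) *: 1]mulr1 subrK.
Qed.

(** A vector-valued [f] has no mean value theorem with equality, and its norm need not be
    differentiable; the upper derivate of [|f t - f a| - C * (t - a)] is nonpositive all the
    same. *)
Lemma mean_value_ineq (R : realType) (W : normedModType R) (f f' : R -> W) (a b C : R) :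
  a <= b -> (forall t, a <= t <= b -> is_derive t 1 f (f' t)) ->
  (forall t, a <= t <= b -> `|f' t| <= C) -> `|f b - f a| <= C * (b - a).
Proof.
move=> ab df fC.
have C0 : 0 <= C by apply: le_trans (fC a _); rewrite ?lexx.
suff : `|f b - f a| - C * (b - a) <= `|f a - f a| - C * (a - a).
  by rewrite !subrr normr0 mulr0 subr0 subr_le0.
apply: (@nonincreasing_of_upper_derivate _ (fun t => `|f t - f a| - C * (t - a))) => //.
- move=> t at_ tb eta eta0.
  have tab : a <= t <= b by rewrite at_ ltW.
  have [d d0 Hd] := is_derive1_expand (df t tab) eta0.
  exists d => // s /andP[ts sd].
  have st0 : 0 < s - t by lra.
  have := Hd s; rewrite gtr0_norm// => /(_ _)/wrap[]; first by lra.
  move=> H1.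
  have : `|f s - f t| <= (eta + C) * (s - t).
    rewrite -(subrK ((s - t) *: f' t) (f s - f t)) (le_trans (ler_normD _ _))//.
    rewrite mulrDl lerD// normrZ gtr0_norm// mulrC ler_pM2r//; exact: fC.
  have : `|f s - f a| <= `|f s - f t| + `|f t - f a|.
    by rewrite -[f s - f a](subrKA (f t)) ler_normD.
  lra.
- move=> t at_ tb eta eta0.
  have tab : a <= t <= b by rewrite tb ltW.
  have [d d0 Hd] := is_derive1_expand (df t tab) ltr01.
  pose K := 1 + `|f' t| + C.
  have K0 : 0 < K by rewrite /K -addrA ltr_pwDl// addr_ge0.
  exists (Num.min d (eta / K)); first by rewrite lt_min d0 divr_gt0.
  move=> s /andP[sd st].
  have ts0 : 0 < t - s by lra.
  have tsd : t - s < Num.min d (eta / K) by lra.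
  move: tsd; rewrite lt_min => /andP[tsd]; rewrite ltr_pdivlMr// => tse.
  have := Hd s; rewrite distrC gtr0_norm// => /(_ tsd) H1.
  have : `|f s - f t| <= (1 + `|f' t|) * (t - s).
    rewrite -(subrK ((s - t) *: f' t) (f s - f t)) (le_trans (ler_normD _ _))//.
    by rewrite mulrDl lerD// normrZ distrC gtr0_norm// mulrC.
  have : `|f t - f a| <= `|f s - f t| + `|f s - f a|.
    by rewrite [`|f s - f t|]distrC -[f t - f a](subrKA (f s)) ler_normD.
  have CK : C * (t - s) + (1 + `|f' t|) * (t - s) = (t - s) * K by rewrite /K; ring.
  have : 0 <= C * (t - s) by rewrite mulr_ge0// ltW.
  lra.
Qed.

Lemma antiderivative (R : realType) (f : R -> R) (A : R) :
  0 < A -> continuous f ->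
  exists F : R -> R, F 0 = 0 /\ forall t, - A < t < A -> is_derive t 1 F (f t).
Proof.
move=> A0 cf.
pose F t := (\int[lebesgue_measure]_(s in `[- A, t]) f s)%R.
have iF : lebesgue_measure.-integrable `[- A, A] (EFin \o f).
  apply: continuous_compact_integrable; first exact: segment_compact.
  exact: continuous_subspaceT.
exists (fun t => F t - F 0); split=> [|t /andP[At tA]]; first by rewrite subrr.
have [dF F'] := continuous_FTC1_closed tA iF At (cf t).
have dF' : is_derive t 1 F (f t) by apply: DeriveDef => //; rewrite -derive1E.
have -> : (fun t => F t - F 0) = F - cst (F 0) by apply/funext.
by apply: is_derive_eq; rewrite subr0.
Qed.

Lemma Rintegral_derive (R : realType) (f F : R -> R) (a b : R) :
  a < b -> {within `[a, b], continuous f} ->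
  (forall t, a <= t <= b -> is_derive t 1 F (f t)) ->
  (\int[lebesgue_measure]_(t in `[a, b]) f t)%R = F b - F a.
Proof.
move=> ab cf dF; rewrite /Rintegral (@continuous_FTC2 _ f F)//.
- have cF t : a <= t <= b -> {for t, continuous F}.
    by move=> tab; apply/differentiable_continuous/derivable1_diffP; case: (dF t tab).
  split.
  + by move=> t; rewrite in_itv/= => /andP[h1 h2]; case: (dF t _) => //; rewrite !ltW.
  + by apply/cvg_at_right_filter/cF; rewrite lexx ltW.
  + by apply/cvg_at_left_filter/cF; rewrite lexx ltW.
- move=> t; rewrite in_itv/= => /andP[h1 h2]; rewrite derive1E.
  by have tab : a <= t <= b; [rewrite !ltW|case: (dF t tab)].
Qed.

Lemma is_derive_mxP (R : realType) (V : normedModType R) (m n : nat)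
    (M : V -> 'M[R]_(m, n)) (t v : V) (L : 'M[R]_(m, n)) :
  is_derive t v M L <-> forall i j, is_derive t v (fun x => M x i j) (L i j).
Proof.
split=> [[dM <-] i j|H].
  apply: DeriveDef; first by move/derivable_mxP: dM; apply.
  by rewrite derive_mx// mxE.
have dM : derivable M t v by apply/derivable_mxP => i j; case: (H i j).
apply: DeriveDef => //; rewrite derive_mx//; apply/matrixP => i j; rewrite mxE.
by case: (H i j).
Qed.

Lemma mx_norm_le (R : realType) (m n : nat) (u : 'M[R]_(m, n)) (C : R) :
  0 <= C -> (forall i j, `|u i j| <= C) -> `|u| <= C.
Proof.
by move=> C0 H; rewrite /Num.Def.normr/= mx_normrE; apply: bigmax_le.
Qed.

Lemma ler_coord_norm (R : realType) (m n : nat) (u : 'M[R]_(m, n)) i j : `|u i j| <= `|u|.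
Proof.
rewrite [leRHS]/Num.Def.normr/= mx_normrE.
exact: (le_bigmax _ (fun ij : 'I_m * 'I_n => `|u ij.1 ij.2|) (i, j)).
Qed.

Lemma antiderivative_rV (R : realType) (n : nat) (f : R -> 'rV[R]_n) (A : R) :
  0 < A -> continuous f ->
  exists F : R -> 'rV[R]_n,
    F 0 = 0 /\ forall t, - A < t < A -> is_derive t 1 F (f t).
Proof.
move=> A0 cf.
have H i : exists F : R -> R, F 0 = 0 /\
    forall t, - A < t < A -> is_derive t 1 F (f t 0 i).
  apply: antiderivative => // t.
  apply: (@continuous_comp _ _ _ f (fun N : 'rV[R]_n => N 0 i) t); first exact: cf.
  exact: coord_continuous.
pose F i := sval (cid (H i)).
have HF i : F i 0 = 0 /\ forall t, - A < t < A -> is_derive t 1 (F i) (f t 0 i).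
  by rewrite /F; case: (cid (H i)).
exists (fun t => \row_i F i t); split.
  by apply/rowP => i; rewrite !mxE; case: (HF i).
move=> t At; apply/is_derive_mxP => i j; rewrite ord1.
by rewrite (_ : (fun _ => _) = F j); [exact: (HF j).2|apply/funext => s; rewrite mxE].
Qed.

(** * Perturbations of the identity *)

Lemma ler0_half_pow (R : realType) (x B : R) :
  (forall k, x <= B * 2^-1 ^+ k) -> x <= 0.
Proof.
move=> H; have h1 : `|2^-1 : R| < 1 by rewrite gtr0_norm ?invr_gt0// invf_lt1// ltr1n.
have : (B * 2^-1 ^+ k) @[k --> \oo] --> B * 0.
  by apply: cvgMr; exact: cvg_expr.
rewrite mulr0 => cv; have <- := cvg_lim (@Rhausdorff R) cv.
by apply: limr_ge; [apply/cvg_ex; exists 0|apply: nearW].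
Qed.

(** The factor 2 is the sum of the geometric series. The estimate [tail] keeps the exact remainder
    of the series, which is what makes the induction close. *)
Lemma geometric_limit (R : realType) (V : completeNormedModType R) (u : nat -> V) (B : R) :
  (forall k, `|u k.+1 - u k| <= B * 2^-1 ^+ k) ->
  exists l, forall k, `|u k - l| <= 2 * B * 2^-1 ^+ k.
Proof.
move=> H.
have h1 : `|2^-1 : R| < 1 by rewrite gtr0_norm ?invr_gt0// invf_lt1// ltr1n.
have B0 : 0 <= B by have := H 0%N; rewrite expr0 mulr1; apply: le_trans.
have tail k m : `|u k - u (k + m)%N| <= 2 * B * 2^-1 ^+ k - 2 * B * 2^-1 ^+ (k + m).
  elim: m => [|m IH]; first by rewrite addn0 !subrr normr0.
  rewrite -(subrKA (u (k + m)%N)) (le_trans (ler_normD _ _))//.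
  apply: (le_trans (lerD IH _)); first by rewrite distrC addnS; exact: H.
  rewrite -addrA lerD2l addnS exprS.
  by set q := _ ^+ (k + m); rewrite le_eqVlt; apply/orP; left; apply/eqP; field.
have tail' k m : `|u k - u (k + m)%N| <= 2 * B * 2^-1 ^+ k.
  apply: (le_trans (tail k m)); rewrite lerBlDr lerDl.
  by rewrite mulr_ge0 ?mulr_ge0// exprn_ge0// invr_ge0.
have cu : cvgn u.
  apply/cauchy_cvgP/cauchy_ballP => e e0.
  have : (2 * (2 * B) * 2^-1 ^+ k) @[k --> \oo] --> (2 * (2 * B)) * (0 : R).
    by apply: cvgMr; exact: cvg_expr.
  rewrite mulr0 => /cvgrPdist_lt /(_ e e0) [K _ HK].
  have {}HK := HK K (leqnn K).
  have HK' m : (K <= m)%N -> `|u K - u m| < e / 2.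
    move=> Km; rewrite -(subnKC Km); apply: (le_lt_trans (tail' _ _)).
    by move: HK; rewrite sub0r normrN => /(le_lt_trans (ler_norm _)); lra.
  near_simpl; exists ([set m | (K <= m)%N], [set m | (K <= m)%N]); first by split; exists K.
  move=> [i j] /= [Ki Kj]; rewrite -ball_normE /=.
  rewrite -(subrKA (u K)) (le_lt_trans (ler_normD _ _))// (splitr e) ltrD//.
    by rewrite distrC HK'.
  exact: HK'.
exists (limn u) => k.
have cv : (`|u k - u m|) @[m --> \oo] --> `|u k - limn u|.
  by apply: cvg_norm; apply: cvgB => //; exact: cvg_cst.
rewrite -(cvg_lim (@Rhausdorff R) cv).
apply: limr_le; first by apply/cvg_ex; eexists; exact: cv.
by exists k => // m /= km; rewrite -(subnKC km).
Qed.

(** Lets row vectors be used where a complete normed module is expected, as in [geometric_limit]. *)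
HB.instance Definition _ (R : realType) (m n : nat) := Complete.on 'M[R]_(m, n).

Section perturbed_identity.
Variables (R : realType) (V : completeNormedModType R) (E : V -> V).
Hypothesis HE : forall v w, `|E v - E w - (v - w)| <= 2^-1 * `|v - w|.

Lemma perturbed_identity_lower v w : `|v - w| <= 2 * `|E v - E w|.
Proof.
have := HE v w.
have := ler_normB (E v - E w) (E v - E w - (v - w)).
rewrite opprB addrCA subrr addr0; lra.
Qed.

Lemma perturbed_identity_upper v w : `|E v - E w| <= 2 * `|v - w|.
Proof.
have := HE v w; have := ler_normD (E v - E w - (v - w)) (v - w).
rewrite subrK; have := normr_ge0 (v - w); lra.
Qed.

(** The map [v + (y - E v)] contracts distances by 1/2, and its fixed points are the solutions of
    [E v = y]. The residual [y - E (u k)] equals the next increment, so it halves at each step. *)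
Lemma perturbed_identity_surj y : exists v, E v = y.
Proof.
pose u k := iter k (fun v => v + (y - E v)) 0.
have uS k : u k.+1 = u k + (y - E (u k)) by [].
have H k : `|u k.+1 - u k| <= `|y - E 0| * 2^-1 ^+ k.
  elim: k => [|k IH]; first by rewrite uS expr0 mulr1 addrAC subrr add0r.
  have d j : u j.+1 - u j = y - E (u j) by rewrite uS addrAC subrr add0r.
  move: IH; rewrite !d => IH.
  have := HE (u k.+1) (u k); rewrite d opprB addrA subrK distrC.
  by move=> /le_trans; apply; rewrite exprS mulrCA ler_pM2l ?invr_gt0.
have [l Hl] := geometric_limit H; exists l; apply/eqP.
(* Here 5 = 2 * 2 + 1: the Lipschitz constant of [E] times the tail bound of the series, plus the
   residual of [u k]. *)
rewrite -subr_eq0 -normr_le0; apply: (@ler0_half_pow _ _ (5 * `|y - E 0|)) => k.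
have h1 : `|E l - E (u k)| <= 2 * (2 * `|y - E 0| * 2^-1 ^+ k).
  by apply: (le_trans (perturbed_identity_upper _ _)); rewrite distrC ler_pM2l.
have h2 : `|E (u k) - y| <= `|y - E 0| * 2^-1 ^+ k.
  by have := H k; rewrite uS [u k + _ - _]addrAC subrr add0r distrC.
have := ler_normD (E l - E (u k)) (E (u k) - y); rewrite subrKA; lra.
Qed.

End perturbed_identity.

(** * Picard iteration *)

Lemma near_dist (R : realType) (V : normedModType R) (x : V) (e : R) :
  0 < e -> \forall y \near x, `|x - y| < e.
Proof. by move=> e0; exact: (cvgrPdist_lt _ _).1 (@cvg_id _ (nbhs x)) e e0. Qed.

Lemma lipschitz_continuous (R : realType) (V W : normedModType R) (f : V -> W) (K : R) :
  (forall x y, `|f x - f y| <= K * `|x - y|) -> continuous f.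
Proof.
move=> H x; apply/cvgrPdist_lt => e e0.
near=> y; apply: (le_lt_trans (H _ _)).
have : `|x - y| < e / (`|K| + 1).
  by near: y; apply: near_dist; rewrite divr_gt0// ltr_wpDl.
rewrite ltr_pdivlMr ?ltr_wpDl// => /(le_lt_trans _); apply.
rewrite mulrC ler_wpM2l// (le_trans (ler_norm _))// lerDl ler01//.
Unshelve. all: by end_near. Qed.

(** The cut-off used throughout, for coordinates, velocities and time alike: 1-Lipschitz, and the
    identity on [-r, r]. *)
Definition clamp (R : realType) (r t : R) : R := Num.max (- r) (Num.min r t).

Lemma clamp_lipschitz (R : realType) (r s t : R) :
  `|clamp r s - clamp r t| <= `|s - t|.
Proof.
wlog st : s t / s <= t => [H|].
  by have [/H//|/ltW/H] := leP s t; rewrite distrC [`|t - s|]distrC.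
have m : clamp r s <= clamp r t.
  by rewrite /clamp ge_max !le_max ge_min lexx/= le_min ge_min lexx/= ge_min st !orbT.
rewrite distrC ger0_norm ?subr_ge0// distrC ger0_norm ?subr_ge0//.
rewrite /clamp lerBlDr ge_max; apply/andP; split.
  have : - r <= Num.max (- r) (Num.min r s) by rewrite le_max lexx.
  lra.
have : Num.min r s <= Num.max (- r) (Num.min r s) by rewrite le_max lexx orbT.
by have [h1|h1] := leP r s; have [h2|h2] := leP r t; lra.
Qed.

Lemma clamp_id (R : realType) (r t : R) : `|t| <= r -> clamp r t = t.
Proof.
by rewrite ler_norml => /andP[h1 h2]; rewrite /clamp min_r// max_r.
Qed.

Lemma clamp_le (R : realType) (r t : R) : 0 <= r -> `|clamp r t| <= r.
Proof.
move=> r0; rewrite ler_norml /clamp le_max lexx/= ge_max ge_min lexx/= andbT; lra.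
Qed.

Lemma clamp0 (R : realType) (r : R) : 0 <= r -> clamp r 0 = 0.
Proof. by move=> r0; rewrite clamp_id// normr0. Qed.

Section primitive.
Variables (R : realType) (n : nat).
Implicit Types f g : R -> 'rV[R]_n.

(** Chosen by [xget], hence meaningful for continuous [f] only. The interval (-3, 3) exceeds [-2, 2]
    so that the derivatives at -2 and 2 are two-sided. *)
Definition primitive f : R -> 'rV[R]_n :=
  xget 0 [set F : R -> 'rV[R]_n | F 0 = 0 /\ forall t : R, - 3 < t < 3 -> is_derive t 1 F (f t)].

Lemma primitiveP f : continuous f ->
  primitive f 0 = 0 /\ forall t : R, - 3 < t < 3 -> is_derive t 1 (primitive f) (f t).
Proof.
move=> cf; have [F HF] := antiderivative_rV (ltr0n _ 3) cf.
by rewrite /primitive; case: xgetP => [G _ //|/(_ F)/= []].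
Qed.

Lemma mean_value_ineq0 (W : normedModType R) (F F' : R -> W) (b C : R) : 
  (forall t : R, `|t| <= b -> is_derive t 1 F (F' t)) ->
  (forall t : R, `|t| <= b -> `|F' t| <= C) ->
  forall t : R, `|t| <= b -> `|F t - F 0| <= C * `|t|.
Proof.
move=> dF FC t tb; have [t0|t0] := leP 0 t.
  rewrite ger0_norm//; rewrite -[X in C * X]subr0.
  have h s : 0 <= s <= t -> `|s| <= b.
    by move=> /andP[h1 h2]; rewrite ger0_norm// (le_trans h2)// -(ger0_norm t0).
  apply: (@mean_value_ineq _ _ F F') => // s st; [exact/dF/h|exact/FC/h].
rewrite ltr0_norm// -[X in C * X]sub0r distrC.
have h s : t <= s <= 0 -> `|s| <= b.
  by move=> /andP[h1 h2]; rewrite ler0_norm// (le_trans _ tb)// ltr0_norm// lerN2.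
by apply: (@mean_value_ineq _ _ F F') => [|s st|s st]; [exact: ltW|exact/dF/h|exact/FC/h].
Qed.

Lemma primitive_close f g (D : R) : continuous f -> continuous g -> 
  (forall t : R, `|t| <= 2 -> `|f t - g t| <= D) ->
  forall t : R, `|t| <= 2 -> `|primitive f t - primitive g t| <= D * `|t|.
Proof.
move=> cf cg fgD t t2.
have [f0 df] := primitiveP cf; have [g0 dg] := primitiveP cg.
have := @mean_value_ineq0 _ (primitive f - primitive g) (f - g) 2 D _ fgD t t2.
rewrite !fctE f0 g0 subrr subr0; apply => s.
rewrite ler_norml => /andP[h1 h2].
have s3 : - 3 < s < 3 by apply/andP; split; lra.
by have := df s s3; have := dg s s3 => ? ?; exact: is_deriveB.
Qed.

Lemma continuous_primitive_clamp f : continuous f -> 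
  continuous (fun t => primitive f (clamp 2 t)).
Proof.
move=> cf t; apply: (@continuous_comp _ _ _ (clamp 2) (primitive f)).
  by apply: (@lipschitz_continuous _ _ _ _ 1) => x y; rewrite mul1r; exact: clamp_lipschitz.
apply: differentiable_continuous; apply/derivable1_diffP.
have : `|clamp 2 t| <= 2 by apply: clamp_le.
rewrite ler_norml => /andP[h1 h2].
by case: ((primitiveP cf).2 (clamp 2 t)) => //; apply/andP; split; lra.
Qed.

End primitive.

Section picard.
Variables (R : realType) (n : nat) (H : 'rV[R]_n -> 'rV[R]_n -> 'rV[R]_n) (lam : R).
Hypothesis lam0 : 0 <= lam.
Hypothesis lam_small : lam <= 16^-1.
Hypothesis H0 : forall c, H c 0 = 0.
Hypothesis HL : forall c z c' z', `|H c z - H c' z'| <= lam * (`|c - c'| + `|z - z'|).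

Lemma H_le c z : `|H c z| <= lam * `|z|.
Proof. by have := HL c z c 0; rewrite H0 subrr normr0 add0r !subr0. Qed.

Lemma continuous_H (c z : R -> 'rV[R]_n) : continuous c -> continuous z ->
  continuous (fun t => H (c t) (z t)).
Proof.
move=> cc cz t; apply/cvgrPdist_lt => e e0; near=> s.
apply: (le_lt_trans (HL _ _ _ _)).
have h1 : `|c t - c s| < e by near: s; exact: (cvgrPdist_lt _ _).1 (cc t) e e0.
have h2 : `|z t - z s| < e by near: s; exact: (cvgrPdist_lt _ _).1 (cz t) e e0.
apply: (@le_lt_trans _ _ (16^-1 * (`|c t - c s| + `|z t - z s|))); last by lra.
by apply: ler_wpM2r.
Unshelve. all: by end_near. Qed.

Definition ode_solution (b1 b2 : R) (c z : R -> 'rV[R]_n) : Prop :=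
  forall t : R, b1 <= t <= b2 -> is_derive t 1 c (z t) /\ is_derive t 1 z (H (c t) (z t)).

Section iteration.
Variables a v : 'rV[R]_n.

Definition position (z : R -> 'rV[R]_n) : R -> 'rV[R]_n := fun t => a + primitive z (clamp 2 t).

(** The iteration runs on the velocity alone, the position being recovered by integration. Clamping
    the time to [-2, 2] makes every iterate a continuous function on the whole line, so that
    iterates are compared uniformly without restricting their domain. *)
Definition picard_step (z : R -> 'rV[R]_n) : R -> 'rV[R]_n := fun t =>
  v + primitive (fun s => H (position z s) (z s)) (clamp 2 t).

Lemma continuous_position z : continuous z -> continuous (position z).
Proof.
move=> cz t; apply: (@continuousD R 'rV[R]_n R (cst a) (fun t => primitive z (clamp 2 t))).
  exact: cst_continuous.
exact: continuous_primitive_clamp.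
Qed.

Lemma continuous_picard_step z : continuous z -> continuous (picard_step z).
Proof.
move=> cz t.
apply: (@continuousD R 'rV[R]_n R (cst v) (fun t => primitive _ (clamp 2 t))).
  exact: cst_continuous.
by apply: continuous_primitive_clamp; apply: continuous_H => //; exact: continuous_position.
Qed.

Lemma position_close z z' D : continuous z -> continuous z' -> 
  (forall t : R, `|z t - z' t| <= D) -> forall t : R, `|position z t - position z' t| <= D * 2.
Proof.
move=> cz cz' zD t; rewrite /position opprD addrACA subrr add0r.
have D0 : 0 <= D by apply: le_trans (zD 0).
have c2 : `|clamp 2 t| <= 2 by apply: clamp_le.
apply: (le_trans (primitive_close cz cz' (fun t _ => zD t) c2)).
by rewrite ler_wpM2l.
Qed.

Lemma picard_step_close z z' D : continuous z -> continuous z' -> 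
  (forall t : R, `|z t - z' t| <= D) ->
  forall t : R, `|picard_step z t - picard_step z' t| <= 2^-1 * D.
Proof.
move=> cz cz' zD t; rewrite /picard_step opprD addrACA subrr add0r.
have D0 : 0 <= D by apply: le_trans (zD 0).
have c2 : `|clamp 2 t| <= 2 by apply: clamp_le.
have ch y : continuous y -> continuous (fun s => H (position y s) (y s)).
  by move=> cy; apply: continuous_H => //; exact: continuous_position.
(* Positions differ by at most [2 * D], the integrands by [3 * D / 16], and their integrals over a
   length of at most 2 by [3 * D / 8], which is below [D / 2]. *)
apply: (@le_trans _ _ (16^-1 * (D * 2 + D) * `|clamp 2 t|)).
  apply: primitive_close => //; [exact: ch|exact: ch|move=> s _].
  apply: (le_trans (HL _ _ _ _)).
  apply: ler_pM => //.
  by apply: lerD => //; exact: position_close.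
apply: (@le_trans _ _ (16^-1 * (D * 2 + D) * 2)).
  by rewrite ler_wpM2l// mulr_ge0//; lra.
lra.
Qed.

(** The iteration starts from the constant velocity [v], and its first increment is at most [|v|]
    because [H] vanishes at zero velocity. The final bound is the geometric tail from that first
    iterate. *)
Lemma picard : exists c z : R -> 'rV[R]_n,
  [/\ c 0 = a, z 0 = v,
      forall t : R, - 2 < t < 2 -> is_derive t 1 c (z t) /\ is_derive t 1 z (H (c t) (z t)) &
      forall t : R, `|z t - v| <= 2 * `|v|].
Proof.
pose Z k := iter k picard_step (cst v).
have cZ k : continuous (Z k).
  by elim: k => [|k IH]; [exact: cst_continuous|exact: continuous_picard_step].
have close k : forall t : R, `|Z k.+1 t - Z k t| <= `|v| * 2^-1 ^+ k.
  elim: k => [|k IH] t; last first.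
    rewrite exprS mulrCA; exact: (picard_step_close (cZ _) (cZ _) IH).
  rewrite expr0 mulr1 /= /picard_step [v + _ - _]addrAC subrr add0r.
  have c2 : `|clamp 2 t| <= 2 by apply: clamp_le.
  have ch : continuous (fun s => H (position (cst v) s) v).
    apply: (@continuous_H _ (cst v)); last exact: cst_continuous.
    by apply: continuous_position; exact: cst_continuous.
  have c0 : continuous (fun _ : R => 0 : 'rV[R]_n) by exact: cst_continuous.
  have [p0 dp] := primitiveP ch.
  rewrite -[X in `|X| <= _]subr0 -[X in _ - X]p0.
  apply: (@le_trans _ _ (lam * `|v| * `|clamp 2 t|)).
    apply: (@mean_value_ineq0 _ _ _ (fun s => H (position (cst v) s) v) 2) => // s.
      rewrite ler_norml => /andP[h1 h2].
      by apply: dp; apply/andP; split; lra.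
    by move=> _; exact: H_le.
  apply: (@le_trans _ _ (16^-1 * `|v| * 2)); last by have := normr_ge0 v; lra.
  by apply: ler_pM => //; [rewrite mulr_ge0|rewrite ler_wpM2r].
have lim t : exists l, forall k, `|Z k t - l| <= 2 * `|v| * 2^-1 ^+ k.
  refine (@geometric_limit R 'rV[R]_n (fun k => Z k t) _ _) => k; exact: close.
pose z t := sval (cid (lim t)).
have Zz k t : `|Z k t - z t| <= 2 * `|v| * 2^-1 ^+ k by rewrite /z; case: (cid (lim t)).
have cz : continuous z.
  move=> t; apply/cvgrPdist_lt => e e0.
  have : (2 * `|v| * 2^-1 ^+ k) @[k --> \oo] --> (2 * `|v|) * (0 : R).
    apply: cvgMr; apply: cvg_expr.
    by rewrite gtr0_norm ?invr_gt0// invf_lt1// ltr1n.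
  rewrite mulr0 => /cvgrPdist_lt /(_ (e / 4)); rewrite divr_gt0// => /(_ isT) [K _ HK].
  have {}HK := HK K (leqnn K).
  have {}HK s : `|Z K s - z s| < e / 4.
    apply: (le_lt_trans (Zz _ _)); apply: le_lt_trans HK.
    by rewrite sub0r normrN ler_norm.
  near=> s.
  have h : `|Z K t - Z K s| < e / 4.
    by near: s; apply: (cvgrPdist_lt _ _).1 (cZ K t) _ _; rewrite divr_gt0.
  have h1 := HK t; have h2 := HK s.
  have -> : z t - z s = - (Z K t - z t) + (Z K t - Z K s) + (Z K s - z s).
    by rewrite opprB !subrKA.
  have := ler_normD (- (Z K t - z t) + (Z K t - Z K s)) (Z K s - z s).
  have := ler_normD (- (Z K t - z t)) (Z K t - Z K s); rewrite normrN; lra.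
have zfix : picard_step z = z.
  apply/funext => t; apply/eqP; rewrite -subr_eq0 -normr_le0.
  apply: (@ler0_half_pow _ _ (2 * `|v|)) => k.
  have h1 : `|picard_step z t - Z k.+1 t| <= 2^-1 * (2 * `|v| * 2^-1 ^+ k).
    apply: (@picard_step_close z (Z k)) => //.
    by move=> s; rewrite distrC.
  have h2 := Zz k.+1 t; rewrite exprS in h2.
  have := ler_normD (picard_step z t - Z k.+1 t) (Z k.+1 t - z t); rewrite subrKA; lra.
have c20 : clamp 2 0 = 0 :> R by rewrite clamp0.
have ch : continuous (fun s => H (position z s) (z s)).
  by apply: continuous_H => //; exact: continuous_position.
have [p0 dp] := primitiveP cz.
have [q0 dq] := primitiveP ch.
exists (position z), z; split.
- by rewrite /position c20 p0 addr0.
- by rewrite -zfix /picard_step c20 q0 addr0.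
- move=> t /andP[h1 h2].
  have t3 : - 3 < t < 3 by apply/andP; split; lra.
  (* Strictly inside (-2, 2) the clamped time is locally the true time, so the fixed-point equation
     can be differentiated. *)
  have t_near : \forall s \near t, clamp 2 s = s.
    near=> s; apply: clamp_id; rewrite ler_norml; apply/andP; split.
      by apply: ltW; near: s; exact: lt_nbhsr.
    by apply: ltW; near: s; exact: lt_nbhsl.
  split.
  + apply: (@near_eq_is_derive _ _ _ (cst a + primitive z)).
      by near=> s; rewrite /position (near t_near s).
    by have := dp t t3 => ?; apply: is_derive_eq; rewrite add0r.
  + rewrite -{1}zfix.
    apply: (@near_eq_is_derive _ _ _ (cst v + primitive (fun s => H (position z s) (z s)))).
      by near=> s; rewrite /picard_step (near t_near s).
    by have := dq t t3 => ?; apply: is_derive_eq; rewrite add0r.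
- by move=> t; have := Zz 0%N t; rewrite expr0 mulr1 distrC.
Unshelve. all: by end_near. Qed.

End iteration.
End picard.

(** * Comparison of solutions and the time-one map *)

Section flow.
Variables (R : realType) (n : nat) (H : 'rV[R]_n -> 'rV[R]_n -> 'rV[R]_n) (lam : R).
Hypothesis lam0 : 0 <= lam.
Hypothesis lam_small : lam <= 16^-1.
Hypothesis H0 : forall c, H c 0 = 0.
Hypothesis HL : forall c z c' z', `|H c z - H c' z'| <= lam * (`|c - c'| + `|z - z'|).

(** No Gronwall inequality is needed on a time interval of length at most 1. If [D] is the maximum
    of [|z1 - z2|], then [|c1 - c2| <= D], so the derivative of [z1 - z2] is at most [2 * D / 16].
    Thus [z1 - z2] stays within [D / 8] of its initial value, which bounds [D] by twice that value;
    one more integration gives the estimate on positions. With equal initial velocities this is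
    uniqueness. *)
Lemma ode_solution_close (b : R) (c1 z1 c2 z2 : R -> 'rV[R]_n) :
  0 <= b <= 1 -> ode_solution H 0 b c1 z1 -> ode_solution H 0 b c2 z2 ->
  c1 0 = c2 0 -> forall t : R, 0 <= t <= b ->
  `|z1 t - z2 t| <= 2 * `|z1 0 - z2 0| /\
  `|c1 t - c2 t - t *: (z1 0 - z2 0)| <= 2^-1 * `|z1 0 - z2 0|.
Proof.
move=> /andP[b0 b1] s1 s2 c12.
have dz t : 0 <= t <= b -> is_derive t 1 (z1 - z2) (H (c1 t) (z1 t) - H (c2 t) (z2 t)).
  by move=> tb; have [? ?] := s1 t tb; have [? ?] := s2 t tb; exact: is_deriveB.
have dc t : 0 <= t <= b -> is_derive t 1 (c1 - c2) (z1 t - z2 t).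
  by move=> tb; have [? ?] := s1 t tb; have [? ?] := s2 t tb; exact: is_deriveB.
have cf : {within `[0, b], continuous (fun t => `|(z1 - z2) t|)}.
  have cz : {within `[0, b], continuous (z1 - z2)}.
    apply: derivable_within_continuous => t; rewrite in_itv/= => tb.
    by case: (dz t tb).
  by move=> t; apply: cvg_norm; exact: cz.
have [m mb Hm] := EVT_max b0 cf.
set D := `|(z1 - z2) m| in Hm.
have HD t : 0 <= t <= b -> `|z1 t - z2 t| <= D.
  by move=> tb; apply: Hm; rewrite in_itv.
have sub t s : 0 <= t <= b -> 0 <= s <= t -> 0 <= s <= b.
  by move=> /andP[h1 h2] /andP[h3 h4]; rewrite h3 (le_trans h4).
have c_close t : 0 <= t <= b -> `|c1 t - c2 t| <= D.
  move=> tb; have t0 : 0 <= t by case/andP: tb.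
  have := @mean_value_ineq _ _ (c1 - c2) _ 0 t D t0
    (fun s st => dc s (sub _ _ tb st)) (fun s st => HD s (sub _ _ tb st)).
  rewrite !fctE c12 subrr !subr0 => /le_trans; apply.
  by rewrite ler_piMr ?normr_ge0//; move: tb => /andP[_]; lra.
have z_close t : 0 <= t <= b -> `|(z1 t - z2 t) - (z1 0 - z2 0)| <= 8^-1 * D.
  move=> tb; have t0 : 0 <= t by case/andP: tb.
  have HH s : 0 <= s <= t -> `|H (c1 s) (z1 s) - H (c2 s) (z2 s)| <= 8^-1 * D.
    move=> st; have sb := sub _ _ tb st; apply: (le_trans (HL _ _ _ _)).
    have h1 := c_close s sb; have h2 := HD s sb.
    apply: (@le_trans _ _ (16^-1 * (`|c1 s - c2 s| + `|z1 s - z2 s|))).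
      by apply: ler_wpM2r.
    lra.
  have := @mean_value_ineq _ _ (z1 - z2) _ 0 t _ t0
    (fun s st => dz s (sub _ _ tb st)) HH.
  rewrite !fctE => /le_trans; apply; rewrite subr0 ler_piMr ?mulr_ge0 ?normr_ge0//.
  by move: tb => /andP[_]; lra.
have D0 : 0 <= D by rewrite normr_ge0.
have DW : D <= 2 * `|z1 0 - z2 0|.
  have mb' : 0 <= m <= b by move: mb; rewrite in_itv.
  have := z_close m mb'.
  have := ler_normD ((z1 m - z2 m) - (z1 0 - z2 0)) (z1 0 - z2 0); rewrite subrK.
  have : D = `|z1 m - z2 m| by [].
  by move: (normr_ge0 (z1 0 - z2 0)); lra.
move=> t tb; split; first by exact: le_trans (HD t tb) DW.
have t0 : 0 <= t by case/andP: tb.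
have dt s : 0 <= s <= t -> is_derive s 1 (c1 - c2 - (fun s => s *: (z1 0 - z2 0)))
    ((z1 s - z2 s) - (z1 0 - z2 0)).
  move=> st; have ? := dc s (sub _ _ tb st).
  apply: is_deriveB.
  have -> : (fun s : R => s *: (z1 0 - z2 0)) = ( *:%R ^~ (z1 0 - z2 0)) by [].
  apply: DeriveDef.
    apply/derivable1_diffP; apply: ex_diff.
  by rewrite deriveE ?diff_val ?scale1r//; apply: ex_diff.
have := mean_value_ineq t0 dt (fun s st => z_close s (sub _ _ tb st)).
rewrite !fctE c12 subrr scale0r !subr0 => /le_trans; apply.
apply: (@le_trans _ _ (8^-1 * D)); last by lra.
rewrite ler_piMr ?mulr_ge0//; move: tb => /andP[_]; lra.
Qed.

Definition flow_data (a v : 'rV[R]_n) := cid (picard lam0 lam_small H0 HL a v).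
Definition flow (a v : 'rV[R]_n) : R -> 'rV[R]_n := sval (flow_data a v).
Definition flow_velocity (a v : 'rV[R]_n) : R -> 'rV[R]_n :=
  sval (cid (svalP (flow_data a v))).

Lemma flowP a v : [/\ flow a v 0 = a, flow_velocity a v 0 = v,
  forall t : R, - 2 < t < 2 -> is_derive t 1 (flow a v) (flow_velocity a v t) /\
    is_derive t 1 (flow_velocity a v) (H (flow a v t) (flow_velocity a v t)) &
  forall t : R, `|flow_velocity a v t - v| <= 2 * `|v|].
Proof. exact: (svalP (cid (svalP (flow_data a v)))). Qed.

Lemma flow_solution a v (b1 b2 : R) : - 2 < b1 -> b2 < 2 ->
  ode_solution H b1 b2 (flow a v) (flow_velocity a v).
Proof.
move=> h1 h2 t /andP[h3 h4]; have [_ _ + _] := flowP a v; apply.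
by rewrite (lt_le_trans h1)//= (le_lt_trans h4).
Qed.

Lemma flow_velocity_le a v t : `|flow_velocity a v t| <= 3 * `|v|.
Proof.
have [_ _ _ /(_ t)] := flowP a v.
have := ler_normD (flow_velocity a v t - v) v; rewrite subrK; lra.
Qed.

Lemma flow_close a v (t : R) : - 2 < t < 2 -> `|flow a v t - a| <= 6 * `|v|.
Proof.
have [f0 _ fd _] := flowP a v.
move=> /andP[t1 t2]; have tt : `|t| <= `|t| by [].
have t2' : `|t| < 2 by rewrite ltr_norml t1.
have dflow (s : R) : `|s| <= `|t| -> is_derive s 1 (flow a v) (flow_velocity a v s).
  move=> st; have : `|s| < 2 := le_lt_trans st t2'.
  by rewrite ltr_norml => s2; case: (fd s s2).
have := mean_value_ineq0 dflow (fun s _ => flow_velocity_le a v s) tt.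
rewrite f0 => /le_trans; apply.
have := normr_ge0 v.
have : 0 <= `|v| * (2 - `|t|) by rewrite mulr_ge0// subr_ge0 ltW.
lra.
Qed.

Lemma flow_unique a v b c z : 0 <= b <= 1 -> ode_solution H 0 b c z -> c 0 = a -> z 0 = v ->
  forall t : R, 0 <= t <= b -> c t = flow a v t /\ z t = flow_velocity a v t.
Proof.
move=> b01 s c0 z0 t tb; have [f0 v0 _ _] := flowP a v.
have [b0 b1] := andP b01.
have h1 : -2 < (0 : R) by lra.
have h2 : b < 2 by lra.
have fs := @flow_solution a v 0 b h1 h2.
have c00 : c 0 = flow a v 0 by rewrite c0 f0.
have [] := ode_solution_close b01 s fs c00 tb.
rewrite z0 v0 subrr normr0 !mulr0 scaler0 subr0 !normr_le0 !subr_eq0.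
by move=> /eqP -> /eqP ->.
Qed.

Definition endpoint (a v : 'rV[R]_n) : 'rV[R]_n := flow a v 1.

Lemma endpoint_perturbed_identity a v w :
  `|endpoint a v - endpoint a w - (v - w)| <= 2^-1 * `|v - w|.
Proof.
have [f0 v0 _ _] := flowP a v; have [f0' v0' _ _] := flowP a w.
have h1 : -2 < (0 : R) by lra.
have h2 : 1 < (2 : R) by lra.
have c00 : flow a v 0 = flow a w 0 by rewrite f0 f0'.
have b01 : 0 <= (1 : R) <= 1 by rewrite ler01 lexx.
have := ode_solution_close b01 (@flow_solution a v 0 1 h1 h2)
   (@flow_solution a w 0 1 h1 h2) c00 b01.
by rewrite v0 v0' scale1r => -[].
Qed.

Lemma endpoint0 a : endpoint a 0 = a.
Proof.
have [f0 _ _ _] := flowP a 0.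
apply/eqP; rewrite -subr_eq0 -normr_le0.
have : - 2 < (1 : R) < 2 by apply/andP; split; lra.
by move=> /(flow_close a 0); rewrite normr0 mulr0.
Qed.

End flow.

(** * Functions of class C^1 and Lipschitz functions *)

(** Argued on first-order expansions, since [f] is only known to have a derivative in the direction
    [v]. The factor [c] may vanish, whence the divisions by [|c| + 1]. *)
Lemma is_derive_segment (R : realType) (V W : normedModType R) (f : V -> W)
    (w v : V) (c t : R) (l : W) :
  is_derive (t *: (c *: v) + w) v f l ->
  is_derive t 1 (fun s => f (s *: (c *: v) + w)) (c *: l).
Proof.
move=> /is_derive_expand H; apply: expand_is_derive => e e0.
have c1 : 0 < `|c| + 1 by rewrite ltr_wpDl.
have [|d d0 Hd] := H (e / (`|c| + 1)); first by rewrite divr_gt0.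
exists (d / (`|c| + 1)); first by rewrite divr_gt0.
move=> h; rewrite ltr_pdivlMr// => hd.
have hc : `|h * c| < d.
  rewrite normrM; apply: le_lt_trans hd.
  by rewrite ler_wpM2l// lerDl.
have := Hd (h * c) hc; rewrite [h *: 1]mulr1 addrA.
rewrite -!scalerA -scalerDl => /le_trans; apply.
rewrite mulrAC ler_pdivrMr// normrM -mulrA ler_wpM2l ?(ltW e0)//.
by rewrite ler_wpM2l// lerDl.
Qed.

Lemma is_derive_line (R : realType) (V W : normedModType R) (f : V -> W) (x v : V) (l : W) :
  is_derive x v f l <-> is_derive (0 : R) 1 (fun h : R => f (h *: v + x)) l.
Proof.
split=> /is_derive_expand H; apply: expand_is_derive => e e0;
  have [d d0 Hd] := H e e0; exists d => // h hd; have := Hd h hd;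
  by rewrite addr0 [h *: 1]mulr1 scale0r add0r.
Qed.

Lemma is_derive_comp (R : realType) (U V W : normedModType R) (g : U -> V)
    (f : V -> W) (x v : U) (l : V) :
  differentiable f (g x) -> is_derive x v g l ->
  is_derive x v (f \o g) ('d f (g x) l).
Proof.
move=> df /is_derive_line [dg dgl]; apply/is_derive_line.
have dg' := (derivable1_diffP _ _).1 dg.
have e0 : g (0 *: v + x) = g x by rewrite scale0r add0r.
have df0 : differentiable f (g ((0 : R) *: v + x)) by rewrite e0.
apply: DeriveDef.
  by apply/derivable1_diffP; exact: (differentiable_comp dg' df0).
rewrite deriveE; last exact: (differentiable_comp dg' df0).
have dl' : 'd (fun h : R => g (h *: v + x)) (0 : R) 1 = l by rewrite -deriveE.
by rewrite (diff_comp dg' df0) /= dl' e0.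
Qed.

Lemma open_ball_mem (R : realType) (V : normedModType R) (A : set V) (x : V) :
  open A -> A x -> exists2 d, 0 < d & forall y, `|y - x| < d -> A y.
Proof.
move=> oA Ax; have nA : nbhs x A by exact: open_nbhs_nbhs.
have [d /= d0 H] := (@nbhs_normP R V x A).1 nA; exists d => // y yd.
by apply: H; rewrite /ball_/= distrC.
Qed.

Lemma within_open_continuous (T U : topologicalType) (A : set T) (f : T -> U) x :
  open A -> {within A, continuous f} -> A x -> {for x, continuous f}.
Proof.
move=> oA cf Ax; rewrite continuous_open_subspace// in cf.
by apply: cf; rewrite inE.
Qed.

Lemma continuous_for_dist (R : realType) (V W : normedModType R) (f : V -> W) (x : V) :
  {for x, continuous f} -> forall e, 0 < e -> exists2 d, 0 < d &
    forall y, `|y - x| < d -> `|f y - f x| < e.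
Proof.
move=> cf e e0; have H0 := (cvgrPdist_lt _ _).1 cf e e0.
have [d /= d0 H] := (@nbhs_normP R V x _).1 (H0 _).
by exists d => // y yd; rewrite distrC; apply: H; rewrite /ball_/= distrC.
Qed.

Section C1.
Variables (R : realType) (n : nat) (W : normedModType R).
Variables (A : set 'rV[R]_n) (f : 'rV[R]_n -> W).
Hypothesis oA : open A.

Section at_point.
Hypothesis Cf : Ck 1 A f.
Variables (x : 'rV[R]_n).
Hypothesis Ax : A x.

(** Passing from [w] to [u] one coordinate at a time, each step is a mean value estimate along an
    axis, where the partial derivative is close to its value at [x]. The form with two variable
    points, rather than one point and [x], yields local Lipschitz continuity at once and carries the
    proof of [schwarz]. *)
Lemma C1_strict_differentiable e : 0 < e -> exists2 d, 0 < d & forall u w,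
  `|u - x| < d -> `|w - x| < d ->
  `|f u - f w - \sum_i (u - w) 0 i *: partial i f x| <= e * `|u - w|.
Proof.
move=> e0; have [d1 d10 Ad1] := open_ball_mem oA Ax.
case: (Cf) => _ /= C1.
pose e' := e / (n%:R + 1).
have n1 : 0 < n%:R + 1 :> R by rewrite ltr_wpDl.
have e'0 : 0 < e' by rewrite divr_gt0.
have H i : exists2 d, 0 < d & forall y, `|y - x| < d -> `|partial i f y - partial i f x| < e'.
  apply: continuous_for_dist => //.
  have [_ [ci _]] := C1 i; exact: within_open_continuous oA ci Ax.
have [d2 d20 Hd2] : exists2 d, 0 < d & forall i y, `|y - x| < d ->
    `|partial i f y - partial i f x| < e'.
  pose d i := sval (cid2 (H i)).
  have d_gt0 i : 0 < d i by rewrite /d; case: cid2.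
  exists (\big[Num.min/1]_i d i).
    by apply: (big_ind (fun r => 0 < r)) => // a b a0 b0; rewrite lt_min a0.
  move=> i y yd; have : `|y - x| < d i.
    by apply: lt_le_trans yd _; exact: bigmin_le_cond.
  by rewrite /d; case: cid2 => r r0 Hr /= /Hr.
exists (Num.min d1 d2) => [|u w ux wx]; first by rewrite lt_min d10.
have cvx (y : 'rV[R]_n) : (forall i, `|(y - x) 0 i| <= Num.max `|u - x| `|w - x|) ->
    `|y - x| < Num.min d1 d2.
  move=> Hy; apply: le_lt_trans (_ : Num.max `|u - x| `|w - x| < _); last first.
    by rewrite gt_max ux wx.
  apply: mx_norm_le => [|j i]; first by rewrite le_max normr_ge0.
  by rewrite ord1; exact: Hy.
(* The first [k] coordinates come from [u] and the others from [w]. Every point met on the way has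
   coordinates between those of [u] and [w], hence stays in the max-norm ball around [x]. *)
pose h (k : nat) : 'rV[R]_n := \row_i (if (i < k)%N then u 0 i else w 0 i).
have hS (k : 'I_n) : h k.+1 = 1 *: ((u - w) 0 k *: delta_mx 0 k) + h k.
  apply/rowP => j; rewrite !mxE eqxx /= mul1r ltnS leq_eqVlt.
  have [jk|jk] := eqVneq j k; first by rewrite jk eqxx /= ltnn mulr1 subrK.
  by rewrite mulr0 add0r (inj_eq val_inj) (negbTE jk).
have h0 : h 0%N = w by apply/rowP => j; rewrite !mxE.
have hn : h n = u by apply/rowP => j; rewrite !mxE ltn_ord.
have step (k : 'I_n) : `|f (h k.+1) - f (h k) - (u - w) 0 k *: partial k f x| <= e' * `|u - w|.
  pose g t := f (t *: ((u - w) 0 k *: delta_mx 0 k) + h k) - t *: ((u - w) 0 k *: partial k f x).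
  have inb (t : R) : 0 <= t <= 1 -> `|t *: ((u - w) 0 k *: delta_mx 0 k) + h k - x| < Num.min d1 d2.
    move=> /andP[t0 t1]; apply: cvx => i; rewrite !mxE eqxx /=.
    have ui : `|u 0 i - x 0 i| <= `|u - x| by have := ler_coord_norm (u - x) 0 i; rewrite !mxE.
    have wi : `|w 0 i - x 0 i| <= `|w - x| by have := ler_coord_norm (w - x) 0 i; rewrite !mxE.
    have [->|ik] := eqVneq i k; last first.
      rewrite mulr0 mulr0 add0r; case: ifP => _.
        by rewrite le_max ui.
      by rewrite le_max wi orbT.
    rewrite ltnn mulr1.
    have -> : t * (u 0 k - w 0 k) + w 0 k - x 0 k =
       t * (u 0 k - x 0 k) + (1 - t) * (w 0 k - x 0 k) by ring.
    apply: (le_trans (ler_normD _ _)); rewrite !normrM ger0_norm// [`|1 - t|]ger0_norm ?subr_ge0//.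
    have uk : `|u 0 k - x 0 k| <= Num.max `|u - x| `|w - x|.
      by rewrite le_max; have := ler_coord_norm (u - x) 0 k; rewrite !mxE => ->.
    have wk : `|w 0 k - x 0 k| <= Num.max `|u - x| `|w - x|.
      by rewrite le_max; have := ler_coord_norm (w - x) 0 k; rewrite !mxE => ->; rewrite orbT.
    set m := Num.max _ _ in uk wk *.
    have h1 : t * `|u 0 k - x 0 k| <= t * m by rewrite ler_wpM2l.
    have h2 : (1 - t) * `|w 0 k - x 0 k| <= (1 - t) * m by rewrite ler_wpM2l ?subr_ge0.
    lra.
  have dg (t : R) : 0 <= t <= 1 -> is_derive t 1 g
      ((u - w) 0 k *: partial k f (t *: ((u - w) 0 k *: delta_mx 0 k) + h k)
        - (u - w) 0 k *: partial k f x).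
    move=> t01; apply: is_deriveB.
      apply: is_derive_segment; apply/derivableP.
      have [+ _] := C1 k; apply; apply: Ad1.
      by have := inb t t01; rewrite lt_min => /andP[].
    apply: DeriveDef.
      by apply/derivable1_diffP; apply: ex_diff.
    by rewrite deriveE ?diff_val ?scale1r//; apply: ex_diff.
  have := @mean_value_ineq _ _ g _ 0 1 (e' * `|u - w|) ler01 dg.
  rewrite subr0 mulr1 /g scale0r add0r scale0r subr0 -hS scale1r addrAC; apply.
  move=> t t01; rewrite -scalerBr normrZ mulrC ler_pM//; last exact: ler_coord_norm.
  apply/ltW/Hd2; have := inb t t01; rewrite lt_min => /andP[].
  by [].
have tel : f u - f w = \sum_(k < n) (f (h k.+1) - f (h k)).
  by rewrite -(big_mkord xpredT (fun k => f (h k.+1) - f (h k))) telescope_sumr// h0 hn.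
rewrite tel -sumrB (le_trans (ler_norm_sum _ _ _))//.
apply: (@le_trans _ _ (\sum_(k < n) e' * `|u - w|)); first by apply: ler_sum => k _; exact: step.
have ee : e = e' * (n%:R + 1) by rewrite divfK// gt_eqF.
rewrite sumr_const card_ord -mulr_natr [X in _ <= X * _]ee.
have : 0 <= e' * `|u - w| by rewrite mulr_ge0// ltW.
by move: e' {ee e'0 Hd2 step H} => e'; lra.
Qed.

Let L (w : 'rV[R]_n) : W := \sum_i w 0 i *: partial i f x.

Let L_linear : linear L.
Proof.
move=> a u v; rewrite /L scaler_sumr -big_split/=; apply: eq_bigr => i _.
by rewrite !mxE scalerDl scalerA.
Qed.

Let Lf : {linear 'rV[R]_n -> W} := HB.pack L (GRing.isLinear.Build _ _ _ _ _ L_linear).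

Let L_continuous : continuous Lf.
Proof.
apply: (@lipschitz_continuous _ _ _ _ (\sum_i `|partial i f x|)) => u w.
rewrite -linearB /= /L (le_trans (ler_norm_sum _ _ _))// mulr_suml; apply: ler_sum => i _.
by rewrite normrZ mulrC ler_wpM2l// ler_coord_norm.
Qed.

Let L_expand : f \o shift x = cst (f x) + Lf +o_ 0 id.
Proof.
apply/eqaddoP => e e0; have [d d0 Hd] := C1_strict_differentiable e0.
near=> w; rewrite !fctE /= opprD addrA.
have := Hd (w + x) x; rewrite subrr normr0 addrK; apply => //.
Unshelve. all: by end_near. Qed.

Lemma C1_diff w : 'd f x w = \sum_i w 0 i *: partial i f x.
Proof. by rewrite (diff_unique L_continuous L_expand). Qed.

Lemma C1_differentiable : differentiable f x.
Proof.
apply/diff_locallyP; rewrite (diff_unique L_continuous L_expand).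
by split; [exact: L_continuous|exact: L_expand].
Qed.

End at_point.
End C1.

Lemma C1_chain (R : realType) (n : nat) (U W : normedModType R) (A : set 'rV[R]_n)
    (f : 'rV[R]_n -> W) (g : U -> 'rV[R]_n) (x v : U) (l : 'rV[R]_n) :
  open A -> Ck 1 A f -> A (g x) -> is_derive x v g l ->
  is_derive x v (f \o g) (\sum_i l 0 i *: partial i f (g x)).
Proof.
move=> oA Cf Ax dg; rewrite -(C1_diff oA Cf Ax).
apply: is_derive_comp => //; exact: (C1_differentiable oA Cf Ax).
Qed.

(** The second difference of [f] along [s * e_k] and [s * e_l] is symmetric in [k] and [l]. By [key]
    it equals [s ^+ 2] times either mixed derivative up to [e * s ^+ 2]: the mean value inequality
    is applied in the direction [k], and strict differentiability of [partial k f] handles the shift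
    in the direction [l]. *)
Lemma schwarz (R : realType) (n : nat) (W : normedModType R) (A : set 'rV[R]_n)
    (f : 'rV[R]_n -> W) (x : 'rV[R]_n) (i j : 'I_n) :
  open A -> Ck 2 A f -> A x -> partial i (partial j f) x = partial j (partial i f) x.
Proof.
move=> oA Cf Ax; case: (Cf) => _ Cf1.
have key (k l : 'I_n) : forall e, 0 < e -> exists2 d, 0 < d & forall s : R, 0 < s < d ->
    `|f (s *: delta_mx 0 k + s *: delta_mx 0 l + x) - f (s *: delta_mx 0 k + x)
      - f (s *: delta_mx 0 l + x) + f x - s ^+ 2 *: partial l (partial k f) x| <= e * s ^+ 2.
  move=> e e0; have [dk Ck1] := Cf1 k.
  have [d1 d10 Ad1] := open_ball_mem oA Ax.
  have [d2 d20 Hd2] := C1_strict_differentiable oA Ck1 Ax e0.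
  exists (Num.min d1 d2 / 2); first by rewrite divr_gt0// lt_min d10.
  move=> s /andP[s0 sd].
  pose g (t : R) := f (t *: (1 *: delta_mx 0 k) + (s *: delta_mx 0 l + x))
    - f (t *: (1 *: delta_mx 0 k) + x) - t *: (s *: partial l (partial k f) x).
  have dl m : `|delta_mx 0 m : 'rV[R]_n| <= 1.
    by apply: mx_norm_le => // a b; rewrite mxE; case: (_ && _); rewrite ?normr1// normr0.
  have near1 (t : R) : 0 <= t <= s ->
      `|t *: (1 *: delta_mx 0 k) + (s *: delta_mx 0 l + x) - x| < Num.min d1 d2.
    move=> /andP[t0 ts]; rewrite scale1r addrA addrK (le_lt_trans (ler_normD _ _))//.
    rewrite !normrZ !ger0_norm ?(ltW s0)//.
    have h1 : t * `|delta_mx 0 k : 'rV[R]_n| <= t by rewrite ler_piMr.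
    have h2 : s * `|delta_mx 0 l : 'rV[R]_n| <= s by rewrite ler_piMr// ltW.
    lra.
  have near2 (t : R) : 0 <= t <= s -> `|t *: (1 *: delta_mx 0 k) + x - x| < Num.min d1 d2.
    move=> /andP[t0 ts]; rewrite scale1r addrK normrZ ger0_norm//.
    have h1 : t * `|delta_mx 0 k : 'rV[R]_n| <= t by rewrite ler_piMr.
    lra.
  have dg (t : R) : 0 <= t <= s -> is_derive t 1 g
     (1 *: partial k f (t *: (1 *: delta_mx 0 k) + (s *: delta_mx 0 l + x))
      - 1 *: partial k f (t *: (1 *: delta_mx 0 k) + x) - s *: partial l (partial k f) x).
    move=> ts; have := near1 t ts; have := near2 t ts.
    rewrite !lt_min => /andP[n1 _] /andP[n2 _].
    apply: is_deriveB.
      apply: is_deriveB; apply: is_derive_segment; apply/derivableP; apply: dk; exact: Ad1.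
    apply: DeriveDef.
      by apply/derivable1_diffP; apply: ex_diff.
    by rewrite deriveE ?diff_val ?scale1r//; apply: ex_diff.
  have := @mean_value_ineq _ _ g _ 0 s (e * s) (ltW s0) dg.
  rewrite subr0 -mulrA -expr2.
  have -> : g s - g 0 = f (s *: delta_mx 0 k + s *: delta_mx 0 l + x) - f (s *: delta_mx 0 k + x)
      - f (s *: delta_mx 0 l + x) + f x - s ^+ 2 *: partial l (partial k f) x.
    rewrite /g !scale1r !scale0r !add0r subr0 scalerA -expr2 opprB [s *: _ + (_ + _)]addrA.
    by rewrite [f x - _]addrC addrA [RHS]addrAC; congr (_ + f x); rewrite [LHS]addrAC.
  apply => t ts; rewrite !scale1r.
  have := near1 t ts; have := near2 t ts.
  rewrite !lt_min => /andP[_ n1] /andP[_ n2].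
  have := Hd2 _ _ n2 n1.
  rewrite opprD addrACA subrr add0r addrK.
  have -> : \sum_m (s *: delta_mx 0 l : 'rV[R]_n) 0 m *: partial m (partial k f) x = s *: partial l (partial k f) x.
    rewrite (bigD1 l)//= big1 ?addr0 => [|m ml]; first by rewrite !mxE !eqxx mulr1.
    by rewrite !mxE eqxx (negbTE ml) mulr0 scale0r.
  rewrite !scale1r => /le_trans; apply; rewrite normrZ gtr0_norm// ler_wpM2l ?(ltW e0)//.
  by rewrite ler_piMr// ltW.
apply/eqP; rewrite -subr_eq0 -normr_le0; apply/ler_addgt0Pr => e e0; rewrite add0r.
have e20 : 0 < e / 2 by rewrite divr_gt0.
have [d1 d10 H1] := key i j _ e20; have [d2 d20 H2] := key j i _ e20.
pose s := Num.min d1 d2 / 2.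
have s0 : 0 < s by rewrite divr_gt0// lt_min d10.
have m0 : 0 < Num.min d1 d2 by rewrite lt_min d10.
have s1 : 0 < s < d1.
  rewrite s0 /= (@lt_le_trans _ _ (Num.min d1 d2))// ?ge_min ?lexx// /s; lra.
have s2 : 0 < s < d2.
  rewrite s0 /= (@lt_le_trans _ _ (Num.min d1 d2))// ?ge_min ?lexx ?orbT// /s; lra.
have := H1 s s1; have := H2 s s2.
rewrite [s *: delta_mx 0 j + _]addrC.
set z := f (_ + _ + _).
have -> : z - f (s *: delta_mx 0 j + x) - f (s *: delta_mx 0 i + x) = 
  z - f (s *: delta_mx 0 i + x) - f (s *: delta_mx 0 j + x) by rewrite addrAC.
set w := _ + f x.
move: (partial i (partial j f) x) (partial j (partial i f) x) => P Q h1 h2.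
have : `|s ^+ 2 *: (P - Q)| <= e * s ^+ 2.
  have -> : s ^+ 2 *: (P - Q) = (w - s ^+ 2 *: Q) - (w - s ^+ 2 *: P).
    by rewrite scalerBr opprB [RHS]addrC subrKA.
  by rewrite (le_trans (ler_normB _ _))// (splitr e) mulrDl lerD.
rewrite normrZ gtr0_norm ?exprn_gt0// mulrC ler_pM2r ?exprn_gt0//.
Qed.

(** * Lipschitz continuity near a point, with explicit radius and constant *)

Definition lipschitz_at (R : realType) (n : nat) (W : normedModType R)
    (f : 'rV[R]_n -> W) (x : 'rV[R]_n) : Prop :=
  exists d K : R, 0 < d /\ forall u w, `|u - x| < d -> `|w - x| < d ->
    `|f u - f w| <= K * `|u - w|.

Section lipschitz_at.
Variables (R : realType) (n : nat).
Implicit Types (f g : 'rV[R]_n -> R) (x : 'rV[R]_n).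

Lemma C1_lipschitz_at (W : normedModType R) (A : set 'rV[R]_n) (f : 'rV[R]_n -> W) x :
  open A -> Ck 1 A f -> A x -> lipschitz_at f x.
Proof.
move=> oA Cf Ax; have [d d0 Hd] := C1_strict_differentiable oA Cf Ax ltr01.
exists d, (1 + \sum_i `|partial i f x|); split => // u w ux wx.
have := Hd u w ux wx; rewrite mul1r => h.
rewrite -(subrK (\sum_i (u - w) 0 i *: partial i f x) (f u - f w)).
rewrite (le_trans (ler_normD _ _))// mulrDl mul1r lerD//.
rewrite (le_trans (ler_norm_sum _ _ _))// mulr_suml; apply: ler_sum => i _.
by rewrite normrZ mulrC ler_wpM2l// ler_coord_norm.
Qed.

Lemma locally_lipschitz_at (W : normedModType R) (A : set 'rV[R]_n) (f : 'rV[R]_n -> W) x :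
  open A -> locally_lipschitz A f -> A x -> lipschitz_at f x.
Proof.
move=> oA Lf Ax; have [B nB] := Lf x Ax.
(* The library predicate holds for all constants beyond some [K], so a constant strictly larger than
   [K] is taken. *)
move=> [K [_ /(_ (`|K| + 1))]]; rewrite (le_lt_trans (ler_norm K)) ?ltrDl// => /(_ isT) H.
have [d1 d10 Ad1] := open_ball_mem oA Ax.
have [d2 /= d20 H2] := (@nbhs_normP R _ x B).1 nB.
exists (Num.min d1 d2), (`|K| + 1); split; first by rewrite lt_min d10.
move=> u w; rewrite !lt_min => /andP[u1 u2] /andP[w1 w2].
apply: (H (u, w)); split; split => /=; try exact: Ad1; 
  by apply: H2; rewrite /ball_/= distrC.
Qed.

Lemma lipschitz_at_pos (W : normedModType R) (f : 'rV[R]_n -> W) x : lipschitz_at f x ->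
  exists d K : R, [/\ 0 < d, 0 <= K & forall u w, `|u - x| < d -> `|w - x| < d ->
    `|f u - f w| <= K * `|u - w|].
Proof.
move=> [d [K [d0 H]]]; exists d, `|K|; split=> // u w ux wx.
by apply: (le_trans (H u w ux wx)); rewrite ler_wpM2r// ler_norm.
Qed.

Lemma lipschitz_at_continuous (W : normedModType R) (f : 'rV[R]_n -> W) x :
  lipschitz_at f x -> forall e, 0 < e -> exists2 d, 0 < d &
    forall y, `|y - x| < d -> `|f y - f x| < e.
Proof.
move=> /lipschitz_at_pos [d [K [d0 K0 H]]] e e0.
exists (Num.min d (e / (K + 1))); first by rewrite lt_min d0 divr_gt0// ltr_wpDl.
move=> y; rewrite lt_min => /andP[yd]; rewrite ltr_pdivlMr ?ltr_wpDl// => ye.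
apply: (le_lt_trans (H y x yd _)); first by rewrite subrr normr0.
by apply: le_lt_trans ye; rewrite mulrC ler_wpM2l// lerDl.
Qed.

Lemma lipschitz_at_cst (W : normedModType R) (c : W) x : lipschitz_at (fun _ : 'rV[R]_n => c) x.
Proof. by exists 1, 0; split => // u w _ _; rewrite subrr normr0 mul0r. Qed.

Lemma lipschitz_atD (W : normedModType R) (f g : 'rV[R]_n -> W) x :
  lipschitz_at f x -> lipschitz_at g x -> lipschitz_at (fun y => f y + g y) x.
Proof.
move=> [d [K [d0 H]]] [d' [K' [d'0 H']]].
exists (Num.min d d'), (K + K'); split; first by rewrite lt_min d0.
move=> u w; rewrite !lt_min => /andP[u1 u2] /andP[w1 w2].
rewrite opprD addrACA (le_trans (ler_normD _ _))// mulrDl lerD//.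
  exact: H.
exact: H'.
Qed.

Lemma lipschitz_atM f g x :
  lipschitz_at f x -> lipschitz_at g x -> lipschitz_at (fun y => f y * g y) x.
Proof.
move=> Lf Lg; have [d [K [d0 K0 H]]] := lipschitz_at_pos Lf.
have [d' [K' [d'0 K'0 H']]] := lipschitz_at_pos Lg.
have [e e0 He] := lipschitz_at_continuous Lf ltr01.
have [e' e'0 He'] := lipschitz_at_continuous Lg ltr01.
exists (Num.min (Num.min d d') (Num.min e e')), ((`|f x| + 1) * K' + (`|g x| + 1) * K).
split; first by rewrite !lt_min d0 d'0 e0.
move=> u w; rewrite !lt_min => /andP[/andP[u1 u2] /andP[u3 u4]] /andP[/andP[w1 w2] /andP[w3 w4]].
have -> : f u * g u - f w * g w = f u * (g u - g w) + g w * (f u - f w) by ring.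
apply: (le_trans (ler_normD _ _)); rewrite !normrM mulrDl -!mulrA.
have fu : `|f u| <= `|f x| + 1.
  by have := He u u3; have := ler_normD (f u - f x) (f x); rewrite subrK; lra.
have gw : `|g w| <= `|g x| + 1.
  by have := He' w w4; have := ler_normD (g w - g x) (g x); rewrite subrK; lra.
by apply: lerD; apply: ler_pM => //; [exact: H'|exact: H].
Qed.

Lemma lipschitz_atV f x : f x != 0 -> lipschitz_at f x -> lipschitz_at (fun y => (f y)^-1) x.
Proof.
move=> fx0 Lf; have [d [K [d0 K0 H]]] := lipschitz_at_pos Lf.
have fx20 : 0 < `|f x| / 2 by rewrite divr_gt0// normr_gt0.
have [e e0 He] := lipschitz_at_continuous Lf fx20.
exists (Num.min d e), ((`|f x| / 2)^-2 * K); split; first by rewrite lt_min d0.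
move=> u w; rewrite !lt_min => /andP[u1 u2] /andP[w1 w2].
have lo y : `|y - x| < e -> `|f x| / 2 <= `|f y|.
  move=> /He; have := ler_normD (f x - f y) (f y); rewrite subrK distrC.
  by lra.
have fu := lo u u2; have fw := lo w w2.
have fu0 : f u != 0 by rewrite -normr_gt0 (lt_le_trans fx20).
have fw0 : f w != 0 by rewrite -normr_gt0 (lt_le_trans fx20).
have -> : (f u)^-1 - (f w)^-1 = (f w - f u) / (f u * f w) by field; rewrite ?fu0 ?fw0.
rewrite normrM normfV normrM [`|f w - f u|]distrC [X in X <= _]mulrC -mulrA; apply: ler_pM => //.
- rewrite lef_pV2 ?posrE ?mulr_gt0 ?exprn_gt0 ?normr_gt0// expr2.
  by apply: ler_pM => //; exact: ltW.
- exact: H.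
Qed.

Lemma lipschitz_at_sum (I : finType) (F : I -> 'rV[R]_n -> R) x :
  (forall i, lipschitz_at (F i) x) -> lipschitz_at (fun y => \sum_i F i y) x.
Proof.
move=> H; suff G (s : seq I) : lipschitz_at (fun y => \sum_(i <- s) F i y) x by exact: G.
elim: s => [|i s IH].
  under eq_fun do rewrite big_nil; exact: lipschitz_at_cst.
by under eq_fun do rewrite big_cons; exact: lipschitz_atD.
Qed.

Lemma lipschitz_at_prod (I : finType) (F : I -> 'rV[R]_n -> R) x :
  (forall i, lipschitz_at (F i) x) -> lipschitz_at (fun y => \prod_i F i y) x.
Proof.
move=> H; suff G (s : seq I) : lipschitz_at (fun y => \prod_(i <- s) F i y) x by exact: G.
elim: s => [|i s IH].
  under eq_fun do rewrite big_nil; exact: lipschitz_at_cst.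
by under eq_fun do rewrite big_cons; exact: lipschitz_atM.
Qed.

Lemma lipschitz_at_det m (F : 'rV[R]_n -> 'M[R]_m) x :
  (forall i j, lipschitz_at (fun y => F y i j) x) -> lipschitz_at (fun y => \det (F y)) x.
Proof.
move=> H; rewrite /determinant; apply: lipschitz_at_sum => s.
apply: lipschitz_atM; first exact: lipschitz_at_cst.
by apply: lipschitz_at_prod => i.
Qed.

Lemma lipschitz_at_near (W : normedModType R) (f g : 'rV[R]_n -> W) x d :
  0 < d -> (forall y, `|y - x| < d -> f y = g y) -> lipschitz_at f x -> lipschitz_at g x.
Proof.
move=> d0 fg [d' [K [d'0 H]]]; exists (Num.min d d'), K.
split; first by rewrite lt_min d0.
move=> u w; rewrite !lt_min => /andP[u1 u2] /andP[w1 w2].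
by rewrite -!fg//; exact: H.
Qed.

(** By Cramer's rule the entries are cofactors divided by the determinant, so sums, products and one
    inverse suffice. Invertibility is required on a whole ball because [invmx] follows this formula
    on invertible matrices only. *)
Lemma lipschitz_at_invmx m (F : 'rV[R]_n -> 'M[R]_m) x d :
  0 < d -> (forall y, `|y - x| < d -> F y \in unitmx) ->
  (forall i j, lipschitz_at (fun y => F y i j) x) ->
  forall i j, lipschitz_at (fun y => invmx (F y) i j) x.
Proof.
move=> d0 uF LF i j.
apply: (@lipschitz_at_near _ (fun y => (\det (F y))^-1 * ((-1) ^+ (j + i) * \det (row' j (col' i (F y))))) _ _ d d0).
  by move=> y yd; rewrite /invmx uF// !mxE.
apply: lipschitz_atM.
  apply: lipschitz_atV; last exact: lipschitz_at_det.
  by have := uF x; rewrite subrr normr0 unitmxE unitfE; apply.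
apply: lipschitz_atM; first exact: lipschitz_at_cst.
apply: lipschitz_at_det => k l.
by under eq_fun do rewrite !mxE; exact: LF.
Qed.

End lipschitz_at.

(** * Covariance of the geodesic equation *)

Section euler_lagrange.
Variables (R : realType) (n : nat).
Implicit Types (G J : 'M[R]_n) (dG dJ : 'I_n -> 'M[R]_n) (u w : 'rV[R]_n).

(** The derivative in the direction [w] of a matrix field with partial derivatives [dG]. *)
Definition dirmx dG w : 'M[R]_n := \sum_l w 0 l *: dG l.

(* d/dt (dL/dw) - dL/da for the Lagrangian L(a, w) = 1/2 w G(a) w^T, along a curve with
   velocity w and acceleration u. *)
Definition euler_lagrange G dG w u : 'rV[R]_n :=
  u *m G + w *m dirmx dG w - \row_l (2^-1 * (w *m dG l *m w^T) 0 0).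

Lemma scalar_tr (A : 'M[R]_1) : A^T = A.
Proof. by apply/matrixP => i j; rewrite !mxE !ord1. Qed.

Lemma dirmxD dG dJ w : dirmx (fun l => dG l + dJ l) w = dirmx dG w + dirmx dJ w.
Proof. by rewrite /dirmx -big_split/=; apply: eq_bigr => l _; rewrite scalerDr. Qed.

Lemma dirmxMl G dG w : dirmx (fun l => G *m dG l) w = G *m dirmx dG w.
Proof. by rewrite /dirmx mulmx_sumr; apply: eq_bigr => l _; rewrite scalemxAr. Qed.

Lemma dirmxMr G dG w : dirmx (fun l => dG l *m G) w = dirmx dG w *m G.
Proof. by rewrite /dirmx mulmx_suml; apply: eq_bigr => l _; rewrite scalemxAl. Qed.

Lemma dirmx_tr dG w : dirmx (fun l => (dG l)^T) w = (dirmx dG w)^T.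
Proof. by rewrite /dirmx linear_sum/=; apply: eq_bigr => l _; rewrite linearZ. Qed.

Lemma dirmx_row dG J w : dirmx (fun l => dirmx dG (row l J)) w = dirmx dG (w *m J).
Proof.
rewrite /dirmx; under eq_bigr do rewrite scaler_sumr.
rewrite exchange_big/=; apply: eq_bigr => k _.
rewrite !mxE scaler_suml; apply: eq_bigr => l _.
by rewrite !mxE scalerA.
Qed.

(** The Euler-Lagrange expression is a covector. Here [J] is the Jacobian of a coordinate change,
    [dJ] its partial derivatives, and the second argument on the left is the product rule for
    [J *m G *m J^T]. The terms in which [dJ] meets [G] without differentiating it cancel between the
    two parts of the expression, apart from those absorbed by the transformed acceleration. The
    computation uses neither inverse matrices nor second derivatives of the metric. *)
Lemma euler_lagrange_transform G dG J dJ w u :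
  G^T = G -> (forall l i k, dJ l i k = dJ i l k) ->
  euler_lagrange (J *m G *m J^T)
    (fun l => dJ l *m G *m J^T + J *m dirmx dG (row l J) *m J^T + J *m G *m (dJ l)^T) w u =
  euler_lagrange G dG (w *m J) (u *m J + w *m dirmx dJ w) *m J^T.
Proof.
move=> Gs dJs; set w' := w *m J; set v := w *m dirmx dJ w.
(* The symmetry of second derivatives enters here: it exchanges the direction of differentiation
   with a row index of the Jacobian. *)
have dJw l : row l (dirmx dJ w) = w *m dJ l.
  apply/rowP => k; rewrite !mxE /dirmx summxE; apply: eq_bigr => m _.
  by rewrite !mxE dJs.
have dirE : dirmx (fun l => dJ l *m G *m J^T + J *m dirmx dG (row l J) *m J^T + J *m G *m (dJ l)^T) w =
   dirmx dJ w *m G *m J^T + J *m dirmx dG w' *m J^T + J *m G *m (dirmx dJ w)^T.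
  by rewrite !dirmxD !(dirmxMr, dirmxMl) dirmx_tr dirmx_row.
have addE m (A B : 'rV[R]_m) l : (A + B) 0 l = A 0 l + B 0 l by rewrite mxE.
have quad l : (w *m (dJ l *m G *m J^T + J *m dirmx dG (row l J) *m J^T + J *m G *m (dJ l)^T) *m w^T) 0 0
   = (w' *m dirmx dG (row l J) *m w'^T) 0 0 + 2 * (w' *m G *m (w *m dJ l)^T) 0 0.
  have -> : w *m (dJ l *m G *m J^T + J *m dirmx dG (row l J) *m J^T + J *m G *m (dJ l)^T) *m w^T
    = w' *m G *m (w *m dJ l)^T + w' *m dirmx dG (row l J) *m w'^T + w' *m G *m (w *m dJ l)^T.
    rewrite !mulmxDr !mulmxDl; congr (_ + _ + _).
    - by rewrite -[LHS]scalar_tr /w' !trmx_mul !trmxK Gs !mulmxA.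
    - by rewrite /w' trmx_mul !mulmxA.
    - by rewrite /w' trmx_mul !mulmxA.
  by rewrite !addE; ring.
rewrite /euler_lagrange dirE; apply/rowP => l.
have hr : (\row_k (2^-1 * (w' *m dG k *m w'^T) 0 0) *m J^T) 0 l
   = 2^-1 * (w' *m dirmx dG (row l J) *m w'^T) 0 0.
  rewrite /dirmx mulmx_sumr mulmx_suml summxE mulr_sumr mxE; apply: eq_bigr => k _.
  rewrite -scalemxAr -scalemxAl [X in _ = _ * X]mxE [X in X * _]mxE.
  rewrite [X in _ = _ * (X * _)]mxE [X in _ * X = _]mxE.
  ring.
have hl : (w' *m G *m (dirmx dJ w)^T) 0 l = (w' *m G *m (w *m dJ l)^T) 0 0.
  by rewrite -dJw !mxE; apply: eq_bigr => k _; rewrite !mxE.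
rewrite [LHS]addE [X in _ + X = _]mxE [X in _ - X]mxE quad.
rewrite !mulmxDl mulNmx [RHS]addE [X in _ = _ + X]mxE hr.
rewrite !mulmxDr !addE.
have -> : w *m (J *m G *m (dirmx dJ w)^T) = w' *m G *m (dirmx dJ w)^T by rewrite !mulmxA.
by rewrite hl /v /w' !mulmxA; field.
Qed.

(** Multiplying by the inverse of [G] raises the index. The two terms [dG i j l] and [dG j i l]
    contribute equally once contracted with the symmetric [w_i w_j], which accounts for the factor
    1/2. *)
Lemma euler_lagrange_eq0 G dG w u : G \in unitmx -> G^T = G -> (forall l, (dG l)^T = dG l) ->
  (forall k, u 0 k + \sum_i \sum_j (2^-1 * \sum_l invmx G k l *
     (dG i j l + dG j i l - dG l i j)) * w 0 i * w 0 j = 0) <->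
  euler_lagrange G dG w u = 0.
Proof.
move=> uG Gs dGs.
pose S := w *m dirmx dG w - \row_l (2^-1 * (w *m dG l *m w^T) 0 0).
have SE l : S 0 l = \sum_i \sum_j 2^-1 * (dG i j l + dG j i l - dG l i j) * w 0 i * w 0 j.
  have quad : (w *m dG l *m w^T) 0 0 = \sum_i \sum_j dG l i j * w 0 i * w 0 j.
    rewrite mxE exchange_big/=; apply: eq_bigr => j _; rewrite !mxE mulr_suml.
    by apply: eq_bigr => i _; ring.
  have dir : (w *m dirmx dG w) 0 l = \sum_i \sum_j dG i j l * w 0 i * w 0 j.
    rewrite mxE exchange_big/=; apply: eq_bigr => j _; rewrite /dirmx summxE mulr_sumr.
    by apply: eq_bigr => i _; rewrite mxE; ring.
  have dir' : (w *m dirmx dG w) 0 l = \sum_i \sum_j dG j i l * w 0 i * w 0 j.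
    rewrite dir exchange_big/=; apply: eq_bigr => j _.
    by apply: eq_bigr => i _; ring.
  rewrite /S mxE [X in _ + X]mxE [X in _ - X]mxE.
  have -> : (w *m dirmx dG w) 0 l = 2^-1 * (w *m dirmx dG w) 0 l + 2^-1 * (w *m dirmx dG w) 0 l.
    by field.
  rewrite {1}dir dir' quad !mulr_sumr -big_split/= -sumrB; apply: eq_bigr => i _.
  rewrite !mulr_sumr -big_split/= -sumrB; apply: eq_bigr => j _.
  ring.
have E k : u 0 k + \sum_i \sum_j (2^-1 * \sum_l invmx G k l *
     (dG i j l + dG j i l - dG l i j)) * w 0 i * w 0 j = (u + S *m invmx G) 0 k.
  rewrite !mxE; congr (_ + _).
  under [RHS]eq_bigr do rewrite SE mulr_suml.
  rewrite [RHS]exchange_big/=; apply: eq_bigr => i _.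
  under [RHS]eq_bigr do rewrite mulr_suml.
  rewrite [RHS]exchange_big/=; apply: eq_bigr => j _.
  rewrite mulr_sumr !mulr_suml; apply: eq_bigr => l _.
  have -> : invmx G k l = invmx G l k.
    by rewrite -[in LHS]Gs -trmx_inv mxE.
  ring.
have EL : euler_lagrange G dG w u = (u + S *m invmx G) *m G.
  by rewrite mulmxDl mulmxKV// /euler_lagrange /S addrA.
rewrite EL; split => [H|H].
  have -> : u + S *m invmx G = 0 by apply/rowP => k; rewrite -E H mxE.
  by rewrite mul0mx.
move=> k; rewrite E.
have -> : u + S *m invmx G = 0 by rewrite -(mulmxK uG (u + _)) H mul0mx.
by rewrite mxE.
Qed.

End euler_lagrange.

Section matrix_derivative.
Variables (R : realType) (V : normedModType R) (a v : V).

Lemma is_derive_fun_sum m (F : 'I_m -> V -> R) (dF : 'I_m -> R) :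
  (forall i, is_derive a v (F i) (dF i)) ->
  is_derive a v (fun y => \sum_i F i y) (\sum_i dF i).
Proof.
move=> H; have -> : (fun y => \sum_i F i y) = \sum_i F i.
  by apply/funext => y; rewrite fct_sumE.
exact: is_derive_sum.
Qed.

Lemma is_derive_fun_mul (f g : V -> R) (df dg : R) :
  is_derive a v f df -> is_derive a v g dg ->
  is_derive a v (fun y => f y * g y) (df * g a + f a * dg).
Proof.
move=> Hf Hg; have -> : df * g a + f a * dg = f a *: dg + g a *: df.
  by rewrite addrC [df * _]mulrC.
exact: is_deriveM.
Qed.

Lemma is_derive_mulmx m n p (A : V -> 'M[R]_(m, n)) (B : V -> 'M[R]_(n, p)) dA dB :
  is_derive a v A dA -> is_derive a v B dB ->
  is_derive a v (fun y => A y *m B y) (dA *m B a + A a *m dB).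
Proof.
move=> /is_derive_mxP HA /is_derive_mxP HB; apply/is_derive_mxP => i j.
have -> : (dA *m B a + A a *m dB) i j = \sum_k (dA i k * B a k j + A a i k * dB k j).
  by rewrite !mxE -big_split.
have -> : (fun y => (A y *m B y) i j) = (fun y => \sum_k A y i k * B y k j).
  by apply/funext => y; rewrite mxE.
by apply: is_derive_fun_sum => k; apply: is_derive_fun_mul.
Qed.

Lemma is_derive_trmx m n (A : V -> 'M[R]_(m, n)) dA :
  is_derive a v A dA -> is_derive a v (fun y => (A y)^T) dA^T.
Proof.
move=> /is_derive_mxP HA; apply/is_derive_mxP => i j; rewrite mxE.
have -> : (fun y => (A y)^T i j) = (fun y => A y j i) by apply/funext => y; rewrite mxE.
exact: HA.
Qed.

End matrix_derivative.

(** * Transition maps, their derivatives, and the components of a metric *)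

Section charts.
Variables (R : realType) (n : nat) (M : topologicalType).
Implicit Types (x y z : chart R n M) (a : 'rV[R]_n) (q : M).

Definition transition x y : 'rV[R]_n -> 'rV[R]_n := chart_map y \o chart_inv x.

Definition overlap x y : set 'rV[R]_n := chart_map x @` (chart_dom x `&` chart_dom y).

Lemma chart_invK x q : chart_dom x q -> chart_inv x (chart_map x q) = q.
Proof. by move=> xq; apply: chart_mapK; rewrite inE. Qed.

Lemma chart_imgP x a : chart_img x a -> chart_dom x (chart_inv x a) /\ chart_map x (chart_inv x a) = a.
Proof. by move=> [q xq <-]; rewrite chart_invK. Qed.

Lemma chart_img_map x q : chart_dom x q -> chart_img x (chart_map x q).
Proof. by move=> xq; exists q. Qed.

Lemma chart_map_cts x q : chart_dom x q -> {for q, continuous (chart_map x)}.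
Proof.
exact: within_open_continuous (@chart_dom_open _ _ _ x) (@chart_map_continuous _ _ _ x).
Qed.

Lemma chart_inv_cts x a : chart_img x a -> {for a, continuous (chart_inv x)}.
Proof.
exact: within_open_continuous (@chart_img_open _ _ _ x) (@chart_inv_continuous _ _ _ x).
Qed.

Lemma open_chart_image x (O : set M) : open O -> open (chart_map x @` (chart_dom x `&` O)).
Proof.
move=> oO; have -> : chart_map x @` (chart_dom x `&` O) = chart_img x `&` chart_inv x @^-1` O.
  apply/seteqP; split => [_ [q [xq Oq] <-]|a [/chart_imgP[xa aE] Oa]].
    by split; [exact: chart_img_map|rewrite /= chart_invK].
  by exists (chart_inv x a).
apply: (continuous_inP _ (@chart_img_open _ _ _ x)).1 => //.
by rewrite -continuous_open_subspace; [exact: chart_inv_continuous|exact: chart_img_open].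
Qed.

Lemma open_chart_preimage x (B : set 'rV[R]_n) : open B -> open (chart_dom x `&` chart_map x @^-1` B).
Proof.
move=> oB; apply: (continuous_inP _ (@chart_dom_open _ _ _ x)).1 => //.
by rewrite -continuous_open_subspace; [exact: chart_map_continuous|exact: chart_dom_open].
Qed.

Lemma open_overlap x y : open (overlap x y).
Proof. exact: open_chart_image (@chart_dom_open _ _ _ y). Qed.

Lemma overlapP x y a : overlap x y a <-> chart_img x a /\ chart_dom y (chart_inv x a).
Proof.
split=> [[q [xq yq] <-]|[/chart_imgP[xa aE] ya]]; last by exists (chart_inv x a).
by rewrite chart_invK//; split => //; exact: chart_img_map.
Qed.

(** The partial derivatives form the rows, so that components of vectors, being row vectors, pass
    from [x] to [y] by multiplication on the right. *)
Definition jac x y a : 'M[R]_n := \matrix_(i, k) partial i (transition x y) a 0 k.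

(** The derivative of [jac x y] in the coordinate direction [l]. *)
Definition hess x y a (l : 'I_n) : 'M[R]_n :=
  \matrix_(i, k) partial l (partial i (transition x y)) a 0 k.

Lemma sum_partial x y a (w : 'rV[R]_n) :
  \sum_i w 0 i *: partial i (transition x y) a = w *m jac x y a.
Proof.
apply/rowP => k; rewrite summxE mxE; apply: eq_bigr => i _; by rewrite !mxE.
Qed.

End charts.

Section manifold.
Variables (R : realType) (n : nat) (M : manifold R n).
Implicit Types (x y z : chart R n M) (a : 'rV[R]_n) (q : M).

Lemma transition_Ck k x y : atlas x -> atlas y -> Ck k (overlap x y) (transition x y).
Proof. by move=> ax ay; have [H _] := atlas_compatible ax ay; exact: H. Qed.

Lemma hess_sym x y a l i k : atlas x -> atlas y -> overlap x y a ->
  hess x y a l i k = hess x y a i l k.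
Proof.
move=> ax ay xy.
have E := schwarz l i (@open_overlap _ _ _ x y) (transition_Ck 2 ax ay) xy.
rewrite [LHS]mxE [RHS]mxE; exact: (f_equal (fun v : 'rV[R]_n => v 0 k) E).
Qed.

Lemma transition_derive x y a v : atlas x -> atlas y -> overlap x y a ->
  is_derive a v (transition x y) (v *m jac x y a).
Proof.
move=> ax ay xy; rewrite -sum_partial.
have := @C1_chain R n _ _ (overlap x y) (transition x y) id a v v (@open_overlap _ _ _ x y)
  (transition_Ck 1 ax ay) xy.
by apply; exact: is_derive_id.
Qed.

Lemma near_overlap x y a : overlap x y a -> \forall b \near a, overlap x y b.
Proof. by move=> xy; apply: open_nbhs_nbhs; split => //; exact: open_overlap. Qed.

Lemma partial_transition x y a i : partial i (transition x y) a = row i (jac x y a).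
Proof. by apply/rowP => k; rewrite !mxE. Qed.

Lemma partial_derive (W : normedModType R) (f : 'rV[R]_n -> W) a i l :
  is_derive a (delta_mx 0 i) f l -> partial i f a = l.
Proof. by case. Qed.

Lemma jac_chain x y z a : atlas x -> atlas y -> atlas z ->
  overlap x y a -> chart_dom z (chart_inv x a) ->
  jac x z a = jac x y a *m jac y z (transition x y a).
Proof.
move=> ax ay az xya za.
have yza : overlap y z (transition x y a).
  case: xya => q [xq yq] qa; move: za; rewrite -qa chart_invK// => zq.
  by rewrite /transition /= chart_invK//; exists q.
apply/row_matrixP => i; rewrite -partial_transition row_mul -partial_transition.
apply: partial_derive.
apply: (@near_eq_is_derive _ _ _ (transition y z \o transition x y)).
  have := near_overlap xya; apply: filterS => b [q [xq yq] <-].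
  by rewrite /transition /= !chart_invK.
rewrite -sum_partial; apply: (C1_chain (@open_overlap _ _ _ y z)) => //.
  exact: transition_Ck.
rewrite partial_transition rowE; exact: transition_derive.
Qed.

Lemma jac_id x a : chart_img x a -> jac x x a = 1%:M.
Proof.
move=> xa; apply/row_matrixP => i; rewrite -partial_transition.
apply: partial_derive; apply: (@near_eq_is_derive _ _ _ id).
  have : \forall b \near a, chart_img x b.
    by apply: open_nbhs_nbhs; split => //; exact: chart_img_open.
  by apply: filterS => b /chart_imgP[xb xbE]; rewrite /transition /= xbE.
by rewrite rowE mulmx1; exact: is_derive_id.
Qed.

Lemma jac_inv x y a : atlas x -> atlas y -> overlap x y a ->
  jac x y a *m jac y x (transition x y a) = 1%:M.
Proof.
move=> ax ay xya; have [xa _] := (overlapP x y a).1 xya.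
by rewrite -jac_chain ?jac_id//; have [] := chart_imgP xa.
Qed.

Lemma jac_unit x y a : atlas x -> atlas y -> overlap x y a -> jac x y a \in unitmx.
Proof. by move=> ax ay xya; have [] := mulmx1_unit (jac_inv ax ay xya). Qed.

Definition metric_mx (g : M -> 'M[R]_n) x a : 'M[R]_n := \matrix_(r, s) component g x r s a.

Definition metric_dmx (g : M -> 'M[R]_n) x a (l : 'I_n) : 'M[R]_n :=
  \matrix_(i, j) partial l (component g x i j) a.

Lemma bform_mul (G P : 'M[R]_n) (u v : 'rV[R]_n) :
  bform G (u *m P) (v *m P) = bform (P *m G *m P^T) u v.
Proof. by rewrite /bform trmx_mul !mulmxA. Qed.

Lemma bform_delta (G : 'M[R]_n) i j : bform G (delta_mx 0 i) (delta_mx 0 j) = G i j.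
Proof. by rewrite /bform -rowE trmx_delta -colE !mxE. Qed.

Lemma bform_row (G P : 'M[R]_n) i j : bform G (row i P) (row j P) = (P *m G *m P^T) i j.
Proof. by rewrite !rowE bform_mul bform_delta. Qed.

(** Connects components in an arbitrary chart with [g q], which is written in the basis of
    [chart_at q]: the vectors [frame x q i] are the rows of the Jacobian towards that chart. *)
Lemma metric_mxE g x q : chart_dom x q ->
  metric_mx g x (chart_map x q) =
  jac x (chart_at q) (chart_map x q) *m g q *m (jac x (chart_at q) (chart_map x q))^T.
Proof.
move=> xq; apply/matrixP => i j; rewrite mxE /component chart_invK// /frame.
by rewrite -bform_row -!partial_transition.
Qed.

Lemma metric_mx_transition g x y q : atlas x -> atlas y -> chart_dom x q -> chart_dom y q ->
  let J := jac x y (chart_map x q) in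
  metric_mx g x (chart_map x q) = J *m metric_mx g y (chart_map y q) *m J^T.
Proof.
move=> ax ay xq yq J; rewrite (metric_mxE g xq) (metric_mxE g yq).
have xyq : overlap x y (chart_map x q) by exists q.
have zq : chart_dom (chart_at q) (chart_inv x (chart_map x q)).
  by rewrite chart_invK//; exact: chart_at_dom.
have ab : transition x y (chart_map x q) = chart_map y q by rewrite /transition/= chart_invK.
by rewrite (jac_chain ax ay (chart_at_atlas q) xyq zq) ab trmx_mul !mulmxA.
Qed.

Lemma metric_mx_unit g x q : atlas x -> (forall q, g q \in unitmx) -> chart_dom x q ->
  metric_mx g x (chart_map x q) \in unitmx.
Proof.
move=> ax ug xq; rewrite metric_mxE// !unitmx_mul unitmx_tr ug andbT andbb.
apply: jac_unit => //; first exact: chart_at_atlas.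
by exists q => //; split => //; exact: chart_at_dom.
Qed.

Lemma component_sym g x i j : (forall q u v, bform (g q) u v = bform (g q) v u) ->
  component g x i j = component g x j i.
Proof. by move=> sg; apply/funext => a; exact: sg. Qed.

Lemma metric_mx_sym g x a : (forall q u v, bform (g q) u v = bform (g q) v u) ->
  (metric_mx g x a)^T = metric_mx g x a.
Proof. by move=> sg; apply/matrixP => i j; rewrite !mxE component_sym. Qed.

Lemma metric_dmx_sym g x a l : (forall q u v, bform (g q) u v = bform (g q) v u) ->
  (metric_dmx g x a l)^T = metric_dmx g x a l.
Proof. by move=> sg; apply/matrixP => i j; rewrite !mxE component_sym. Qed.

Lemma nondegenerate_unit (G : 'M[R]_n) :
  (forall u, (forall v, bform G u v = 0) -> u = 0) -> G \in unitmx.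
Proof.
move=> H; rewrite unitmxE unitfE; apply/negP => /det0P[u u0 uG].
by move/eqP: u0; apply; apply: H => v; rewrite /bform uG mul0mx mxE.
Qed.

(** The congruence between the component matrices holds on the whole overlap and can therefore be
    differentiated. The product rule gives exactly the shape that [euler_lagrange_transform]
    accepts. *)
Lemma metric_dmx_transition g x y q l : atlas x -> atlas y ->
  (forall i j, Ck 1 (chart_img y) (component g y i j)) ->
  chart_dom x q -> chart_dom y q ->
  let a := chart_map x q in let b := chart_map y q in let J := jac x y a in
  metric_dmx g x a l = hess x y a l *m metric_mx g y b *m J^T +
    J *m dirmx (metric_dmx g y b) (row l J) *m J^T + J *m metric_mx g y b *m (hess x y a l)^T.
Proof.
move=> ax ay Cg xq yq a b J.
have xya : overlap x y a by exists q.
have ab : transition x y a = b by rewrite /transition/= chart_invK.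
have dJ : is_derive a (delta_mx 0 l) (jac x y) (hess x y a l).
  apply/is_derive_mxP => i k.
  have [_ /(_ i) [_ [_ /(_ l) [dp _]]]] := transition_Ck 2 ax ay.
  have /is_derive_mxP := derivableP (dp a xya).
  move=> /(_ 0 k); rewrite [X in _ X -> _](_ : _ = hess x y a l i k); last by rewrite mxE.
  by apply: near_eq_is_derive; near=> a'; rewrite mxE.
have dG : is_derive a (delta_mx 0 l) (fun a' => metric_mx g y (transition x y a'))
    (dirmx (metric_dmx g y b) (row l J)).
  apply/is_derive_mxP => i j.
  have Ib : chart_img y (transition x y a) by rewrite ab; exact: chart_img_map.
  have := C1_chain (@chart_img_open _ _ _ y) (Cg i j) Ib (transition_derive (delta_mx 0 l) ax ay xya).
  rewrite -rowE ab [X in is_derive _ _ _ X -> _](_ : _ = dirmx (metric_dmx g y b) (row l J) i j).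
    by apply: near_eq_is_derive; near=> a'; rewrite mxE.
  by rewrite /dirmx summxE; apply: eq_bigr => m _; rewrite [RHS]mxE [X in _ = _ * X]mxE.
have near_eq : \forall a' \near a, (fun a' => jac x y a' *m metric_mx g y (transition x y a')
     *m (jac x y a')^T) a' = metric_mx g x a'.
  have := near_overlap xya; apply: filterS => a' [q' [xq' yq'] <-].
  rewrite (metric_mx_transition g ax ay xq' yq').
  by rewrite /transition /= chart_invK.
have := is_derive_mulmx (is_derive_mulmx dJ dG) (is_derive_trmx dJ).
move=> /(near_eq_is_derive near_eq) /is_derive_mxP H.
apply/matrixP => i j; have [_ E] := H i j; rewrite [LHS]mxE.
rewrite ab mulmxDl in E.
have -> : component g x i j = (fun a' => metric_mx g x a' i j).
  by apply/funext => a'; rewrite mxE.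
exact: E.
Unshelve. all: by end_near. Qed.

Lemma christoffel_euler_lagrange g x q (w u : 'rV[R]_n) : atlas x ->
  (forall q u v, bform (g q) u v = bform (g q) v u) -> (forall q, g q \in unitmx) ->
  chart_dom x q ->
  let a := chart_map x q in
  (forall k, u 0 k + \sum_i \sum_j christoffel g x k i j a * w 0 i * w 0 j = 0) <->
  euler_lagrange (metric_mx g x a) (metric_dmx g x a) w u = 0.
Proof.
move=> ax sg ug xq a.
have uG := metric_mx_unit ax ug xq.
have Gs := metric_mx_sym x a sg.
apply: (iff_trans _ (euler_lagrange_eq0 w u uG Gs (fun l => metric_dmx_sym x a l sg))).
have E k i j : christoffel g x k i j a = 2^-1 * \sum_l invmx (metric_mx g x a) k l *
   (metric_dmx g x a i j l + metric_dmx g x a j i l - metric_dmx g x a l i j).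
  have dE r s t : metric_dmx g x a r s t = partial r (component g x s t) a by rewrite mxE.
  rewrite /christoffel; congr (_ * _); apply: eq_bigr => l _.
  by congr (_ * (_ + _ - _)); exact/esym/dE.
by split=> H k; rewrite -[RHS](H k); congr (_ + _); apply: eq_bigr => i _; apply: eq_bigr => j _;
  rewrite E.
Qed.

End manifold.

(** * Curves read in two charts *)

Section curves.
Variables (R : realType) (n : nat) (M : manifold R n).
Implicit Types (x y : chart R n M) (c : R -> M) (t : R) (w u : 'rV[R]_n).

Lemma near_chart_dom x c t : {for t, continuous c} -> chart_dom x (c t) ->
  \forall s \near t, chart_dom x (c s).
Proof.
move=> cc xc; apply: cc; apply: open_nbhs_nbhs; split => //; exact: chart_dom_open.
Qed.

Lemma curve_change x y c t w : atlas x -> atlas y -> {for t, continuous c} ->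
  chart_dom x (c t) -> chart_dom y (c t) ->
  is_derive t 1 (chart_map x \o c : R -> 'rV[R]_n) w ->
  is_derive t 1 (chart_map y \o c : R -> 'rV[R]_n) (w *m jac x y (chart_map x (c t))).
Proof.
move=> ax ay cc xc yc dc.
have xy : overlap x y (chart_map x (c t)) by exists (c t).
have := C1_chain (@open_overlap _ _ _ x y) (transition_Ck 1 ax ay) xy dc.
rewrite sum_partial; apply: near_eq_is_derive.
have := near_chart_dom cc xc; apply: filterS => s xs.
by rewrite /transition /= chart_invK.
Qed.

(** The formula for the velocity holds near [t], hence can be differentiated once more; the second
    term comes from the motion of the Jacobian along the curve. The open set [I] provides the
    continuity of [c] at these nearby times. *)
Lemma curve_change2 x y c (I : set R) t u : atlas x -> atlas y -> open I -> I t ->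
  (forall s, I s -> {for s, continuous c}) ->
  chart_dom x (c t) -> chart_dom y (c t) ->
  (\forall s \near t, derivable (chart_map x \o c : R -> 'rV[R]_n) s 1) ->
  is_derive t 1 (derive1 (chart_map x \o c : R -> 'rV[R]_n)) u ->
  let a := chart_map x (c t) in
  let w := derive1 (chart_map x \o c : R -> 'rV[R]_n) t in
  [/\ \forall s \near t, derivable (chart_map y \o c : R -> 'rV[R]_n) s 1,
      derive1 (chart_map y \o c : R -> 'rV[R]_n) t = w *m jac x y a &
      is_derive t 1 (derive1 (chart_map y \o c : R -> 'rV[R]_n))
        (u *m jac x y a + w *m dirmx (hess x y a) w)].
Proof.
move=> ax ay oI It cc xc yc dcx d2cx a w.
have nI : \forall s \near t, I s by exact: open_nbhs_nbhs.
have all_near : \forall s \near t,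
    is_derive (s : R) 1 (chart_map y \o c : R -> 'rV[R]_n)
      (derive1 (chart_map x \o c : R -> 'rV[R]_n) s *m jac x y (chart_map x (c s))).
  have nx := near_chart_dom (cc t It) xc; have ny := near_chart_dom (cc t It) yc.
  near=> s.
  have Is : I s by near: s.
  have xs : chart_dom x (c s) by near: s.
  have ys : chart_dom y (c s) by near: s.
  have ds : derivable (chart_map x \o c : R -> 'rV[R]_n) s 1 by near: s.
  by rewrite derive1E; exact: (curve_change ax ay (cc s Is) xs ys (derivableP ds)).
split.
- by move: all_near; apply: filterS => s [].
- by have [_ E] := nbhs_singleton all_near; rewrite derive1E E.
- have xy : overlap x y a by exists (c t).
  have dcxt : is_derive t 1 (chart_map x \o c : R -> 'rV[R]_n) w.
    by rewrite /w derive1E; apply/derivableP; exact: nbhs_singleton dcx.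
  have djac : is_derive t 1 (fun s => jac x y (chart_map x (c s))) (dirmx (hess x y a) w).
    apply/is_derive_mxP => i k.
    have [_ /(_ i) [_ C1]] := transition_Ck 2 ax ay.
    have /is_derive_mxP /(_ 0 k) := C1_chain (@open_overlap _ _ _ x y) C1 xy dcxt.
    rewrite [X in is_derive _ _ _ X -> _](_ : _ = dirmx (hess x y a) w i k).
      by apply: near_eq_is_derive; near=> s; rewrite /= mxE.
    by rewrite /dirmx !summxE; apply: eq_bigr => l _; rewrite [LHS]mxE [RHS]mxE [X in _ = _ * X]mxE.
  have := is_derive_mulmx d2cx djac.
  apply: near_eq_is_derive; move: all_near; apply: filterS => s [_ E].
  by rewrite [RHS]derive1E; exact: esym E.
Unshelve. all: by end_near. Qed.

Variables (g : M -> 'M[R]_n).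

Definition geodesic_at x c t : Prop :=
  let c_x : R -> 'rV[R]_n := chart_map x \o c in
  [/\ \forall s \near t, derivable c_x s 1,
      derivable (derive1 c_x) t 1 &
      forall k, derive1 (derive1 c_x) t 0 k +
        \sum_i \sum_j christoffel g x k i j (c_x t) *
          derive1 c_x t 0 i * derive1 c_x t 0 j = 0].

Hypothesis hg : C11_pseudo_riemannian g.

Lemma metric_unit q : g q \in unitmx.
Proof. by apply: nondegenerate_unit => u; exact: (metric_nondegenerate hg). Qed.

Lemma component_C1 x i j : atlas x -> Ck 1 (chart_img x) (component g x i j).
Proof. by move=> ax; have [] := metric_C11 hg ax i j. Qed.

(** In each chart the equation says that the Euler-Lagrange covector vanishes; the two covectors
    differ by the transposed Jacobian, which is invertible. *)
Lemma geodesic_at_change x y c (I : set R) t : atlas x -> atlas y -> open I -> I t ->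
  (forall s, I s -> {for s, continuous c}) ->
  chart_dom x (c t) -> chart_dom y (c t) -> geodesic_at x c t -> geodesic_at y c t.
Proof.
move=> ax ay oI It cc xc yc [dcx d2cx eqx].
have d2 : is_derive t 1 (derive1 (chart_map x \o c : R -> 'rV[R]_n))
    (derive1 (derive1 (chart_map x \o c : R -> 'rV[R]_n)) t).
  by rewrite [X in is_derive _ _ _ X]derive1E; apply/derivableP.
have [dcy dcyE [d2cy d2cyE]] := curve_change2 ax ay oI It cc xc yc dcx d2.
split; [exact: dcy|exact: d2cy|].
apply: (christoffel_euler_lagrange (derive1 (chart_map y \o c : R -> 'rV[R]_n) t)
  (derive1 (derive1 (chart_map y \o c : R -> 'rV[R]_n)) t) ay (Defs.metric_sym hg) metric_unit yc).2.
have := (christoffel_euler_lagrange (derive1 (chart_map x \o c : R -> 'rV[R]_n) t)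
  (derive1 (derive1 (chart_map x \o c : R -> 'rV[R]_n)) t) ax (Defs.metric_sym hg) metric_unit xc).1 eqx.
have xy : overlap x y (chart_map x (c t)) by exists (c t).
have Gsy := metric_mx_sym y (chart_map y (c t)) (Defs.metric_sym hg).
have hs l i k := hess_sym l i k ax ay xy.
rewrite (metric_mx_transition g ax ay xc yc).
have -> : metric_dmx g x (chart_map x (c t)) = (fun l =>
   hess x y (chart_map x (c t)) l *m metric_mx g y (chart_map y (c t)) *m (jac x y (chart_map x (c t)))^T +
    jac x y (chart_map x (c t)) *m dirmx (metric_dmx g y (chart_map y (c t))) (row l (jac x y (chart_map x (c t))))
      *m (jac x y (chart_map x (c t)))^T +
    jac x y (chart_map x (c t)) *m metric_mx g y (chart_map y (c t)) *m (hess x y (chart_map x (c t)) l)^T).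
  apply/funext => l; apply: (metric_dmx_transition l ax ay _ xc yc) => i j.
  exact: component_C1.
rewrite (euler_lagrange_transform _ _ _ _ Gsy hs) -dcyE -d2cyE -derive1E => E.
have uJ := jac_unit ax ay xy.
have uJT : (jac x y (chart_map x (c t)))^T \in unitmx by rewrite unitmx_tr.
by move/(f_equal (mulmx^~ (invmx (jac x y (chart_map x (c t)))^T))): E; rewrite /= mul0mx mulmxK.
Qed.

Lemma geodesic_of_chart x (I : set R) c : atlas x -> open I ->
  (forall s, I s -> {for s, continuous c}) ->
  (forall t, I t -> chart_dom x (c t) /\ geodesic_at x c t) -> geodesic g I c.
Proof.
move=> ax oI cc H; split.
  by rewrite continuous_open_subspace// => s; rewrite inE; exact: cc.
move=> t y It ay yc; have [xc gx] := H t It.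
exact: (geodesic_at_change ax ay oI It cc xc yc gx).
Qed.

End curves.

(** * Geodesics near a point *)

Section spray.
Variables (R : realType) (n : nat).

(** Coordinatewise truncation to the closed max-norm ball around [a0]. Since the norm is the max
    norm, it is again 1-Lipschitz and the identity on that ball. *)
Definition clampv (a0 : 'rV[R]_n) (r : R) (c : 'rV[R]_n) : 'rV[R]_n :=
  \row_i (a0 0 i + clamp r (c 0 i - a0 0 i)).

Lemma clampv_lipschitz a0 r c c' : `|clampv a0 r c - clampv a0 r c'| <= `|c - c'|.
Proof.
apply: mx_norm_le => // i j; rewrite ord1 !mxE opprD addrACA subrr add0r.
apply: (le_trans (clamp_lipschitz _ _ _)); rewrite opprB addrA subrK.
by have := ler_coord_norm (c - c') 0 j; rewrite !mxE.
Qed.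

Lemma clampv_close a0 r c : 0 <= r -> `|clampv a0 r c - a0| <= r.
Proof.
move=> r0; apply: mx_norm_le => // i j; rewrite ord1 !mxE [a0 0 j + _ - _]addrAC subrr add0r.
exact: clamp_le.
Qed.

Lemma clampv_id a0 r c : `|c - a0| <= r -> clampv a0 r c = c.
Proof.
move=> cr; apply/rowP => i; rewrite mxE clamp_id; first by rewrite addrC subrK.
by apply: le_trans cr; have := ler_coord_norm (c - a0) 0 i; rewrite !mxE.
Qed.

Variable Gam : 'I_n -> 'I_n -> 'I_n -> 'rV[R]_n -> R.

Definition spray (c z : 'rV[R]_n) : 'rV[R]_n :=
  - \row_k \sum_i \sum_j Gam k i j c * z 0 i * z 0 j.

Lemma spray_homogeneous c z (t : R) : spray c (t *: z) = t ^+ 2 *: spray c z.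
Proof.
rewrite /spray scalerN; congr (- _); apply/rowP => k; rewrite !mxE mulr_sumr.
apply: eq_bigr => i _; rewrite mulr_sumr; apply: eq_bigr => j _; rewrite !mxE; ring.
Qed.

Definition clamped_spray (a0 : 'rV[R]_n) (r s : R) (c z : 'rV[R]_n) : 'rV[R]_n :=
  spray (clampv a0 r c) (clampv 0 s z).

Lemma clamped_sprayE a0 r s c z : `|c - a0| <= r -> `|z| <= s ->
  clamped_spray a0 r s c z = spray c z.
Proof.
by move=> cr zs; rewrite /clamped_spray !clampv_id// subr0.
Qed.

Variables (a0 : 'rV[R]_n).
Hypothesis LGam : forall k i j, lipschitz_at (Gam k i j) a0.

Lemma uniform_lipschitz : exists d L K : R, [/\ 0 < d, 0 <= L, 0 <= K,
  forall k i j u, `|u - a0| < d -> `|Gam k i j u| <= K &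
  forall k i j u w, `|u - a0| < d -> `|w - a0| < d ->
    `|Gam k i j u - Gam k i j w| <= L * `|u - w|].
Proof.
pose I := ('I_n * 'I_n * 'I_n)%type.
have H (l : I) : exists dL : R * R, [/\ 0 < dL.1, 0 <= dL.2 &
   forall u w, `|u - a0| < dL.1 -> `|w - a0| < dL.1 ->
   `|Gam l.1.1 l.1.2 l.2 u - Gam l.1.1 l.1.2 l.2 w| <= dL.2 * `|u - w|].
  by have [d [K [d0 K0 H]]] := lipschitz_at_pos (LGam l.1.1 l.1.2 l.2); exists (d, K).
pose dL l := sval (cid (H l)).
have HdL l : [/\ 0 < (dL l).1, 0 <= (dL l).2 &
   forall u w, `|u - a0| < (dL l).1 -> `|w - a0| < (dL l).1 ->
   `|Gam l.1.1 l.1.2 l.2 u - Gam l.1.1 l.1.2 l.2 w| <= (dL l).2 * `|u - w|].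
  exact: (svalP (cid (H l))).
pose d := \big[Num.min/1]_l (dL l).1.
pose L := \sum_l (dL l).2.
have d0 : 0 < d.
  apply: (big_ind (fun r => 0 < r)) => // [a b a1 b1|l _]; first by rewrite lt_min a1.
  by case: (HdL l).
have dl l : d <= (dL l).1 by exact: bigmin_le_cond.
have d1 : d <= 1 by exact: bigmin_le_id.
have Ll l : (dL l).2 <= L.
  rewrite /L (bigD1 l)//= lerDl; apply: sumr_ge0 => m _; by case: (HdL m).
have L0 : 0 <= L by apply: sumr_ge0 => m _; case: (HdL m).
have HL k i j u w : `|u - a0| < d -> `|w - a0| < d -> `|Gam k i j u - Gam k i j w| <= L * `|u - w|.
  move=> ud wd; have [_ _ Hl] := HdL ((k, i), j).
  apply: (le_trans (Hl u w _ _)); [exact: lt_le_trans (dl _)|exact: lt_le_trans (dl _)|].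
  by apply: ler_wpM2r.
pose K := L + \sum_(l : I) `|Gam l.1.1 l.1.2 l.2 a0|.
exists d, L, K; split => //.
  by rewrite /K addr_ge0// sumr_ge0.
move=> k i j u ud.
rewrite -(subrK (Gam k i j a0) (Gam k i j u)) (le_trans (ler_normD _ _))// /K lerD//.
  apply: (le_trans (HL k i j u a0 ud _)); first by rewrite subrr normr0.
  by rewrite ler_piMr// (le_trans (ltW ud)).
by rewrite (bigD1 ((k, i), j))//= lerDl sumr_ge0.
Qed.

(** With velocities truncated at [s <= 1], the spray varies by at most [B * s] times the variation
    of its arguments, where [B] depends only on [n] and on the bounds of the Christoffel symbols
    near [a0]. The choice [s = (16 * (B + 1))^-1] then brings the constant below 1/16. *)
Lemma clamped_spray_exists r0 : 0 < r0 -> exists r s lam K : R,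
  [/\ [/\ 0 < r, r < r0, 0 < s & 0 <= K], 0 <= lam, lam <= 16^-1,
    (forall c, clamped_spray a0 r s c 0 = 0) /\
    (forall c z c' z', `|clamped_spray a0 r s c z - clamped_spray a0 r s c' z'| <=
       lam * (`|c - c'| + `|z - z'|)) &
    forall c z, `|c - a0| <= r -> `|spray c z| <= K * `|z| ^+ 2].
Proof.
move=> r00; have [d [L [K [d0 L0 K0 GK GL]]]] := uniform_lipschitz.
pose r := Num.min d r0 / 2.
have m0 : 0 < Num.min d r0 by rewrite lt_min d0.
have rm : r < Num.min d r0 by rewrite /r; lra.
have [rd rr0] : r < d /\ r < r0 by move: rm; rewrite lt_min => /andP.
have r_gt0 : 0 < r by rewrite /r; lra.
pose n2 : R := (n * n)%:R.
have n20 : 0 <= n2 by rewrite ler0n.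
pose B := n2 * (L + 2 * K).
have B0 : 0 <= B by rewrite mulr_ge0// addr_ge0// mulr_ge0.
pose s := (16 * (B + 1))^-1.
have s0 : 0 < s by rewrite invr_gt0 mulr_gt0// ltr_wpDl.
have s1 : s <= 1.
  rewrite invf_le1; last by rewrite mulr_gt0// ltr_wpDl.
  by lra.
have sumle (F : 'I_n -> 'I_n -> R) (C : R) : (forall i j, `|F i j| <= C) ->
    `|\sum_i \sum_j F i j| <= n2 * C.
  move=> H; rewrite (le_trans (ler_norm_sum _ _ _))//.
  apply: (@le_trans _ _ (\sum_(i < n) \sum_(j < n) C)).
    apply: ler_sum => i _; rewrite (le_trans (ler_norm_sum _ _ _))//.
    by apply: ler_sum => j _; exact: H.
  by rewrite sumr_const card_ord sumr_const card_ord -mulrnA -mulr_natl.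
exists r, s, (B * s), (n2 * K); split => //.
- by rewrite r_gt0 rr0 s0 mulr_ge0.
- by rewrite mulr_ge0// ltW.
- rewrite /s invfM mulrCA -[leRHS]mulr1 ler_pM2l ?invr_gt0//.
  by rewrite ler_pdivrMr ?mul1r ?lerDl// ltr_wpDl.
- split=> [c|c z c' z'].
    (* The zero velocity is displayed as a multiple by 0 so that homogeneity of the spray makes it
       vanish. *)
    rewrite /clamped_spray; have -> : clampv 0 s 0 = 0 * 0 *: (0 : 'rV[R]_n).
      by rewrite scaler0 clampv_id// subr0 normr0 ltW.
    by rewrite -scalerA scaler0 spray_homogeneous expr0n /= scale0r.
  rewrite /clamped_spray.
  have cc := clampv_lipschitz a0 r c c'; have zz := clampv_lipschitz 0 s z z'.
  have cr := clampv_close a0 c (ltW r_gt0); have cr' := clampv_close a0 c' (ltW r_gt0).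
  have zs := clampv_close 0 z (ltW s0); have zs' := clampv_close 0 z' (ltW s0).
  move: (clampv a0 r c) (clampv a0 r c') (clampv 0 s z) (clampv 0 s z') cc zz cr cr' zs zs'.
  move=> b b' y y' cc zz cr cr'; rewrite !subr0 => ys ys'.
  have D0 : 0 <= `|c - c'| + `|z - z'| by [].
  apply: mx_norm_le => [|i k]; first by apply: mulr_ge0 => //; apply: mulr_ge0 => //; exact: ltW.
  rewrite ord1 /spray !mxE -opprD normrN -sumrB.
  have -> : \sum_i0 (\sum_j Gam k i0 j b * y 0 i0 * y 0 j - \sum_j Gam k i0 j b' * y' 0 i0 * y' 0 j) =
     \sum_i0 (\sum_j (Gam k i0 j b * y 0 i0 * y 0 j - Gam k i0 j b' * y' 0 i0 * y' 0 j)).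
    by apply: eq_bigr => l _; rewrite sumrB.
  rewrite /B -mulrA -mulrA; apply: sumle => l j.
  (* Each of the three terms keeps at least one truncated velocity as a factor: this is the source
     of the small factor [s]. *)
  have -> : Gam k l j b * y 0 l * y 0 j - Gam k l j b' * y' 0 l * y' 0 j =
    (Gam k l j b - Gam k l j b') * (y 0 l * y 0 j) + Gam k l j b' * ((y 0 l - y' 0 l) * y 0 j)
     + Gam k l j b' * (y' 0 l * (y 0 j - y' 0 j)) by ring.
  have bd : `|b - a0| < d := le_lt_trans cr rd.
  have bd' : `|b' - a0| < d := le_lt_trans cr' rd.
  have yl m : `|y 0 m| <= s := le_trans (ler_coord_norm y 0 m) ys.
  have yl' m : `|y' 0 m| <= s := le_trans (ler_coord_norm y' 0 m) ys'.
  have dy m : `|y 0 m - y' 0 m| <= `|z - z'|.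
    by apply: le_trans zz; have := ler_coord_norm (y - y') 0 m; rewrite !mxE.
  have G1 : `|Gam k l j b - Gam k l j b'| <= L * `|c - c'|.
    by apply: (le_trans (GL _ _ _ _ _ bd bd')); rewrite ler_wpM2l.
  have G2 := GK k l j b' bd'.
  have t1 : `|(Gam k l j b - Gam k l j b') * (y 0 l * y 0 j)| <= (L * `|c - c'|) * (s * s).
    by rewrite !normrM; apply: ler_pM => //; apply: ler_pM => //.
  have t2 : `|Gam k l j b' * ((y 0 l - y' 0 l) * y 0 j)| <= K * (`|z - z'| * s).
    by rewrite !normrM; apply: ler_pM => //; apply: ler_pM => //.
  have t3 : `|Gam k l j b' * (y' 0 l * (y 0 j - y' 0 j))| <= K * (s * `|z - z'|).
    by rewrite !normrM; apply: ler_pM => //; apply: ler_pM => //.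
  apply: (le_trans (ler_normD _ _)); apply: (le_trans (lerD (ler_normD _ _) (lexx _))).
  apply: (le_trans (lerD (lerD t1 t2) t3)).
  have e1 : L * `|c - c'| * (s * s) <= L * `|c - c'| * s.
    by rewrite ler_wpM2l ?mulr_ge0// ler_piMr// ltW.
  have e2 : 0 <= L * `|z - z'| * s by rewrite !mulr_ge0// ltW.
  have e3 : 0 <= K * `|c - c'| * s by rewrite !mulr_ge0// ltW.
  nra.
- move=> c z cr; apply: mx_norm_le => [|i k]; first by rewrite !mulr_ge0// exprn_ge0.
  rewrite ord1 !mxE normrN -mulrA; apply: sumle => l j.
  rewrite !normrM expr2 -mulrA; apply: ler_pM => //; first exact: GK (le_lt_trans cr rd).
  by apply: ler_pM => //; exact: ler_coord_norm.
Qed.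

End spray.

Lemma is_derive_scale (R : realType) (W : normedModType R) (F : R -> W) (t s : R) (l : W) :
  is_derive (t * s) 1 F l -> is_derive s 1 (fun s => F (t * s)) (t *: l).
Proof.
move=> dF; have e (r : R) : r *: (t *: (1 : R)) + 0 = t * r.
  by rewrite addr0 [LHS]mulrA mulr1 mulrC.
have -> : (fun s => F (t * s)) = (fun r => F (r *: (t *: (1 : R)) + 0)).
  by apply/funext => r; rewrite e.
by apply: is_derive_segment; rewrite e.
Qed.

Lemma is_derive_translate (R : realType) (W : normedModType R) (F : R -> W) (t s : R) (l : W) :
  is_derive (t + s) 1 F l -> is_derive s 1 (fun s => F (t + s)) l.
Proof.
move=> dF; have e (r : R) : r *: (1 *: (1 : R)) + t = t + r.
  by rewrite scale1r [_ *: _]mulr1 addrC.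
have -> : (fun s => F (t + s)) = (fun r => F (r *: (1 *: (1 : R)) + t)).
  by apply/funext => r; rewrite e.
by rewrite -[l]scale1r; apply: is_derive_segment; rewrite e.
Qed.

(** An interior value above both ends would give, by the mean value theorem, a positive slope
    followed by a negative one, and hence a negative second derivative in between. *)
Lemma convex_le_max (R : realType) (f f' f'' : R -> R) :
  (forall t : R, 0 <= t <= 1 -> is_derive t 1 f (f' t)) ->
  (forall t : R, 0 <= t <= 1 -> is_derive t 1 f' (f'' t)) ->
  (forall t : R, 0 <= t <= 1 -> 0 <= f'' t) ->
  forall t : R, 0 <= t <= 1 -> f t <= Num.max (f 0) (f 1).
Proof.
move=> df df' f''0 t /andP[t0 t1].
have cts (F dF : R -> R) (a b : R) : 0 <= a -> b <= 1 ->
    (forall t : R, 0 <= t <= 1 -> is_derive t 1 F (dF t)) -> {within `[a, b], continuous F}.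
  move=> a0 b1 dF'; apply: derivable_within_continuous => r; rewrite in_itv/= => /andP[r0 r1].
  by case: (dF' r _) => //; rewrite (le_trans a0)//= (le_trans r1).
have mvt (F dF : R -> R) (a b : R) : 0 <= a -> b <= 1 -> a < b ->
    (forall t : R, 0 <= t <= 1 -> is_derive t 1 F (dF t)) ->
    exists2 c, a < c < b & F b - F a = dF c * (b - a).
  move=> a0 b1 ab dF'; have [|c] := @MVT _ F dF a b ab _ (cts F dF a b a0 b1 dF').
    move=> r; rewrite in_itv/= => /andP[r0 r1]; apply: dF'.
    by rewrite (le_trans a0 (ltW r0))/= (le_trans (ltW r1)).
  by rewrite in_itv/= => cab E; exists c.
rewrite le_max; apply/negPn/negP; rewrite negb_or -!ltNge => /andP[f0 f1].
have [t00|tne0] := eqVneq t 0; first by rewrite t00 ltxx in f0.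
have [t11|tne1] := eqVneq t 1; first by rewrite t11 ltxx in f1.
have t_gt0 : 0 < t by rewrite lt_neqAle eq_sym tne0.
have t_lt1 : t < 1 by rewrite lt_neqAle tne1.
have [c1 /andP[c10 c1t] E1] := mvt f f' 0 t (lexx 0) t1 t_gt0 df.
have [c2 /andP[c2t c21] E2] := mvt f f' t 1 t0 (lexx 1) t_lt1 df.
have c12 : c1 < c2 := lt_trans c1t c2t.
have [c3 /andP[c31 c32] E3] := mvt f' f'' c1 c2 (ltW c10) (ltW c21) c12 df'.
have h1 : 0 < f' c1.
  have : 0 < f' c1 * (t - 0) by rewrite -E1 subr_gt0.
  by rewrite pmulr_lgt0// subr0.
have h2 : f' c2 < 0.
  have : f' c2 * (1 - t) < 0 by rewrite -E2 subr_lt0.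
  by rewrite pmulr_llt0// subr_gt0.
have h3 : 0 <= f'' c3 * (c2 - c1).
  rewrite mulr_ge0 ?subr_ge0 ?(ltW c12)//; apply: f''0.
  by rewrite (ltW (lt_trans c10 c31)) (ltW (lt_trans c32 c21)).
lra.
Qed.

Section sqnorm.
Variables (R : realType) (n : nat).

(** The squared Euclidean norm: unlike the max norm of the library, it is smooth, so its second
    derivative along a curve makes sense. *)
Definition sqnorm (u : 'rV[R]_n) : R := \sum_i u 0 i ^+ 2.

Lemma sqnorm_ge u : `|u| ^+ 2 <= sqnorm u.
Proof.
have s0 : 0 <= sqnorm u by apply: sumr_ge0 => i _; exact: sqr_ge0.
rewrite -(sqr_sqrtr s0) ler_pXn2r ?nnegrE ?sqrtr_ge0//.
apply: mx_norm_le => [|i j]; first exact: sqrtr_ge0.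
rewrite ord1 -sqrtr_sqr; apply: ler_wsqrtr.
by rewrite /sqnorm (bigD1 j)//= lerDl; apply: sumr_ge0 => k _; exact: sqr_ge0.
Qed.

Lemma norm_lt_of_sqnorm u (e : R) : 0 < e -> sqnorm u < e ^+ 2 -> `|u| < e.
Proof.
move=> e0 /(le_lt_trans (sqnorm_ge u)); rewrite ltr_pXn2r ?nnegrE// ltW//.
Qed.

Lemma open_sqnorm_ball a0 (e : R) : open [set a : 'rV[R]_n | sqnorm (a - a0) < e].
Proof.
have c : continuous (fun a : 'rV[R]_n => sqnorm (a - a0)).
  move=> a; apply: differentiable_continuous; rewrite /sqnorm.
  have -> : (fun a : 'rV[R]_n => \sum_i (a - a0) 0 i ^+ 2) =
      \sum_i (fun a : 'rV[R]_n => (a 0 i - a0 0 i) ^+ 2).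
    by apply/funext => b; rewrite fct_sumE; apply: eq_bigr => i _; rewrite !mxE.
  apply: differentiable_sum => i.
  pose f (a : 'rV[R]_n) : R := a 0 i - a0 0 i.
  have df : differentiable f a.
    have -> : f = (fun a : 'rV[R]_n => a 0 i : R) - cst (a0 0 i) by [].
    by apply: differentiableB; [exact: differentiable_coord|exact: differentiable_cst].
  have -> : (fun a : 'rV[R]_n => (a 0 i - a0 0 i) ^+ 2) = f * f.
    by apply/funext => b; rewrite expr2.
  exact: differentiableM.
exact: (open_comp (fun a _ => c a) (@open_lt R e)).
Qed.

Lemma sqnorm0 : sqnorm 0 = 0.
Proof. by rewrite /sqnorm big1// => i _; rewrite mxE expr0n. Qed.

End sqnorm.

(** * Convexity of small coordinate balls along solutions *)

Section geodesic_convexity.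
Variables (R : realType) (n : nat) (Gam : 'I_n -> 'I_n -> 'I_n -> 'rV[R]_n -> R).
Variables (a0 : 'rV[R]_n) (r s lam K eps : R).
Let H := clamped_spray Gam a0 r s.
Hypothesis lam0 : 0 <= lam.
Hypothesis lam_small : lam <= 16^-1.
Hypothesis H0 : forall c, H c 0 = 0.
Hypothesis HL : forall c z c' z', `|H c z - H c' z'| <= lam * (`|c - c'| + `|z - z'|).
Hypothesis HK : forall c z, `|c - a0| <= r -> `|spray Gam c z| <= K * `|z| ^+ 2.
Hypothesis eps0 : 0 < eps.
Hypothesis eps_r : 25 * eps <= r.
Hypothesis eps_s : 12 * eps <= s.
Hypothesis eps_K : n%:R * (25 * eps) * K <= 1.

Let flow := flow lam0 lam_small H0 HL.
Let vel := flow_velocity lam0 lam_small H0 HL.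
Let E := endpoint lam0 lam_small H0 HL.

Variables (a w : 'rV[R]_n).
Hypothesis aeps : `|a - a0| < eps.
Hypothesis weps : `|w| < 4 * eps.

(** Here 25 = 6 * 4 + 1: the flow moves by at most [6 * |w|], and [a] lies within [eps] of the
    centre. In the same way the velocity is at most [3 * |w|], below [12 * eps]. Together with
    [eps_r] and [eps_s] this keeps both truncations inactive. *)
Lemma small_flow_close t : - 2 < t < 2 -> `|flow a w t - a0| < 25 * eps.
Proof.
move=> t2; have h1 : `|flow a w t - a| <= 6 * `|w| by exact: flow_close.
have h2 : `|flow a w t - a0| <= `|flow a w t - a| + `|a - a0|.
  by rewrite -(subrKA a) ler_normD.
by move: h1 h2 aeps weps; lra.
Qed.

Lemma small_flow_velocity t : `|vel a w t| < 12 * eps.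
Proof.
have h1 : `|vel a w t| <= 3 * `|w| by exact: flow_velocity_le.
by move: h1 weps; lra.
Qed.

Lemma small_flow_spray t : - 2 < t < 2 -> H (flow a w t) (vel a w t) = spray Gam (flow a w t) (vel a w t).
Proof.
move=> t2; apply: clamped_sprayE.
  by apply: le_trans eps_r; exact: ltW (small_flow_close t2).
by apply: le_trans eps_s; exact: ltW (small_flow_velocity t).
Qed.

Lemma small_flow_convex t : 0 <= t <= 1 ->
  sqnorm (flow a w t - a0) <= Num.max (sqnorm (a - a0)) (sqnorm (E a w - a0)).
Proof.
move=> t01.
have [f0 v0 fd _] := flowP lam0 lam_small H0 HL a w.
rewrite -/flow -/vel in f0 v0 fd.
have E1 : E a w = flow a w 1 by [].
rewrite E1 -{2}f0.
have in2 (u : R) : 0 <= u <= 1 -> - 2 < u < 2 by move=> /andP[u0 u1]; apply/andP; split; lra.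
have dpos i (u : R) : 0 <= u <= 1 -> is_derive u 1 (fun u => (flow a w u - a0) 0 i) (vel a w u 0 i).
  move=> u01; have [/is_derive_mxP /(_ 0 i) d _] := fd u (in2 u u01).
  have -> : (fun u => (flow a w u - a0) 0 i) = (fun u => flow a w u 0 i) - cst (a0 0 i).
    by apply/funext => y; rewrite !mxE.
  by rewrite -[X in is_derive _ _ _ X]subr0; exact: is_deriveB.
have dvel i (u : R) : 0 <= u <= 1 -> is_derive u 1 (fun u => vel a w u 0 i) (H (flow a w u) (vel a w u) 0 i).
  by move=> u01; have [_ /is_derive_mxP /(_ 0 i)] := fd u (in2 u u01).
pose f' u := \sum_i (vel a w u 0 i * (flow a w u - a0) 0 i + (flow a w u - a0) 0 i * vel a w u 0 i).
pose f'' u := \sum_i ((H (flow a w u) (vel a w u) 0 i * (flow a w u - a0) 0 i + vel a w u 0 i * vel a w u 0 i) +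
  (vel a w u 0 i * vel a w u 0 i + (flow a w u - a0) 0 i * H (flow a w u) (vel a w u) 0 i)).
apply: (@convex_le_max _ (fun u => sqnorm (flow a w u - a0)) f' f'') => // u u01.
- by apply: is_derive_fun_sum => i; apply: is_derive_fun_mul; exact: dpos.
- apply: is_derive_fun_sum => i.
  have -> : (fun y => vel a w y 0 i * (flow a w y - a0) 0 i + (flow a w y - a0) 0 i * vel a w y 0 i) =
   (fun y => vel a w y 0 i * (flow a w y - a0) 0 i) + (fun y => (flow a w y - a0) 0 i * vel a w y 0 i) by [].
  by apply: is_deriveD; apply: is_derive_fun_mul; (exact: dpos || exact: dvel).
- have u2 := in2 u u01.
  have -> : f'' u = 2 * (sqnorm (vel a w u) + \sum_i (flow a w u - a0) 0 i * H (flow a w u) (vel a w u) 0 i).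
    rewrite mulrDr /sqnorm /f'' !mulr_sumr -big_split/=; apply: eq_bigr => i _; ring.
  (* It remains to absorb the spray term. Its [n] summands are at most [25 * eps * K] times the
     squared max norm of the velocity, and [eps_K] keeps their total below that square, hence below
     [sqnorm]. *)
  apply: mulr_ge0 => //; rewrite -lerBlDr sub0r.
  apply: (le_trans (ler_norm _)); rewrite normrN; apply: le_trans (sqnorm_ge _).
  have cl := ltW (small_flow_close u2).
  have clr := le_trans cl eps_r.
  rewrite (small_flow_spray u2).
  apply: (le_trans (ler_norm_sum _ _ _)).
  apply: (@le_trans _ _ (\sum_(i < n) (25 * eps) * (K * `|vel a w u| ^+ 2))).
    apply: ler_sum => i _; rewrite normrM; apply: ler_pM => //.
      exact: le_trans (ler_coord_norm _ _ _) cl.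
    exact: le_trans (ler_coord_norm _ _ _) (HK _ clr).
  rewrite sumr_const card_ord -[X in X <= _]mulr_natl.
  have -> : n%:R * (25 * eps * (K * `|vel a w u| ^+ 2)) = n%:R * (25 * eps) * K * `|vel a w u| ^+ 2.
    by ring.
  by apply: ler_piMl => //; exact: sqr_ge0.
Qed.

(** The reparametrised curve [flow a w (t * u)] has velocity multiplied by [t] and acceleration by
    [t ^+ 2]. Since the spray is homogeneous of degree 2 and the truncations are inactive for both
    velocities, it solves the same equation, and uniqueness identifies it. *)
Lemma small_flow_rescale t : 0 <= t <= 1 -> E a (t *: w) = flow a w t.
Proof.
move=> /andP[t0 t1].
have [f0 v0 fd _] := flowP lam0 lam_small H0 HL a w.
rewrite -/flow -/vel in f0 v0 fd.
pose c u := flow a w (t * u); pose z u := t *: vel a w (t * u).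
have sol : ode_solution H 0 1 c z.
  move=> u /andP[u0 u1].
  have tu : - 2 < t * u < 2.
    have : 0 <= t * u by rewrite mulr_ge0.
    have : t * u <= 1 by rewrite mulr_ile1.
    by move=> ? ?; apply/andP; split; lra.
  have [d1 d2] := fd (t * u) tu.
  split; first exact: is_derive_scale.
  have -> : H (c u) (z u) = t *: (t *: H (flow a w (t * u)) (vel a w (t * u))).
    rewrite (small_flow_spray tu) /c /z /H clamped_sprayE; last 2 first.
      by apply: le_trans eps_r; exact: ltW (small_flow_close tu).
      rewrite normrZ ger0_norm//; apply: (@le_trans _ _ (1 * `|vel a w (t * u)|)).
        by rewrite ler_wpM2r.
      by rewrite mul1r; apply: le_trans eps_s; exact: ltW (small_flow_velocity _).
    by rewrite spray_homogeneous scalerA expr2.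
  by apply: is_deriveZ; exact: is_derive_scale.
have b01 : 0 <= (1 : R) <= 1 by rewrite ler01 lexx.
have c0 : c 0 = a by rewrite /c mulr0.
have z0 : z 0 = t *: w by rewrite /z mulr0 v0.
have [E1 _] := flow_unique lam0 lam_small H0 HL b01 sol c0 z0 b01.
by rewrite /E /endpoint -E1 /c mulr1.
Qed.

End geodesic_convexity.

(** Lets agreement of two continuous curves pass to a left limit, in the manifold as well as for
    velocities. *)
Lemma left_limit_unique (R : realType) (T : topologicalType) (f g : R -> T) (a t : R) :
  hausdorff_space T -> {for t, continuous f} -> {for t, continuous g} -> a < t ->
  (forall s, a <= s < t -> f s = g s) -> f t = g t.
Proof.
move=> hT cf cg at_ fg; apply: hT => A B nA nB.
have nfA : \forall s \near t, A (f s) := cf A nA.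
have ngB : \forall s \near t, B (g s) := cg B nB.
have [d /= d0 Hd] := (@nbhs_normP R R t _).1 (filterI nfA ngB).
pose s := Num.max a (t - d / 2).
have st : s < t by rewrite /s gt_max at_/=; lra.
have sa : a <= s by rewrite /s le_max lexx.
have sd : t - d / 2 <= s by rewrite /s le_max lexx orbT.
have [As Bs] : A (f s) /\ B (g s).
  by apply: Hd; rewrite /ball_/= gtr0_norm ?subr_gt0//; lra.
by exists (f s); split => //; rewrite fg// sa.
Qed.

(** * Geodesics in a chart and solutions of the truncated equation *)

Section chart_geodesics.
Variables (R : realType) (n : nat) (M : manifold R n) (g : M -> 'M[R]_n).
Hypothesis hg : C11_pseudo_riemannian g.
Variables (x : chart R n M) (ax : atlas x) (a0 : 'rV[R]_n) (r s : R).
Hypothesis r_img : forall c, `|c - a0| <= r -> chart_img x c.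
Let Gam k i j := christoffel g x k i j.
Let H := clamped_spray Gam a0 r s.

Lemma solution_geodesic (b1 b2 : R) (c z : R -> 'rV[R]_n) :
  (forall t, b1 < t < b2 -> is_derive t 1 c (z t) /\ is_derive t 1 z (H (c t) (z t))) ->
  (forall t, b1 < t < b2 -> `|c t - a0| <= r) ->
  (forall t, b1 < t < b2 -> `|z t| <= s) ->
  geodesic g `]b1, b2[ (chart_inv x \o c).
Proof.
move=> sol cr zs; pose C := chart_inv x \o c.
have oI : open [set` `]b1, b2[] by exact: interval_open.
have cI t : b1 < t < b2 -> \forall u \near t, b1 < u < b2.
  move=> tb; have : \forall u \near t, [set` `]b1, b2[] u.
    by apply: open_nbhs_nbhs; split => //=; rewrite in_itv.
  by apply: filterS => u /=; rewrite in_itv.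
have xc t : b1 < t < b2 -> chart_dom x (C t) /\ chart_map x (C t) = c t.
  by move=> tb; apply: chart_imgP; apply: r_img; exact: cr.
have dC t : b1 < t < b2 -> is_derive t 1 (chart_map x \o C : R -> 'rV[R]_n) (z t).
  move=> tb; have [dc _] := sol t tb; apply: near_eq_is_derive dc.
  by have := cI t tb; apply: filterS => u ub; rewrite /= (xc u ub).2.
have dzC t : b1 < t < b2 -> derive1 (chart_map x \o C : R -> 'rV[R]_n) t = z t.
  by move=> tb; rewrite derive1E; case: (dC t tb).
apply: (geodesic_of_chart hg ax oI) => t /=; rewrite in_itv/= => tb.
  apply: continuous_comp; last by apply: chart_inv_cts; apply: r_img; exact: cr.
  by apply: differentiable_continuous; apply/derivable1_diffP; case: (sol t tb) => -[].
split; first exact: (xc t tb).1.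
have d2 : is_derive t 1 (derive1 (chart_map x \o C : R -> 'rV[R]_n)) (H (c t) (z t)).
  have [_ dz] := sol t tb; apply: near_eq_is_derive dz.
  by have := cI t tb; apply: filterS => u ub; exact/esym/dzC.
split.
- by have := cI t tb; apply: filterS => u ub; case: (dC u ub).
- by case: d2.
- move=> k; have e2 : derive1 (derive1 (chart_map x \o C : R -> 'rV[R]_n)) t = H (c t) (z t).
    by rewrite derive1E; case: d2.
  rewrite -/C e2 (dzC t tb) /= (xc t tb).2 /H clamped_sprayE; [|exact: cr|exact: zs].
  by rewrite /spray !mxE addNr.
Qed.

Lemma geodesic_solution (I : set R) (c : R -> M) t : geodesic g I c -> I t ->
  chart_dom x (c t) ->
  let c_x : R -> 'rV[R]_n := chart_map x \o c in
  `|c_x t - a0| <= r -> `|derive1 c_x t| <= s ->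
  is_derive t 1 c_x (derive1 c_x t) /\
  is_derive t 1 (derive1 c_x) (H (c_x t) (derive1 c_x t)).
Proof.
move=> [_ gc] It xc c_x cr zs; have [d1 d2 eq] := gc t x It ax xc.
split.
  by rewrite [X in is_derive _ _ _ X]derive1E; apply/derivableP; exact: nbhs_singleton d1.
have -> : H (c_x t) (derive1 c_x t) = derive1 (derive1 c_x) t.
  rewrite /H clamped_sprayE//; apply/rowP => k; rewrite /spray !mxE.
  by apply/esym/eqP; rewrite -subr_eq0 opprK; apply/eqP; exact: eq.
by rewrite [X in is_derive _ _ _ X]derive1E; apply/derivableP.
Qed.

Variable lam : R.
Hypothesis lam_small : lam <= 16^-1.
Hypothesis HL : forall c z c' z', `|H c z - H c' z'| <= lam * (`|c - c'| + `|z - z'|).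

(** The competitor [c2] is an arbitrary geodesic of [M], not known to stay in the chart. Real
    induction propagates the agreement of both position and velocity. The strict bounds on [c] and
    [z] leave room for [c2] to satisfy the weak bounds shortly afterwards, where
    [ode_solution_close] applies to the curves shifted in time. *)
Lemma geodesic_unique (e : R) (c z : R -> 'rV[R]_n) (c2 : R -> M) :
  0 < e -> geodesic g `](- e), (1 + e)[ c2 ->
  (forall t, - e < t < 1 + e -> is_derive t 1 c (z t) /\ is_derive t 1 z (H (c t) (z t))) ->
  (forall t, - e < t < 1 + e -> `|c t - a0| < r) ->
  (forall t, - e < t < 1 + e -> `|z t| < s) ->
  c2 0 = chart_inv x (c 0) -> derive1 (chart_map x \o c2 : R -> 'rV[R]_n) 0 = z 0 ->
  c2 1 = chart_inv x (c 1).
Proof.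
move=> e0 gc sol cr zs c20 z20.
pose cx : R -> 'rV[R]_n := chart_map x \o c2.
have xc t : - e < t < 1 + e -> chart_dom x (chart_inv x (c t)) /\ chart_map x (chart_inv x (c t)) = c t.
  by move=> tb; apply: chart_imgP; apply: r_img; exact/ltW/cr.
have oI : open [set` `](- e), (1 + e)[] by exact: interval_open.
have cc2 t : - e < t < 1 + e -> {for t, continuous c2}.
  move=> tb; have [c2c _] := gc.
  by apply: within_open_continuous oI c2c _; rewrite /= in_itv.
have cc t : - e < t < 1 + e -> {for t, continuous c}.
  move=> tb; apply: differentiable_continuous; apply/derivable1_diffP.
  by case: (sol t tb) => -[].
have cz t : - e < t < 1 + e -> {for t, continuous z}.
  move=> tb; apply: differentiable_continuous; apply/derivable1_diffP.
  by case: (sol t tb) => _ [].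
have in01 (t : R) : 0 <= t -> t <= 1 -> - e < t < 1 + e.
  by move=> t0 t1; apply/andP; split; lra.
have dcx_cts t : - e < t < 1 + e -> chart_dom x (c2 t) ->
    {for t, continuous (derive1 cx)}.
  move=> tb xt; have [_ gct] := gc.
  have [|_ d2 _] := gct t x _ ax xt; first by rewrite /= in_itv.
  exact/differentiable_continuous/derivable1_diffP.
pose P t := c2 t = chart_inv x (c t) /\ derive1 cx t = z t.
suff : forall t, 0 <= t <= 1 -> P t.
  by move=> /(_ 1); rewrite ler01 lexx => /(_ isT) [].
apply: real_induction => [//|t t0 t1 IH|t t0 t1 IH].
- have [ct zt] : P t by apply: IH; rewrite t0 lexx.
  have tI := in01 t t0 (ltW t1).
  have [xt xtE] := xc t tI.
  have xc2 : chart_dom x (c2 t) by rewrite ct.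
  have cxt : cx t = c t by rewrite /cx /= ct.
  have cxc : {for t, continuous cx}.
    by apply: continuous_comp; [exact: cc2|exact: chart_map_cts].
  have n1 : \forall u \near t, chart_dom x (c2 u) by exact: near_chart_dom (cc2 t tI) xc2.
  have rp : 0 < r - `|c t - a0| by rewrite subr_gt0; exact: cr.
  have sp : 0 < s - `|z t| by rewrite subr_gt0; exact: zs.
  have n2 : \forall u \near t, `|cx t - cx u| < r - `|c t - a0| by exact: ((cvgrPdist_lt _ _).1 cxc).
  have n3 : \forall u \near t, `|derive1 cx t - derive1 cx u| < s - `|z t|.
    exact: ((cvgrPdist_lt _ _).1 (dcx_cts t tI xc2)).
  have n4 : \forall u \near t, - e < u < 1 + e.
    have : \forall u \near t, [set` `](- e), (1 + e)[] u.
      by apply: open_nbhs_nbhs; split => //=; rewrite in_itv.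
    by apply: filterS => u /=; rewrite in_itv.
  have [d /= d0 Hd] := (@nbhs_normP R R t _).1 (filterI (filterI n1 n2) (filterI n3 n4)).
  (* The comparison of solutions covers time intervals of length at most 1. *)
  exists (Num.min d 1); first by rewrite lt_min d0 ltr01.
  move=> u /andP[tu]; rewrite -ltrBlDl lt_min => /andP[ud u1].
  pose b := u - t.
  have b01 : 0 <= b <= 1 by rewrite /b; apply/andP; split; lra.
  have facts v : 0 <= v <= b -> [/\ chart_dom x (c2 (t + v)), `|cx (t + v) - a0| <= r,
      `|derive1 cx (t + v)| <= s & - e < t + v < 1 + e].
    move=> /andP[v0 vb]; have [|[h1 h2] [h3 h4]] := Hd (t + v).
      by rewrite /ball_/= opprD addrA subrr sub0r normrN ger0_norm// (le_lt_trans vb).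
    split => //.
      have h5 : `|cx (t + v) - a0| <= `|c t - cx (t + v)| + `|c t - a0|.
        by rewrite [`|c t - cx _|]distrC -{1}(subrKA (c t)) ler_normD.
      rewrite cxt in h2; apply: (le_trans h5); rewrite -lerBrDr; exact: ltW.
    have h5 : `|derive1 cx (t + v)| <= `|z t - derive1 cx (t + v)| + `|z t|.
      by rewrite -zt [`|_ - _|]distrC -{1}(subrK (derive1 cx t) (derive1 cx (t + v))) ler_normD.
    rewrite zt in h3; apply: (le_trans h5); rewrite -lerBrDr; exact: ltW.
  have sol1 : ode_solution H 0 b (fun v => cx (t + v)) (fun v => derive1 cx (t + v)).
    move=> v vb; have [h1 h2 h3 h4] := facts v vb.
    have [|d1' d2'] := geodesic_solution gc _ h1 h2 h3; first by rewrite /= in_itv.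
    by split; apply: is_derive_translate.
  have sol2 : ode_solution H 0 b (fun v => c (t + v)) (fun v => z (t + v)).
    move=> v vb; have [h1 h2 h3 h4] := facts v vb; have [s1 s2] := sol (t + v) h4.
    by split; apply: is_derive_translate.
  have c00 : cx (t + 0) = c (t + 0) by rewrite addr0.
  have bb : 0 <= b <= b by case/andP: b01 => ->; rewrite lexx.
  have [] := ode_solution_close lam_small HL b01 sol1 sol2 c00 bb.
  rewrite addr0 zt subrr normr0 !mulr0 scaler0 subr0 !normr_le0 !subr_eq0.
  rewrite /b addrC subrK => /eqP zu /eqP cu; split => //.
  have [h1 _ _ _] := facts b bb; rewrite /b addrC subrK in h1.
  by rewrite -cu /cx /= chart_invK.
- have tI := in01 t (ltW t0) t1.
  have [xt xtE] := xc t tI.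
  (* Positions come before velocities: only once [c2 t] is known to lie in the chart is its
     coordinate velocity continuous at [t]. *)
  have ct : c2 t = chart_inv x (c t).
    apply: (@left_limit_unique R M c2 (chart_inv x \o c) 0 t (@manifold_hausdorff _ _ M) (cc2 t tI) _ t0).
      apply: (@continuous_comp _ _ _ c (chart_inv x)); first exact: cc.
      by apply: chart_inv_cts; apply: r_img; exact/ltW/cr.
    by move=> u ub; have [] := IH u ub.
  split => //.
  apply: (@left_limit_unique R 'rV[R]_n (derive1 cx) z 0 t (@norm_hausdorff _ _) (dcx_cts t tI _) (cz t tI) t0).
    by rewrite ct.
  by move=> u ub; have [] := IH u ub.
Qed.

End chart_geodesics.

(** * Riemannian distance in a chart *)

Lemma positive_on_sphere (R : realType) (n : nat) (phi : 'rV[R]_n -> R) :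
  continuous phi -> (forall w, w != 0 -> 0 < phi w) ->
  exists2 m, 0 < m & forall w, `|w| = 1 -> m <= phi w.
Proof.
move=> cphi phi_gt0; pose S := [set w : 'rV[R]_n | `|w| = 1].
(* In dimension 0 the sphere is empty and any positive bound will do. *)
have [S0|S0] := pselect (S !=set0); last first.
  by exists 1 => // w w1; exfalso; apply: S0; exists w.
have cS : compact S.
  apply: bounded_closed_compact.
    by exists 1; split => // M M1 w /= ->; exact: ltW.
  have -> : S = (fun w : 'rV[R]_n => `|w|) @^-1` [set 1] by [].
  by apply: closed_comp; [move=> w _; exact: norm_continuous|exact: closed_eq].
have [w /set_mem Sw Hw] := EVT_min_rV S0 cS (continuous_subspaceT cphi).
exists (phi w); first by apply: phi_gt0; rewrite -normr_gt0 Sw.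
by move=> u u1; apply: Hw; rewrite inE.
Qed.

(** The triangle inequality on the standard basis gives the upper bound and with it the continuity
    of [N]; compactness of the unit sphere then gives the lower bound. *)
Lemma norm_equivalent (R : realType) (n : nat) (N : 'rV[R]_n -> R) : is_norm N ->
  exists m C : R, [/\ 0 < m, 0 < C & forall u, m * `|u| <= N u /\ N u <= C * `|u|].
Proof.
move=> [ND NZ N0].
have N00 : N 0 = 0 by rewrite -(scale0r 0) NZ normr0 mul0r.
have Nge0 u : 0 <= N u.
  have := ND u (- u); rewrite subrr N00 -scaleN1r NZ normrN1 mul1r; lra.
pose C := 1 + \sum_(i < n) N (delta_mx 0 i).
have C1 : 1 <= C by rewrite lerDl sumr_ge0.
have Nsum (I : Type) (s : seq I) (F : I -> 'rV[R]_n) : N (\sum_(i <- s) F i) <= \sum_(i <- s) N (F i).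
  elim: s => [|i s IH]; first by rewrite !big_nil N00.
  by rewrite !big_cons (le_trans (ND _ _))// lerD2l.
have NC u : N u <= C * `|u|.
  rewrite {1}(row_sum_delta u) (le_trans (Nsum _ _ _))//.
  apply: (@le_trans _ _ (\sum_(i < n) N (delta_mx 0 i) * `|u|)).
    by apply: ler_sum => i _; rewrite NZ mulrC ler_wpM2l// ler_coord_norm.
  by rewrite -mulr_suml ler_wpM2r// /C lerDr.
have cN : continuous N.
  apply: (@lipschitz_continuous _ _ _ _ C) => u w; apply: le_trans (NC _).
  have h1 := ND (u - w) w; rewrite subrK in h1.
  have h2 := ND (w - u) u; rewrite subrK in h2.
  have h3 : N (w - u) = N (u - w) by rewrite -opprB -scaleN1r NZ normrN1 mul1r.
  by rewrite ler_norml; apply/andP; split; lra.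
have Npos w : w != 0 -> 0 < N w.
  move=> w0; rewrite lt_neqAle Nge0 andbT eq_sym; apply/eqP => /N0 /eqP.
  by rewrite (negbTE w0).
have [m m0 Hm] := positive_on_sphere cN Npos.
exists m, C; split => //; first by rewrite (lt_le_trans ltr01).
move=> u; split => //; have [->|u0] := eqVneq u 0; first by rewrite normr0 mulr0 N00.
have un0 : 0 < `|u| by rewrite normr_gt0.
have := Hm (`|u|^-1 *: u); rewrite normrZ normfV normr_id mulVf ?gt_eqF// => /(_ erefl).
by rewrite NZ normfV normr_id ler_pdivlMl// mulrC.
Qed.

Section quadratic_form.
Variables (R : realType) (n : nat).
Implicit Types (G : 'M[R]_n) (w : 'rV[R]_n).

Lemma bformE G w w' : bform G w w' = \sum_i \sum_j G i j * w 0 i * w' 0 j.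
Proof.
rewrite /bform mxE exchange_big/=; apply: eq_bigr => j _; rewrite !mxE mulr_suml.
by apply: eq_bigr => i _; ring.
Qed.

Lemma bform_close G G' w (e : R) : (forall i j, `|G i j - G' i j| <= e) ->
  `|bform G w w - bform G' w w| <= (n * n)%:R * e * `|w| ^+ 2.
Proof.
move=> H; rewrite !bformE -sumrB (le_trans (ler_norm_sum _ _ _))//.
apply: (@le_trans _ _ (\sum_(i < n) \sum_(j < n) e * `|w| ^+ 2)).
  apply: ler_sum => i _; rewrite -sumrB (le_trans (ler_norm_sum _ _ _))//.
  apply: ler_sum => j _.
  have -> : G i j * w 0 i * w 0 j - G' i j * w 0 i * w 0 j = (G i j - G' i j) * (w 0 i * w 0 j).
    by ring.
  rewrite !normrM expr2; apply: ler_pM => //; apply: ler_pM => //; exact: ler_coord_norm.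
by rewrite sumr_const card_ord sumr_const card_ord -mulrnA -[X in X <= _]mulr_natl mulrA.
Qed.

Lemma bform_homogeneous G w (t : R) : bform G (t *: w) (t *: w) = t ^+ 2 * bform G w w.
Proof. by rewrite /bform linearZ/= -!scalemxAl -scalemxAr scalerA mxE expr2. Qed.

Lemma bform_continuous G : continuous (fun w => bform G w w).
Proof.
move=> w; apply: differentiable_continuous.
have -> : (fun w => bform G w w) = \sum_i \sum_j (G i j *: ((fun w : 'rV[R]_n => w 0 i : R) * (fun w => w 0 j : R))).
  apply/funext => u; rewrite bformE fct_sumE; apply: eq_bigr => i _.
  by rewrite fct_sumE; apply: eq_bigr => j _; rewrite -mulrA.
apply: differentiable_sum => i; apply: differentiable_sum => j.
by apply: differentiableZ; apply: differentiableM; exact: differentiable_coord.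
Qed.

Lemma bform_lower G : (forall w, w != 0 -> 0 < bform G w w) ->
  exists2 m, 0 < m & forall w, m * `|w| ^+ 2 <= bform G w w.
Proof.
move=> Gpos; have [m m0 Hm] := positive_on_sphere (@bform_continuous G) Gpos.
exists m => // w; have [->|w0] := eqVneq w 0.
  by rewrite normr0 expr0n/= mulr0 /bform !mul0mx mxE.
have wn0 : 0 < `|w| by rewrite normr_gt0.
have := Hm (`|w|^-1 *: w); rewrite normrZ normfV normr_id mulVf ?gt_eqF// => /(_ erefl).
by rewrite bform_homogeneous exprVn ler_pdivlMl ?exprn_gt0// mulrC.
Qed.

End quadratic_form.

Section local_metric.
Variables (R : realType) (n : nat) (M : manifold R n) (h : M -> 'M[R]_n).
Hypothesis hh : smooth_riemannian h.

Lemma metric_mx_pos x q w : atlas x -> chart_dom x q -> w != 0 ->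
  0 < bform (metric_mx h x (chart_map x q)) w w.
Proof.
move=> ax xq w0; rewrite metric_mxE// -bform_mul; apply: (riem_pos hh).
have xy : overlap x (chart_at q) (chart_map x q) by exists q => //; split => //; exact: chart_at_dom.
have uJ := jac_unit ax (chart_at_atlas q) xy.
apply: contra_neq w0 => E.
by rewrite -(mulmxK uJ w) E mul0mx.
Qed.

Lemma component_continuous x i j a : atlas x -> chart_img x a -> {for a, continuous (component h x i j)}.
Proof.
move=> ax xa; have [c _] := riem_smooth hh ax i j 0.
exact: within_open_continuous (@chart_img_open _ _ _ x) c xa.
Qed.

(** The form at the centre is at least [m * |w| ^+ 2]. Near it the entries move by at most [eta],
    chosen so that the form changes by at most half of that. The square roots are taken because
    speeds are square roots of the form. *)
Lemma local_metric_bounds x p : atlas x -> chart_dom x p -> 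
  exists rho kap C : R, [/\ 0 < rho, 0 < kap, 0 < C &
    forall a, `|a - chart_map x p| < rho -> chart_img x a /\
     forall w, (kap * `|w|) ^+ 2 <= bform (metric_mx h x a) w w /\
               bform (metric_mx h x a) w w <= (C * `|w|) ^+ 2].
Proof.
move=> ax xp; set a0 := chart_map x p.
have xa0 : chart_img x a0 by exact: chart_img_map.
have [m m0 Hm] := bform_lower (fun w => @metric_mx_pos x p w ax xp).
pose n2 : R := (n * n)%:R.
have n20 : 0 <= n2 by rewrite ler0n.
pose eta := m / 2 / (n2 + 1).
have eta0 : 0 < eta by rewrite divr_gt0// ?divr_gt0// ltr_wpDl.
have Hij (ij : 'I_n * 'I_n) : exists2 d, 0 < d & forall a, `|a - a0| < d ->
    `|component h x ij.1 ij.2 a - component h x ij.1 ij.2 a0| < eta.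
  by apply: (continuous_for_dist _ eta0); exact: component_continuous.
pose d ij := sval (cid2 (Hij ij)).
have [d1 d10 Hd1] := open_ball_mem (@chart_img_open _ _ _ x) xa0.
pose rho := \big[Num.min/d1]_ij d ij.
have rho0 : 0 < rho.
  apply: (big_ind (fun r => 0 < r)) => // [a b a1 b1|l _]; first by rewrite lt_min a1.
  by rewrite /d; case: cid2.
have close a : `|a - a0| < rho -> forall i j, `|metric_mx h x a i j - metric_mx h x a0 i j| <= eta.
  move=> ar i j; rewrite [X in X - _]mxE [X in _ - X]mxE; apply: ltW.
  have : `|a - a0| < d (i, j) by apply: lt_le_trans ar _; exact: bigmin_le_cond.
  by rewrite /d; case: cid2 => r r0 Hr /= /Hr.
have n2eta : n2 * eta <= m / 2.
  rewrite /eta mulrCA -[leRHS]mulr1 ler_pM2l ?divr_gt0//.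
  by rewrite ler_pdivrMr ?mul1r ?lerDl// ltr_wpDl.
pose B := \sum_i \sum_j `|metric_mx h x a0 i j|.
have B0 : 0 <= B by apply: sumr_ge0 => i _; apply: sumr_ge0.
have upper0 w : bform (metric_mx h x a0) w w <= n2 * B * `|w| ^+ 2.
  have := @bform_close _ _ (metric_mx h x a0) 0 w B _.
  have -> : bform (0 : 'M[R]_n) w w = 0 by rewrite /bform mulmx0 mul0mx mxE.
  rewrite subr0 => H; apply: le_trans (ler_norm _) (H _) => i j.
  rewrite [(0 : 'M[R]_n) i j]mxE subr0 /B (bigD1 i)//= (bigD1 j)//= -addrA lerDl.
  by rewrite addr_ge0 ?sumr_ge0// => k _; rewrite sumr_ge0.
have aux (P Q W : R) : - (n2 * eta * W) <= P - Q -> P - Q <= n2 * eta * W ->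
   m * W <= Q -> Q <= n2 * B * W -> 0 <= W -> n2 * eta * W <= m / 2 * W -> 0 <= m * W ->
   m / 2 * W <= P /\ P <= (n2 * B + m) * W.
  by move=> *; split; rewrite ?mulrDl; lra.
have nB : 0 <= n2 * B by rewrite mulr_ge0.
have mp : 0 <= m / 2 by rewrite ltW// divr_gt0.
have nBm : 0 < n2 * B + m by rewrite ltr_wpDl.
exists rho, (Num.sqrt (m / 2)), (Num.sqrt (n2 * B + m)).
split; [exact: rho0|by rewrite sqrtr_gt0 divr_gt0|by rewrite sqrtr_gt0|].
move=> a ar; split.
  by apply: Hd1; apply: lt_le_trans ar _; exact: bigmin_le_id.
move=> w; rewrite !exprMn (sqr_sqrtr mp) (sqr_sqrtr (ltW nBm)).
have cl := bform_close w (close a ar).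
have h1 := Hm w; have h2 := upper0 w.
have w2 : 0 <= `|w| ^+ 2 by exact: exprn_ge0.
have h3 : n2 * eta * `|w| ^+ 2 <= m / 2 * `|w| ^+ 2 by rewrite ler_wpM2r.
move: cl; rewrite -/n2 ler_norml => /andP[c1 c2].
have h4 : 0 <= m * `|w| ^+ 2 by rewrite mulr_ge0// ltW.
exact: (aux _ _ _ c1 c2 h1 h2 w2 h3 h4).
Qed.

End local_metric.

Lemma near_eq_continuous (V W : topologicalType) (f g : V -> W) (t : V) :
  (\forall s \near t, f s = g s) -> {for t, continuous f} -> {for t, continuous g}.
Proof.
move=> fg cf; have e : f t = g t by exact: (nbhs_singleton fg).
have := cf; rewrite /prop_for /continuous_at e; apply: cvg_trans.
exact: near_eq_cvg.
Qed.

Lemma continuous_fun_sum (R : realType) (V W : normedModType R) (m : nat)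
    (F : 'I_m -> V -> W) (t : V) :
  (forall i, {for t, continuous (F i)}) -> {for t, continuous (fun s => \sum_i F i s)}.
Proof.
move=> H; suff G (r : seq 'I_m) : {for t, continuous (fun s => \sum_(i <- r) F i s)} by exact: G.
elim: r => [|i r IH].
  have -> : (fun s => \sum_(i <- [::]) F i s) = cst 0 by apply/funext => s; rewrite big_nil.
  exact: cst_continuous.
have -> : (fun s => \sum_(j <- i :: r) F j s) = (fun s => F i s + \sum_(j <- r) F j s).
  by apply/funext => s; rewrite big_cons.
by apply: continuousD; [exact: H|exact: IH].
Qed.

(** * Speed and length of C^1 segments *)

Section segments.
Variables (R : realType) (n : nat) (M : manifold R n) (h : M -> 'M[R]_n).
Hypothesis hh : smooth_riemannian h.
Implicit Types (x y : chart R n M) (c : R -> M).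

Definition speed c (t : R) : R := Num.sqrt (bform (h (c t)) (velocity c t) (velocity c t)).

Lemma velocity_change y c (t : R) : atlas y -> {for t, continuous c} -> chart_dom y (c t) ->
  derivable (chart_map y \o c : R -> 'rV[R]_n) t 1 ->
  velocity c t = derive1 (chart_map y \o c : R -> 'rV[R]_n) t *m jac y (chart_at (c t)) (chart_map y (c t)).
Proof.
move=> ay cc yc dc; rewrite /velocity derive1E.
have [_ ->] := curve_change ay (chart_at_atlas (c t)) cc yc (chart_at_dom (c t)) (derivableP dc).
by rewrite derive1E.
Qed.

(** The velocity is defined through [chart_at (c t)], which may jump with [t]. In a fixed chart the
    speed becomes an expression in continuous functions. *)
Lemma speed_chart y c (t : R) : atlas y -> {for t, continuous c} -> chart_dom y (c t) ->
  derivable (chart_map y \o c : R -> 'rV[R]_n) t 1 ->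
  speed c t = Num.sqrt (bform (metric_mx h y (chart_map y (c t)))
    (derive1 (chart_map y \o c : R -> 'rV[R]_n) t) (derive1 (chart_map y \o c : R -> 'rV[R]_n) t)).
Proof.
move=> ay cc yc dc; rewrite /speed (velocity_change ay cc yc dc) bform_mul.
by rewrite (metric_mxE h yc).
Qed.

Section one_segment.
Variables (c : R -> M) (e : R).
Hypothesis e0 : 0 < e.
Hypothesis cc : {within `](- e), (1 + e)[, continuous c}.
Hypothesis dc : forall (t : R) (x : chart R n M),
      - e < t < 1 + e -> atlas x -> chart_dom x (c t) ->
      (\forall s \near t, derivable (chart_map x \o c : R -> 'rV[R]_n) s 1) /\
      {for t, continuous (derive1 (chart_map x \o c : R -> 'rV[R]_n))}.

Lemma segment_continuous t : - e < t < 1 + e -> {for t, continuous c}.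
Proof.
by move=> te; apply: within_open_continuous (interval_open _ _) cc _ => //=; rewrite in_itv.
Qed.

Lemma near_segment t : - e < t < 1 + e -> \forall s \near t, - e < s < 1 + e.
Proof.
move=> te; have : \forall s \near t, [set` `](- e), (1 + e)[] s.
  by apply: open_nbhs_nbhs; split; [exact: interval_open|rewrite /= in_itv].
by apply: filterS => s /=; rewrite in_itv.
Qed.

Lemma speed_continuous t : - e < t < 1 + e -> {for t, continuous (speed c)}.
Proof.
move=> te; pose y := chart_at (c t).
have ay : atlas y by exact: chart_at_atlas.
have yc : chart_dom y (c t) by exact: chart_at_dom.
have ct := segment_continuous te.
have [d1 d2] := dc te ay yc.
pose D : R -> 'rV[R]_n := derive1 (chart_map y \o c : R -> 'rV[R]_n).
apply: (@near_eq_continuous R R (fun s => Num.sqrt (\sum_i \sum_j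
   component h y i j (chart_map y (c s)) * D s 0 i * D s 0 j))).
  have n1 := near_segment te; have n2 := near_chart_dom ct yc.
  near=> s.
  have se : - e < s < 1 + e by near: s.
  have ys : chart_dom y (c s) by near: s.
  have ds : derivable (chart_map y \o c : R -> 'rV[R]_n) s 1 by near: s.
  rewrite (speed_chart ay (segment_continuous se) ys ds) bformE.
  by congr (Num.sqrt _); apply: eq_bigr => i _; apply: eq_bigr => j _; rewrite [metric_mx _ _ _ _ _]mxE.
have cyc : {for t, continuous (chart_map y \o c)}.
  by apply: continuous_comp; [exact: ct|exact: chart_map_cts].
have cD i : {for t, continuous (fun s => D s 0 i)}.
  apply: (@continuous_comp _ _ _ D (fun N : 'rV[R]_n => N 0 i)); first exact: d2.
  exact: coord_continuous.
apply: (@continuous_comp _ _ _ _ (@Num.sqrt R)); last exact: sqrt_continuous.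
apply: continuous_fun_sum => i; apply: continuous_fun_sum => j.
apply: continuousM; last exact: cD.
apply: continuousM; last exact: cD.
apply: (@continuous_comp _ _ _ (chart_map y \o c) (component h y i j)); first exact: cyc.
by apply: component_continuous => //; exact: chart_img_map.
Unshelve. all: by end_near. Qed.

(** Turns the length into the increment of a function with two-sided derivatives on all of [0, 1],
    so that length estimates reduce to mean value arguments. *)
Lemma segment_length_primitive : exists G : R -> R,
  (forall t : R, 0 <= t <= 1 -> is_derive t 1 G (speed c t)) /\
  segment_length h c = G 1 - G 0.
Proof.
(* Time is truncated to [0, 1], centred at 1/2, which extends the speed to a continuous function on
   the whole line without changing it on [0, 1]. *)
pose tau (t : R) := 2^-1 + clamp 2^-1 (t - 2^-1).
have tau01 t : 0 <= tau t <= 1.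
  have : `|clamp 2^-1 (t - 2^-1)| <= 2^-1 by apply: clamp_le.
  by rewrite /tau ler_norml => /andP[h1 h2]; apply/andP; split; lra.
have tau_id t : 0 <= t <= 1 -> tau t = t.
  move=> /andP[t0 t1]; rewrite /tau clamp_id; first by rewrite addrC subrK.
  by rewrite ler_norml; apply/andP; split; lra.
have tau_cts : continuous tau.
  apply: (@lipschitz_continuous _ _ _ tau 1) => u v; rewrite mul1r /tau opprD addrACA subrr add0r.
  by apply: (le_trans (clamp_lipschitz _ _ _)); rewrite opprB addrA subrK.
have in01 t : 0 <= t <= 1 -> - e < t < 1 + e.
  by move=> /andP[t0 t1]; apply/andP; split; have := e0; lra.
have cs : continuous (speed c \o tau).
  move=> t; apply: continuous_comp; first exact: tau_cts.
  by apply: speed_continuous; apply: in01.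
have [G [_ dG]] := antiderivative (ltr0n R 2) cs.
have dG' (t : R) : 0 <= t <= 1 -> is_derive t 1 G (speed c t).
  move=> t01; have : - 2 < t < 2 by move: t01 => /andP[t0 t1]; apply/andP; split; lra.
  by move=> /dG; rewrite /= tau_id.
exists G; split; first exact: dG'.
have cs' : {within `[0, 1], continuous (speed c)}.
  apply: continuous_in_subspaceT => t; rewrite inE/= in_itv/= => t01.
  exact: (speed_continuous (in01 t t01)).
exact: (@Rintegral_derive R (speed c) G 0 1 ltr01 cs' dG').
Qed.

End one_segment.

End segments.

Lemma min_lipschitz (R : realType) (r u v : R) : `|Num.min r u - Num.min r v| <= `|u - v|.
Proof.
wlog uv : u v / u <= v => [H|].
  by have [/H//|/ltW/H] := leP u v; rewrite distrC [`|v - u|]distrC.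
have m : Num.min r u <= Num.min r v by rewrite le_min ge_min lexx/= ge_min uv orbT.
rewrite distrC ger0_norm ?subr_ge0// distrC ger0_norm ?subr_ge0//.
by have [h1|h1] := leP r u; have [h2|h2] := leP r v; lra.
Qed.

(** * Coordinate distance and Riemannian distance *)

Section distance.
Variables (R : realType) (n : nat) (M : manifold R n) (h : M -> 'M[R]_n).
Hypothesis hh : smooth_riemannian h.
Variables (x : chart R n M) (a0 : 'rV[R]_n) (rho kap C : R).
Hypothesis ax : atlas x.
Hypothesis rho0 : 0 < rho.
Hypothesis kap0 : 0 < kap.
Hypothesis C0 : 0 < C.
Hypothesis bounds : forall a, `|a - a0| < rho -> chart_img x a /\
     forall w, (kap * `|w|) ^+ 2 <= bform (metric_mx h x a) w w /\
               bform (metric_mx h x a) w w <= (C * `|w|) ^+ 2.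

Section lower.
Variables (b : 'rV[R]_n) (rho1 : R).
Hypothesis b_rho : `|b - a0| + rho1 < rho.

(* The truncation extends the coordinate distance to [b] continuously to all of [M]. *)
Definition truncated_dist (q : M) : R :=
  if `[< chart_dom x q >] then Num.min rho1 `|chart_map x q - b| else rho1.

Lemma truncated_distE q : chart_dom x q -> truncated_dist q = Num.min rho1 `|chart_map x q - b|.
Proof. by move=> xq; rewrite /truncated_dist asboolT. Qed.

(** The closed coordinate ball of radius [rho1] around [b] is compact, so its image is compact and,
    [M] being Hausdorff, closed in [M]. Its complement is therefore a neighborhood of [q] on which
    the truncation equals [rho1], even at points on the edge of the chart domain. *)
Lemma truncated_dist_far q : ~ (chart_dom x q /\ `|chart_map x q - b| <= rho1) ->
  \forall q' \near q, truncated_dist q' = rho1.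
Proof.
move=> far; pose B := [set a : 'rV[R]_n | `|a - b| <= rho1].
have Bimg a : B a -> chart_img x a.
  move=> Ba; have [] := @bounds a => //; apply: le_lt_trans b_rho.
  by rewrite -(subrKA b) (le_trans (ler_normD _ _))// addrC lerD2l.
have cB : compact B.
  apply: bounded_closed_compact.
    exists (`|b| + rho1); split; first by rewrite num_real.
    move=> m bm a Ba; apply: ltW; apply: le_lt_trans bm.
    by have := ler_normD (a - b) b; rewrite subrK; move: Ba; rewrite /B /=; lra.
  have -> : B = (fun a => `|a - b|) @^-1` [set r | r <= rho1] by [].
  apply: closed_comp; last exact: closed_le.
  move=> a _; apply: (@lipschitz_continuous _ _ _ (fun a : 'rV[R]_n => `|a - b|) 1) => u v.
  by rewrite mul1r (le_trans (ler_dist_dist _ _))// opprB addrA subrK.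
have cK : compact (chart_inv x @` B).
  apply: continuous_compact cB; apply: continuous_in_subspaceT => a /set_mem Ba.
  exact/chart_inv_cts/Bimg.
have oK : open (~` (chart_inv x @` B)).
  exact: (closed_openC (compact_closed (@manifold_hausdorff _ _ M) cK)).
have qK : (~` (chart_inv x @` B)) q.
  move=> [a Ba aq]; apply: far.
  by have [xa xaE] := chart_imgP (Bimg a Ba); rewrite -aq; split => //; rewrite xaE.
have : \forall q' \near q, (~` (chart_inv x @` B)) q' by apply: open_nbhs_nbhs.
apply: filterS => q' q'K; rewrite /truncated_dist; case: asboolP => // xq'.
apply/min_idPl; rewrite leNgt; apply/negP => lt; apply: q'K.
by exists (chart_map x q'); [exact: ltW|exact: chart_invK].
Qed.

(** A path between two points of the chart may leave it, so the estimate is made on a function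
    defined on all of [M]. Its composite [F] with the path need not be differentiable, whence the
    comparison of [F] with [kap^-1 * G] by upper derivates. *)
Lemma truncated_dist_segment c : C1_segment c ->
  truncated_dist (c 1) - truncated_dist (c 0) <= kap^-1 * segment_length h c.
Proof.
move=> [e e0 [cc dc]]; have [G [dG ->]] := segment_length_primitive hh e0 cc dc.
pose F t := truncated_dist (c t).
have in01 (t : R) : 0 <= t -> t <= 1 -> - e < t < 1 + e.
  by move=> t0 t1; apply/andP; split; lra.
have kV : 0 < kap^-1 by rewrite invr_gt0.
(* Inside the closed ball the growth of [F] is at most the coordinate speed, controlled by [kap];
   elsewhere [F] is locally constant. *)
have claim (t : R) : 0 <= t -> t <= 1 -> forall eta, 0 < eta -> exists2 d, 0 < d & forall s : R,
    `|s - t| < d -> `|F s - F t| <= (kap^-1 * speed h c t + eta) * `|s - t|.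
  move=> t0 t1 eta eta0; have te := in01 t t0 t1.
  have ct := segment_continuous cc te.
  have [[xt ct_b]|far] := pselect (chart_dom x (c t) /\ `|chart_map x (c t) - b| <= rho1).
  - have [d1 d2] := dc t x te ax xt.
    have dxt := nbhs_singleton d1.
    have [d d0 Hd] := is_derive1_expand (derivableP dxt) eta0.
    have [d' /= d'0 Hd'] := (@nbhs_normP R R t _).1 (near_chart_dom ct xt).
    exists (Num.min d d'); first by rewrite lt_min d0.
    move=> s; rewrite lt_min => /andP[sd sd'].
    have xs : chart_dom x (c s) by apply: Hd'; rewrite /ball_/= distrC.
    rewrite /F (truncated_distE xs) (truncated_distE xt).
    apply: (le_trans (min_lipschitz _ _ _)); apply: (le_trans (ler_dist_dist _ _)).
    rewrite opprB addrA subrK mulrDl.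
    have := Hd s sd; rewrite -derive1E /=.
    set w := derive1 _ t => H.
    have wk : `|w| <= kap^-1 * speed h c t.
      rewrite (speed_chart h ax ct xt dxt) ler_pdivlMl//.
      have [|_ Hw] := @bounds (chart_map x (c t)).
        apply: le_lt_trans b_rho; rewrite -(subrKA b) (le_trans (ler_normD _ _))//.
        by rewrite addrC lerD2l.
      have kw0 : 0 <= kap * `|w| by rewrite mulr_ge0// ltW.
      by rewrite -(ger0_norm kw0) -sqrtr_sqr; apply: ler_wsqrtr; have [] := Hw w.
    rewrite -(subrK ((s - t) *: w) (chart_map x (c s) - chart_map x (c t))).
    rewrite (le_trans (ler_normD _ _))// addrC lerD//.
    by rewrite normrZ mulrC ler_wpM2r.
  - have fart := truncated_dist_far far.
    have nF : \forall s \near t, truncated_dist (c s) = rho1 by exact: ct fart.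
    have Ft := nbhs_singleton nF.
    have [d /= d0 Hd] := (@nbhs_normP R R t _).1 nF.
    exists d => // s sd; rewrite /F Ft Hd; last by rewrite /ball_/= distrC.
    rewrite subrr normr0 mulr_ge0// addr_ge0 ?(ltW eta0)//.
    by rewrite mulr_ge0 ?(ltW kV)// sqrtr_ge0.
suff : F 1 - kap^-1 * G 1 <= F 0 - kap^-1 * G 0 by rewrite /F mulrBr; lra.
apply: (@nonincreasing_of_upper_derivate _ (fun t => F t - kap^-1 * G t)) => // t t0 t1 eta eta0.
- have eta2 : 0 < eta / 2 by rewrite divr_gt0.
  have eta2k : 0 < kap * (eta / 2) by rewrite mulr_gt0.
  have [d d0 Hd] := claim t t0 (ltW t1) _ eta2.
  have t01 : 0 <= t <= 1 by rewrite t0 ltW.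
  have [d' d'0 Hd'] := is_derive1_expand (dG t t01) eta2k.
  exists (Num.min d d'); first by rewrite lt_min d0.
  move=> s /andP[ts]; rewrite -ltrBlDl lt_min => /andP[sd sd'].
  have st0 : 0 < s - t by rewrite subr_gt0.
  have := Hd s; rewrite gtr0_norm// => /(_ sd) /(le_trans (ler_norm _)) h1.
  have := Hd' s; rewrite gtr0_norm// => /(_ sd').
  rewrite ler_norml => /andP[h2 _].
  have h3 : kap^-1 * (- (kap * (eta / 2) * (s - t))) <= kap^-1 * (G s - G t - (s - t) * speed h c t).
    by rewrite ler_pM2l.
  have h4 : kap^-1 * (- (kap * (eta / 2) * (s - t))) = - (eta / 2 * (s - t)).
    by rewrite mulrN !mulrA mulVf ?mul1r// gt_eqF.
  move: h1 h3; rewrite h4; move: (speed h c t) (F s) (F t) => S Fs Ft.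
  by move: (G s) (G t) kap^-1 => Gs Gt k; lra.
- have t01 : 0 <= t <= 1 by rewrite t1 ltW.
  have [d d0 Hd] := claim t (ltW t0) t1 _ ltr01.
  have [d' d'0 Hd'] := is_derive1_expand (dG t t01) ltr01.
  have S0 : 0 <= speed h c t by exact: sqrtr_ge0.
  pose K := (kap^-1 * speed h c t + 1) + kap^-1 * (1 + speed h c t).
  have K0 : 0 < K.
    have : 0 <= kap^-1 * speed h c t by rewrite mulr_ge0// ltW.
    have : 0 <= kap^-1 * (1 + speed h c t) by rewrite mulr_ge0// ?(ltW kV)// addr_ge0.
    by rewrite /K; lra.
  exists (Num.min (Num.min d d') (eta / K)); first by rewrite !lt_min d0 d'0 divr_gt0.
  move=> s /andP[sd st].
  have : t - s < Num.min (Num.min d d') (eta / K) by lra.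
  rewrite !lt_min => /andP[/andP[s1 s2]]; rewrite ltr_pdivlMr// => s3.
  have ts0 : 0 < t - s by rewrite subr_gt0.
  have := Hd s; rewrite distrC gtr0_norm// => /(_ s1) h1.
  have := Hd' s; rewrite [`|s - t|]distrC gtr0_norm// => /(_ s2) h2.
  have h3 : `|G t - G s| <= (1 + speed h c t) * (t - s).
    have -> : G t - G s = - (G s - G t - (s - t) * speed h c t) + (t - s) * speed h c t by ring.
    rewrite (le_trans (ler_normD _ _))// normrN [X in _ <= X]mulrDl lerD//.
    by rewrite normrM gtr0_norm// ger0_norm// mulrC.
  have h4 : kap^-1 * `|G t - G s| <= kap^-1 * ((1 + speed h c t) * (t - s)) by rewrite ler_pM2l.
  have h5 : - (kap^-1 * (G t - G s)) <= kap^-1 * `|G t - G s|.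
    by rewrite -mulrN ler_pM2l// -normrN ler_norm.
  have h6 := ler_norm (F t - F s).
  rewrite distrC in h1.
  move: s3; rewrite /K; move: h1 h4 h5 h6.
  move: (speed h c t) (F s) (F t) (`|F t - F s|) (`|G t - G s|) => S Fs Ft nF nG.
  by move: (G s) (G t) kap^-1 => Gs Gt k; lra.
Qed.

Lemma truncated_dist_path p q l : path_of_length h p q l ->
  truncated_dist q - truncated_dist p <= kap^-1 * l.
Proof.
elim=> [p'|c q' l' Cc _ IH]; first by rewrite subrr mulr0.
by have := truncated_dist_segment Cc; rewrite mulrDr; lra.
Qed.

End lower.

(** The truncation is taken at [rho / 2], which exceeds [|b - b'|] when both points lie within
    [rho / 4] of the centre; the truncated distance from [b] to [b'] is then the true one. *)
Lemma riem_dist_lower (b b' : 'rV[R]_n) : `|b - a0| < rho / 4 -> `|b' - a0| < rho / 4 ->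
  ((kap * `|b - b'|)%:E <= riem_dist h (chart_inv x b) (chart_inv x b'))%E.
Proof.
move=> br b'r; apply: le_ereal_inf_tmp => _ [l pl <-]; rewrite lee_fin.
have r1 : 0 < rho / 2 by rewrite divr_gt0.
have br1 : `|b - a0| + rho / 2 < rho by lra.
have := truncated_dist_path br1 pl.
have rho4 : rho / 4 < rho by lra.
have [/chart_imgP[xb xbE] _] := bounds (lt_trans br rho4).
have [/chart_imgP[xb' xb'E] _] := bounds (lt_trans b'r rho4).
rewrite !truncated_distE// xbE xb'E subrr normr0 [Num.min _ 0]min_r ?(ltW r1)// subr0.
rewrite min_r; last first.
  have := ler_normD (b' - a0) (a0 - b); rewrite subrKA [`|a0 - b|]distrC; lra.
by rewrite ler_pdivlMl// distrC.
Qed.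

(** The straight coordinate segment has length at most [C * |b - b'|]. A C^1 segment needs an open
    interval around [0, 1]; over (-1, 2) the line stays within [2 * (rho / 4) + rho / 8 < rho] of
    the centre. *)
Lemma riem_dist_upper (b b' : 'rV[R]_n) : `|b - a0| < rho / 8 -> `|b' - a0| < rho / 8 ->
  (riem_dist h (chart_inv x b) (chart_inv x b') <= (C * `|b - b'|)%:E)%E.
Proof.
move=> br b'r; pose v : 'rV[R]_n := b' - b.
have v_rho : `|v| < rho / 4.
  have := ler_normD (b' - a0) (a0 - b); rewrite subrKA [`|a0 - b|]distrC -/v; lra.
pose gam (t : R) : 'rV[R]_n := t *: (1 *: v) + b.
pose c := chart_inv x \o gam.
have dgam (t : R) : is_derive t 1 gam v.
  by rewrite -[X in is_derive _ _ _ X]scale1r; apply: (@is_derive_segment R 'rV[R]_n 'rV[R]_n id b v 1 t v).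
have cgam : continuous gam.
  by move=> t; apply/differentiable_continuous/derivable1_diffP; case: (dgam t).
have gam_in t : - 1 < t < 1 + 1 -> `|gam t - a0| < rho.
  move=> /andP[t1 t2]; rewrite /gam scale1r -addrA (le_lt_trans (ler_normD _ _))// normrZ.
  have t2' : `|t| <= 2 by rewrite ler_norml; apply/andP; split; lra.
  have h1 : `|t| * `|v| <= 2 * (rho / 4) by apply: ler_pM => //; exact: ltW.
  have h2 : 2 * (rho / 4) + rho / 8 < rho by have := rho0; lra.
  exact: (lt_trans (ler_ltD h1 br) h2).
have img t : - 1 < t < 1 + 1 -> chart_dom x (c t) /\ chart_map x (c t) = gam t.
  by move=> t1; apply: chart_imgP; exact: (bounds (gam_in t t1)).1.
have cc t : - 1 < t < 1 + 1 -> {for t, continuous c}.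
  move=> t1; apply: continuous_comp; first exact: cgam.
  by apply: chart_inv_cts; exact: (bounds (gam_in t t1)).1.
have oI : open [set` `](- 1 : R), (1 + 1)[] by exact: interval_open.
have nI (t : R) : - 1 < t < 1 + 1 -> \forall s \near t, - 1 < s < 1 + 1.
  move=> t1; have : \forall s \near t, [set` `](- 1), (1 + 1)[] s.
    by apply: open_nbhs_nbhs; split => //=; rewrite in_itv.
  by apply: filterS => s /=; rewrite in_itv.
have dcx (t : R) : - 1 < t < 1 + 1 -> is_derive t 1 (chart_map x \o c : R -> 'rV[R]_n) v.
  move=> t1; apply: near_eq_is_derive (dgam t).
  by have := nI t t1; apply: filterS => s s1; exact/esym/(img s s1).2.
have cwithin : {within `](- 1), (1 + 1)[, continuous c}.
  by rewrite continuous_open_subspace// => t; rewrite inE/= in_itv/=; exact: cc.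
have dc (t : R) y : - 1 < t < 1 + 1 -> atlas y -> chart_dom y (c t) ->
    (\forall s \near t, derivable (chart_map y \o c : R -> 'rV[R]_n) s 1) /\
    {for t, continuous (derive1 (chart_map y \o c : R -> 'rV[R]_n))}.
  move=> t1 ay yc; have [xt _] := img t t1.
  have dcy : \forall s \near t, is_derive (s : R) 1 (chart_map y \o c : R -> 'rV[R]_n)
      (\sum_i v 0 i *: partial i (transition x y) (chart_map x (c s))).
    have n1 := nI t t1; have n2 := near_chart_dom (cc t t1) yc.
    near=> s; have s1 : - 1 < s < 1 + 1 by near: s.
    have ys : chart_dom y (c s) by near: s.
    by rewrite sum_partial; exact: (curve_change ax ay (cc s s1) (img s s1).1 ys (dcx s s1)).
  split; first by apply: filterS dcy => s [].
  apply: (@near_eq_continuous R 'rV[R]_n (fun s => \sum_i v 0 i *: partial i (transition x y) (chart_map x (c s)))).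
    by apply: filterS dcy => s [_ E]; rewrite derive1E; exact: esym E.
  apply: continuous_fun_sum => i.
  have xy : overlap x y (chart_map x (c t)) by exists (c t).
  have [_ /(_ i) [_ [cp _]]] := transition_Ck 1 ax ay.
  apply: (@continuous_comp _ _ _ (fun s => partial i (transition x y) (chart_map x (c s))) (fun u => v 0 i *: u)).
    apply: (@continuous_comp _ _ _ (chart_map x \o c) (partial i (transition x y))).
      by apply: continuous_comp; [exact: cc|exact: chart_map_cts].
    exact: within_open_continuous (@open_overlap _ _ _ x y) cp xy.
  apply: (@lipschitz_continuous _ _ _ _ `|v 0 i|) => u u'.
  by rewrite -scalerBr normrZ.
have seg : C1_segment c by exists 1.
have [G [dG len]] := segment_length_primitive hh ltr01 cwithin dc.
have len_le : segment_length h c <= C * `|v|.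
  rewrite len -[leRHS]mulr1 -[X in _ * X](subr0 1) (le_trans (ler_norm _))//.
  apply: (mean_value_ineq ler01 dG) => t /andP[t0 t1].
  have t2 : - 1 < t < 1 + 1 by apply/andP; split; lra.
  have [xt xtE] := img t t2; have [dx dxE] := dcx t t2.
  have Cv : 0 <= C * `|v| by rewrite mulr_ge0// ltW.
  rewrite ger0_norm ?sqrtr_ge0// (speed_chart h ax (cc t t2) xt dx) derive1E dxE xtE.
  rewrite -(ger0_norm Cv) -sqrtr_sqr; apply: ler_wsqrtr.
  by have [_ /(_ v) []] := bounds (gam_in t t2).
have p01 := path_cons seg (path_nil h (c 1)).
have c0 : c 0 = chart_inv x b by rewrite /c /= /gam scale0r add0r.
have c1 : c 1 = chart_inv x b' by rewrite /c /= /gam !scale1r subrK.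
rewrite c0 c1 addr0 in p01.
apply: (@le_trans _ _ (segment_length h c)%:E); first by apply: ereal_inf_lbound; exists (segment_length h c).
by rewrite lee_fin [`|b - b'|]distrC.
Unshelve. all: by end_near. Qed.

End distance.

(** * Normal neighborhoods *)

(** The added 1 keeps the constant positive when [A] or the dimension vanishes, so that it can
    appear in denominators. *)
Lemma mulmx_norm_le (R : realType) (n : nat) (A : 'M[R]_n) (v : 'rV[R]_n) :
  `|v *m A| <= (n%:R * `|A| + 1) * `|v|.
Proof.
apply: (@le_trans _ _ (n%:R * `|A| * `|v|)); last by rewrite ler_wpM2r// lerDl.
apply: mx_norm_le => [|i j]; first by rewrite !mulr_ge0.
rewrite ord1 mxE (le_trans (ler_norm_sum _ _ _))//.
apply: (@le_trans _ _ (\sum_(k < n) `|A| * `|v|)); last first.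
  by rewrite sumr_const card_ord -[X in X <= _]mulr_natl mulrA.
apply: ler_sum => k _; rewrite normrM mulrC.
by apply: ler_pM => //; exact: ler_coord_norm.
Qed.

Lemma mulmx_continuous (R : realType) (n : nat) (A : 'M[R]_n) :
  continuous (fun v : 'rV[R]_n => v *m A).
Proof.
apply: (@lipschitz_continuous _ _ _ _ (n%:R * `|A| + 1)) => u w.
by rewrite -mulmxBl; exact: mulmx_norm_le.
Qed.

Lemma lipschitz_atN (R : realType) (n : nat) (f : 'rV[R]_n -> R) a :
  lipschitz_at f a -> lipschitz_at (fun b => - f b) a.
Proof.
move=> [d [K [d0 H]]]; exists d, K; split => // u w ud wd.
by rewrite -opprD normrN; exact: H.
Qed.

(** This is where the regularity C^{1,1} of [g] yields a Lipschitz equation: the symbols are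
    polynomials in the first derivatives and in the inverse component matrix. *)
Lemma christoffel_lipschitz_at (R : realType) (n : nat) (M : manifold R n) (g : M -> 'M[R]_n)
    (x : chart R n M) (a : 'rV[R]_n) (k i j : 'I_n) :
  C11_pseudo_riemannian g -> atlas x -> chart_img x a -> lipschitz_at (christoffel g x k i j) a.
Proof.
move=> hg ax xa; have oI := @chart_img_open _ _ _ x.
have [d d0 Hd] := open_ball_mem oI xa.
have Lp l r s : lipschitz_at (partial l (component g x r s)) a.
  have [_ H] := metric_C11 hg ax r s; exact: locally_lipschitz_at oI (H l) xa.
rewrite /christoffel; apply: lipschitz_atM; first exact: lipschitz_at_cst.
apply: lipschitz_at_sum => l; apply: lipschitz_atM.
  apply: (lipschitz_at_invmx d0) => [b bd|r s].
    have [xb xbE] := chart_imgP (Hd b bd); rewrite -xbE.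
    exact: (metric_mx_unit ax (metric_unit hg) xb).
  have -> : (fun b => (\matrix_(r, s) component g x r s b) r s) = component g x r s.
    by apply/funext => b; rewrite mxE.
  exact: (C1_lipschitz_at oI (component_C1 hg r s ax) xa).
apply: lipschitz_atD; last by apply: lipschitz_atN.
by apply: lipschitz_atD.
Qed.

Lemma geodesic_sub (R : realType) (n : nat) (M : manifold R n) (g : M -> 'M[R]_n)
    (I J : set R) (c : R -> M) : I `<=` J -> geodesic g J c -> geodesic g I c.
Proof.
move=> IJ [cc gc]; split; first exact: continuous_subspaceW IJ cc.
by move=> t x It; apply: gc; exact: IJ.
Qed.

Section normal_neighborhood.
Variables (R : realType) (n : nat) (M : manifold R n) (g h : M -> 'M[R]_n).
Hypothesis hg : C11_pseudo_riemannian g.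
Hypothesis hh : smooth_riemannian h.
Variables (x : chart R n M) (a0 : 'rV[R]_n) (r s lam K eps rho kap C : R).
Hypothesis ax : atlas x.
Let Gam k i j := christoffel g x k i j.
Let H := clamped_spray Gam a0 r s.
Hypothesis lam0 : 0 <= lam.
Hypothesis lam_small : lam <= 16^-1.
Hypothesis H0 : forall c, H c 0 = 0.
Hypothesis HL : forall c z c' z', `|H c z - H c' z'| <= lam * (`|c - c'| + `|z - z'|).
Hypothesis HK : forall c z, `|c - a0| <= r -> `|spray Gam c z| <= K * `|z| ^+ 2.
Hypothesis eps0 : 0 < eps.
Hypothesis eps_r : 25 * eps <= r.
Hypothesis eps_s : 12 * eps <= s.
Hypothesis eps_K : n%:R * (25 * eps) * K <= 1.
Hypothesis eps_rho : eps <= rho / 8.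
Hypothesis r_img : forall c, `|c - a0| <= r -> chart_img x c.
Hypothesis rho0 : 0 < rho.
Hypothesis kap0 : 0 < kap.
Hypothesis C0 : 0 < C.
Hypothesis bounds : forall a, `|a - a0| < rho -> chart_img x a /\
     forall w, (kap * `|w|) ^+ 2 <= bform (metric_mx h x a) w w /\
               bform (metric_mx h x a) w w <= (C * `|w|) ^+ 2.

Definition coord_ball : set 'rV[R]_n := [set a | sqnorm (a - a0) < eps ^+ 2].

Definition coord_nbhd : set M := chart_dom x `&` chart_map x @^-1` coord_ball.

Lemma coord_ball_close a : coord_ball a -> `|a - a0| < eps.
Proof. exact: norm_lt_of_sqnorm. Qed.

Lemma coord_ball_img a : coord_ball a -> chart_img x a.
Proof.
move=> /coord_ball_close ae; apply: r_img; apply: le_trans eps_r.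
by apply: ltW; apply: (lt_le_trans ae); rewrite ler_peMl ?(ltW eps0)// ler1n.
Qed.

Lemma coord_ball_open : open coord_ball.
Proof. exact: open_sqnorm_ball. Qed.

Lemma coord_nbhd_open : open coord_nbhd.
Proof. by apply: open_chart_preimage; exact: coord_ball_open. Qed.

(** * The exponential map at a point of the coordinate ball *)

Section at_point.
Variable q : M.
Hypothesis Uq : coord_nbhd q.
Let a := chart_map x q.
Let y := chart_at q.
(** [A] carries components of tangent vectors at [q] from the basis of [chart_at q] to that of the
    fixed chart [x], and [B] carries them back. In the chart [x] the exponential map becomes
    [E (v *m A)]. *)
Let A := jac y x (chart_map y q).
Let B := jac x y a.
Let E := endpoint lam0 lam_small H0 HL a.
Let flow_q := flow lam0 lam_small H0 HL a.
Let vel_q := flow_velocity lam0 lam_small H0 HL a.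

Let xq : chart_dom x q. Proof. by case: Uq. Qed.
Let aeps : `|a - a0| < eps. Proof. by case: Uq => _ /coord_ball_close. Qed.
Let ay : atlas y. Proof. exact: chart_at_atlas. Qed.
Let yq : chart_dom y q. Proof. exact: chart_at_dom. Qed.

Let AB : A *m B = 1%:M.
Proof.
have yx : overlap y x (chart_map y q) by exists q.
have := jac_inv ay ax yx; rewrite /transition /= chart_invK//.
Qed.

Let BA : B *m A = 1%:M. Proof. exact: mulmx1C AB. Qed.

Let E_lower v w : `|v - w| <= 2 * `|E v - E w|.
Proof. by apply: perturbed_identity_lower; exact: endpoint_perturbed_identity. Qed.

Let E_upper v w : `|E v - E w| <= 2 * `|v - w|.
Proof. by apply: perturbed_identity_upper; exact: endpoint_perturbed_identity. Qed.

Let E_inj v w : E v = E w -> v = w.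
Proof.
move=> Evw; apply/eqP; rewrite -subr_eq0 -normr_le0; have := E_lower v w.
by rewrite Evw subrr normr0 mulr0.
Qed.

Let E_continuous : continuous E.
Proof. exact: (lipschitz_continuous E_upper). Qed.

Let E0 : E 0 = a. Proof. exact: endpoint0. Qed.

(** Here 4 = 2 * (1 + 1): [|w|] is at most [2 * |E w - a|], and both [E w] and [a] lie within [eps]
    of the centre. *)
Let small w : coord_ball (E w) -> `|w| < 4 * eps.
Proof.
move=> /coord_ball_close Ew; have h1 := E_lower w 0.
rewrite subr0 E0 in h1.
have h2 : `|E w - a| <= `|E w - a0| + `|a - a0|.
  by rewrite [`|a - a0|]distrC -(subrKA a0) ler_normD.
by apply: (le_lt_trans h1); move: aeps Ew h2; lra.
Qed.

(** As [E] is defined on the whole space, the preimage of the ball raises no question of domain; on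
    it the truncations are inactive and [E] computes the exponential map. *)
Definition exp_domain : set 'rV[R]_n := [set v | coord_ball (E (v *m A))].

Let in2 (e t : R) : e <= 2^-1 -> - e < t < 1 + e -> - 2 < t < 2.
Proof. by move=> e2 /andP[t1 t2]; apply/andP; split; lra. Qed.

Let flow_facts w : coord_ball (E w) -> forall t : R, - 2 < t < 2 ->
  [/\ is_derive t 1 (flow_q w) (vel_q w t) /\
      is_derive t 1 (vel_q w) (H (flow_q w t) (vel_q w t)),
      `|flow_q w t - a0| < r & `|vel_q w t| < s].
Proof.
move=> Ew t t2; have w4 := small Ew.
have [_ _ fd _] := flowP lam0 lam_small H0 HL a w.
split; first exact: fd.
  by apply: lt_le_trans eps_r; exact: (small_flow_close lam0 lam_small H0 HL aeps w4).
by apply: lt_le_trans eps_s; exact: (small_flow_velocity lam0 lam_small H0 HL a w4).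
Qed.

Let exp_exists v : exp_domain v -> exp_rel g q v (chart_inv x (E (v *m A))).
Proof.
move=> Vv; set w := v *m A in Vv *; have facts := flow_facts Vv.
have [f0 v0 _ _] := flowP lam0 lam_small H0 HL a w.
have c0 : chart_inv x (flow_q w 0) = q by rewrite /flow_q f0 chart_invK.
(* The flow solves the equation on (-2, 2), which contains (-1/2, 3/2). *)
exists 2^-1, (chart_inv x \o flow_q w); split => //.
  apply: (solution_geodesic hg ax r_img (z := vel_q w)) => t tb.
  - by have [d _ _] := facts t (in2 (lexx _) tb); exact: d.
  - by have [_ d _] := facts t (in2 (lexx _) tb); exact: ltW.
  - by have [_ _ d] := facts t (in2 (lexx _) tb); exact: ltW.
have z2 : - 2 < (0 : R) < 2 by apply/andP; split; lra.
have [[d1 _] cl _] := facts 0 z2.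
have cts : {for (0 : R), continuous (chart_inv x \o flow_q w)}.
  apply: continuous_comp; last by apply: chart_inv_cts; apply: r_img; exact: ltW.
  by apply/differentiable_continuous/derivable1_diffP; case: d1.
have dcx : is_derive (0 : R) 1 (chart_map x \o (chart_inv x \o flow_q w) : R -> 'rV[R]_n) w.
  have vw : vel_q w 0 = w by exact: v0.
  rewrite vw in d1; apply: near_eq_is_derive d1.
  have : \forall t \near (0 : R), [set` `](- 2 : R), 2[] t.
    by apply: open_nbhs_nbhs; split; [exact: interval_open|rewrite /= in_itv].
  apply: filterS => t /=; rewrite in_itv/= => t2.
  have [_ clt _] := facts t t2.
  by have [_ xE] := chart_imgP (r_img (ltW clt)); rewrite /= xE.
have xc : chart_dom x ((chart_inv x \o flow_q w) 0) by rewrite /= c0.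
have [dx dxE] := dcx.
rewrite (velocity_change ax cts xc dx) derive1E dxE /= c0 -/a -/y -/B.
by rewrite /w -mulmxA AB mulmx1.
Qed.

(** [exp_map] picks an arbitrary value of the relation, so its value is known only once all
    geodesics with the given initial data are shown to end at the same point. *)
Let exp_unique v z : exp_domain v -> exp_rel g q v z -> z = chart_inv x (E (v *m A)).
Proof.
move=> Vv; set w := v *m A in Vv *; have facts := flow_facts Vv.
have [f0 v0 _ _] := flowP lam0 lam_small H0 HL a w.
move=> [e [c [e0 gc c0 vc c1]]].
(* The competing geodesic may live on a longer interval than the flow is controlled on; it is
   restricted before the comparison. *)
pose e' := Num.min e 2^-1.
have e'0 : 0 < e' by rewrite lt_min e0 invr_gt0 ltr0n.
have e'e : e' <= e by rewrite ge_min lexx.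
have e'2 : e' <= 2^-1 by rewrite ge_min lexx orbT.
have gc' : geodesic g `](- e'), (1 + e')[ c.
  apply: geodesic_sub gc => t /=; rewrite !in_itv/= => /andP[t1 t2]; apply/andP; split.
    by apply: le_lt_trans t1; rewrite lerN2.
  by apply: (lt_le_trans t2); rewrite lerD2l.
have uni := geodesic_unique ax r_img lam_small HL (c := flow_q w) (z := vel_q w) e'0 gc'.
rewrite -c1; apply: uni.
- by move=> t tb; have [d _ _] := facts t (in2 e'2 tb); exact: d.
- by move=> t tb; have [_ d _] := facts t (in2 e'2 tb); exact: d.
- by move=> t tb; have [_ _ d] := facts t (in2 e'2 tb); exact: d.
- by rewrite /flow_q f0 c0 chart_invK.
have I0 : - e < (0 : R) < 1 + e by apply/andP; split; lra.
have [cc gct] := gc.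
have c0c : {for (0 : R), continuous c} by exact: (segment_continuous cc I0).
have yc : chart_dom y (c 0) by rewrite c0.
have xc : chart_dom x (c 0) by rewrite c0.
have [|dcy _ _] := gct 0 y _ ay yc; first by rewrite /= in_itv.
have dcy0 : is_derive (0 : R) 1 (chart_map y \o c : R -> 'rV[R]_n) v.
  have -> : v = 'D_1 (chart_map y \o c : R -> 'rV[R]_n) (0 : R).
    by rewrite -vc /velocity c0 derive1E.
  exact: derivableP (nbhs_singleton dcy).
have [_ dE] := curve_change ay ax c0c yc xc dcy0.
rewrite derive1E dE c0; exact: esym v0.
Qed.

Let exp_mapE v : exp_domain v -> exp_map g q v = chart_inv x (E (v *m A)).
Proof.
move=> Vv; apply: xget_unique; first exact: exp_exists.
by move=> z; exact: exp_unique.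
Qed.

Let exp_domain_open : open exp_domain.
Proof.
have c : continuous (fun v : 'rV[R]_n => E (v *m A)).
  by move=> v; apply: (@continuous_comp _ _ _ (fun v : 'rV[R]_n => v *m A) E);
    [exact: mulmx_continuous|exact: E_continuous].
exact: (open_comp (fun v _ => c v) coord_ball_open).
Qed.

(** By rescaling, the endpoint for [t *: v] is a point of the solution from [a] to the endpoint for
    [v]; convexity bounds its distance to the centre by that of these two points, both in the
    ball. *)
Let exp_domain_star v (t : R) : exp_domain v -> 0 <= t <= 1 -> exp_domain (t *: v).
Proof.
move=> Vv t01; rewrite /exp_domain /= -scalemxAl.
have w4 := small Vv.
have Et : E (t *: (v *m A)) = flow_q (v *m A) t.
  exact: (small_flow_rescale lam0 lam_small H0 HL eps_r eps_s aeps w4 t01).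
rewrite Et; have := small_flow_convex lam0 lam_small H0 HL HK eps_r eps_s eps_K aeps w4 t01.
move=> /le_lt_trans; apply; rewrite gt_max.
by apply/andP; split; [case: Uq|exact: Vv].
Qed.

(** An inverse of [E] obtained by choice; its continuity comes from [E_lower], which makes it
    2-Lipschitz. *)
Let Einv b : {w | E w = b}.
Proof.
apply: cid; apply: perturbed_identity_surj; exact: endpoint_perturbed_identity.
Qed.

Let EinvK b : E (sval (Einv b)) = b. Proof. exact: (svalP (Einv b)). Qed.

Lemma coord_nbhd_normal (N : 'rV[R]_n -> R) : is_norm N -> normal_nbhd g h N q coord_nbhd.
Proof.
move=> hN; split.
  by apply: open_nbhs_nbhs; split => //; exact: coord_nbhd_open.
exists exp_domain; split.
- exact: exp_domain_open.
- rewrite /exp_domain /= mul0mx E0; by case: Uq.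
- by move=> v t; exact: exp_domain_star.
- by move=> v Vv; exists (chart_inv x (E (v *m A))); exact: exp_exists.
have expU v : exp_domain v -> coord_nbhd (exp_map g q v) /\ chart_map x (exp_map g q v) = E (v *m A).
  move=> Vv; rewrite (exp_mapE Vv); have [xE xEE] := chart_imgP (coord_ball_img Vv).
  by split => //; split => //=; rewrite xEE.
split.
- split.
  + by move=> v /expU[].
  + move=> u v; rewrite !inE => Vu Vv uv.
    have [_ eu] := expU u Vu; have [_ ev] := expU v Vv.
    have : u *m A = v *m A by apply: E_inj; rewrite -eu -ev uv.
    by move=> /(f_equal (mulmx^~ B)); rewrite -!mulmxA AB !mulmx1.
  + move=> q' [xq' Uq']; have Vv : exp_domain (sval (Einv (chart_map x q')) *m B).
      by rewrite /exp_domain /= -mulmxA BA mulmx1 EinvK.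
    exists (sval (Einv (chart_map x q')) *m B) => //.
    by rewrite (exp_mapE Vv) -mulmxA BA mulmx1 EinvK chart_invK.
- rewrite continuous_open_subspace; last exact: exp_domain_open.
  move=> v; rewrite inE => Vv.
  apply: (@near_eq_continuous 'rV[R]_n M (fun v : 'rV[R]_n => chart_inv x (E (v *m A))) (exp_map g q) v).
    have : \forall u \near v, exp_domain u.
      by apply: open_nbhs_nbhs; split => //; exact: exp_domain_open.
    by apply: filterS => u Vu; exact/esym/exp_mapE.
  apply: (@continuous_comp _ _ _ (fun v : 'rV[R]_n => E (v *m A)) (chart_inv x)).
    by apply: (@continuous_comp _ _ _ (fun v : 'rV[R]_n => v *m A) E);
      [exact: mulmx_continuous|exact: E_continuous].
  exact: chart_inv_cts (coord_ball_img Vv).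
- exists (fun q' => sval (Einv (chart_map x q')) *m B).
    move=> v; rewrite inE => Vv; have [_ ev] := expU v Vv; rewrite ev.
    have -> : sval (Einv (E (v *m A))) = v *m A by apply: E_inj; exact: EinvK.
    by rewrite -mulmxA AB mulmx1.
  rewrite continuous_open_subspace; last exact: coord_nbhd_open.
  move=> q'; rewrite inE => -[xq' _].
  apply: (@continuous_comp _ _ _ (chart_map x) (fun b => sval (Einv b) *m B)).
    exact: chart_map_cts.
  apply: (@continuous_comp _ _ _ (fun b => sval (Einv b)) (fun v : 'rV[R]_n => v *m B)); last exact: mulmx_continuous.
  apply: (@lipschitz_continuous _ _ _ _ 2) => b b'.
  by apply: (le_trans (E_lower _ _)); rewrite !EinvK.
have [m [CN [m0 CN0 HN]]] := norm_equivalent hN.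
pose KA := n%:R * `|A| + 1; pose KB := n%:R * `|B| + 1.
have KA0 : 0 < KA by rewrite ltr_wpDl// mulr_ge0.
have KB0 : 0 < KB by rewrite ltr_wpDl// mulr_ge0.
(* Constants multiply along a chain: [m] and [CN] compare [N] with the max norm, [KA] and [KB] bound
   the change of basis, 2 bounds [E] and its inverse, and [kap] and [C] compare coordinates with the
   Riemannian distance. *)
exists (kap / (2 * KB * CN)), (C * 2 * KA / m); split.
- by rewrite divr_gt0// !mulr_gt0.
- by rewrite divr_gt0// !mulr_gt0.
move=> u v Vu Vv; rewrite (exp_mapE Vu) (exp_mapE Vv).
have cu : `|E (u *m A) - a0| < rho / 8 := lt_le_trans (coord_ball_close Vu) eps_rho.
have cv : `|E (v *m A) - a0| < rho / 8 := lt_le_trans (coord_ball_close Vv) eps_rho.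
have r84 : rho / 8 < rho / 4 by have := rho0; lra.
have [HN1 HN2] := HN (u - v).
split.
- apply: (@le_trans _ _ (kap * `|E (u *m A) - E (v *m A)|)%:E); last first.
    exact: (riem_dist_lower hh ax rho0 kap0 bounds (lt_trans cu r84) (lt_trans cv r84)).
  have h1 : `|u - v| <= KB * `|u *m A - v *m A|.
    by rewrite -mulmxBl -{1}(mulmx1 (u - v)) -AB mulmxA; exact: mulmx_norm_le.
  have h2 : N (u - v) <= CN * (KB * (2 * `|E (u *m A) - E (v *m A)|)).
    apply: (le_trans HN2); rewrite ler_pM2l//; apply: (le_trans h1).
    by rewrite ler_pM2l//; exact: E_lower.
  rewrite lee_fin; move: h2; set D := `|E _ - E _| => h2.
  have -> : kap * D = kap / (2 * KB * CN) * (CN * (KB * (2 * D))).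
    by field; rewrite !gt_eqF.
  by rewrite ler_pM2l// divr_gt0// !mulr_gt0.
- apply: (le_trans (riem_dist_upper hh ax rho0 C0 bounds cu cv)).
  have h2 : `|u *m A - v *m A| <= KA * `|u - v| by rewrite -mulmxBl; exact: mulmx_norm_le.
  have h3 : `|E (u *m A) - E (v *m A)| <= 2 * (KA * `|u - v|).
    by apply: (le_trans (E_upper _ _)); rewrite ler_pM2l.
  have h4 : `|u - v| <= m^-1 * N (u - v) by rewrite ler_pdivlMl.
  have -> : C * 2 * KA / m * N (u - v) = C * (2 * (KA * (m^-1 * N (u - v)))) by field; rewrite gt_eqF.
  rewrite lee_fin ler_pM2l//; apply: (le_trans h3).
  by rewrite ler_pM2l// ler_pM2l.
Qed.

End at_point.
End normal_neighborhood.

Theorem theorem4p1 (R : realType) (n : nat) (M : manifold R n)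
    (g : M -> 'M[R]_n) (hg : C11_pseudo_riemannian g)
    (h : M -> 'M[R]_n) (hh : smooth_riemannian h)
    (N : M -> 'rV[R]_n -> R) (hN : forall q, is_norm (N q))
    (p : M) (W : set M) (hW : nbhs p W) :
  exists U : set M, [/\ U p, U `<=` W & totally_normal g h N U].
Proof.
pose x := chart_at p; pose a0 := chart_map x p.
have ax : atlas x by exact: chart_at_atlas.
have xp : chart_dom x p by exact: chart_at_dom.
have xa0 : chart_img x a0 by exact: chart_img_map.
have nW : \forall a \near a0, W (chart_inv x a).
  by apply: (chart_inv_cts xa0); rewrite /a0 chart_invK.
have [d1 /= d10 Hd1] := (@nbhs_normP R _ a0 _).1 nW.
have [d2 d20 Hd2] := open_ball_mem (@chart_img_open _ _ _ x) xa0.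
have [rho [kap [C [rho0 kap0 C0 bounds]]]] := local_metric_bounds hh ax xp.
(* A radius below [d2] keeps the truncated ball in the chart image, and one below [d1] places the
   neighborhood inside [W]. *)
have r00 : 0 < Num.min d1 d2 by rewrite lt_min d10.
have LG k i j := christoffel_lipschitz_at k i j hg ax xa0.
have [r [s [lam [K [[r_gt0 rr0 s0 K0] lam0 lam_small [H0 HL] HK]]]]] :=
  clamped_spray_exists LG r00.
have [rd1 rd2] : r < d1 /\ r < d2 by move: rr0; rewrite lt_min => /andP.
(* With this [D], the quantity bounded in [eps_K] equals [eps * D - 25 * eps]; the added 1 makes [D]
   invertible even if [n] or [K] is zero. *)
pose D := 25 * (n%:R * K + 1).
have nK0 : 0 <= n%:R * K by rewrite mulr_ge0.
have D0 : 0 < D by rewrite /D; lra.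
pose eps := Num.min (Num.min (r / 25) (s / 12)) (Num.min D^-1 (rho / 8)).
have eps0 : 0 < eps by rewrite /eps !lt_min invr_gt0 D0 !divr_gt0.
have [e1 e2 e3 e4] : [/\ eps <= r / 25, eps <= s / 12, eps <= D^-1 & eps <= rho / 8].
  by rewrite /eps !ge_min !lexx ?orbT.
have eps_r : 25 * eps <= r by lra.
have eps_s : 12 * eps <= s by lra.
have eps_K : n%:R * (25 * eps) * K <= 1.
  have : eps * D <= 1 by rewrite -ler_pdivlMr// div1r.
  have -> : n%:R * (25 * eps) * K = eps * D - 25 * eps by rewrite /D; ring.
  by lra.
have r_img c : `|c - a0| <= r -> chart_img x c.
  by move=> cr; apply: Hd2; exact: le_lt_trans rd2.
exists (coord_nbhd x a0 eps); split.
- by split => //; rewrite /coord_ball /= -/a0 subrr sqnorm0 exprn_gt0.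
- move=> q [xq Uq]; rewrite -(chart_invK xq); apply: Hd1; rewrite /ball_/= distrC.
  have ce := coord_ball_close eps0 Uq.
  by apply: lt_le_trans ce _; lra.
- split; first exact: coord_nbhd_open.
  move=> q Uq; exact: (coord_nbhd_normal hg hh ax lam0 lam_small H0 HL HK eps0 eps_r eps_s
    eps_K e4 r_img rho0 kap0 C0 bounds Uq (hN q)).
Qed.
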